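(* The positive ground state solution of $$-\Delta u+u=\left(\int_{D_R}\Big(\ln\frac{1}{|x-y|}-\ln\frac{1}{\left|\frac{Rx}{|x|}-\frac{|x|y}{R}\right|}\Big)u^2(y)\,dy\right)u\ \text{ in } D_R,\qquad u=0\ \text{ on }\partial D_R,$$ converges to the trivial solution as $R\to\infty$.
   Context: $D_R\subset\mathbb{R}^2$ denotes the disc of radius $R>0$ centered at the origin. Each $u\in H_0^1(D_R)$ is identified with its extension by zero to $\mathbb{R}^2$. The trivial solution is the zero function. For $x,y\in D_R$, $x\neq y$, put $G(x,y)=\ln\frac{1}{|x-y|}-\ln\frac{1}{\left|\frac{Rx}{|x|}-\frac{|x|y}{R}\right|}$, where $\left|\frac{Rx}{|x|}-\frac{|x|y}{R}\right|$ is understood as $R$ when $x=0$. The energy functional $I_R:H_0^1(D_R)\to\mathbb{R}$ associated with the equation is $$I_R(u)=\frac12\int_{D_R}(|\nabla u|^2+|u|^2)\,dx-\frac14\int_{D_R}\int_{D_R}G(x,y)|u(y)|^2|u(x)|^2\,dx\,dy.$$ It is well defined and $C^1$, and its critical points are the weak solutions of the equation. A ground state solution is a solution of the equation that minimizes $I_R$ among all nontrivial solutions. For each $R>0$ a positive ground state solution exists and is unique. *)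

(* Defs.v *)
From HB Require Import structures.
From mathcomp Require Import all_boot all_order all_algebra.
From mathcomp Require Import all_classical all_reals all_analysis.
Set Implicit Arguments.
Unset Strict Implicit.
Unset Printing Implicit Defensive.
Import Order.TTheory GRing.Theory Num.Theory.
Import numFieldNormedType.Exports.
Local Open Scope classical_set_scope.
Local Open Scope ring_scope.

Section Plane.
Variable R : realType.

(* Points of the plane are pairs; the library norm on R * R is the sup norm,
   hence the separate Euclidean structure. *)
Definition dot (x y : R * R) : R := x.1 * y.1 + x.2 * y.2.

Definition enorm (x : R * R) : R := Num.sqrt (dot x x).

Definition disc (r : R) : set (R * R) := [set x | enorm x < r].

Definition leb2 :
    {measure set (measurableTypeR R * measurableTypeR R)%type -> \bar R} :=
  (@lebesgue_measure R \x @lebesgue_measure R)%E.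

Definition grad (f : R * R -> R) (x : R * R) : R * R :=
  ('D_((1, 0) : R * R) f x, 'D_((0, 1) : R * R) f x).

Fixpoint Ck (n : nat) (f : R * R -> R) : Prop :=
  continuous f /\
  if n is m.+1 then
    [/\ forall x, derivable f x ((1, 0) : R * R),
        forall x, derivable f x ((0, 1) : R * R),
        Ck m ('D_((1, 0) : R * R) f) & Ck m ('D_((0, 1) : R * R) f)]
  else True.

Definition smooth (f : R * R -> R) : Prop := forall n, Ck n f.

Definition test_function (D : set (R * R)) (f : R * R -> R) : Prop :=
  [/\ smooth f, compact (closure [set x | f x != 0]) &
      closure [set x | f x != 0] `<=` D].

Definition square_integrable (f : R * R -> R) : Prop :=
  measurable_fun setT
    (f : (measurableTypeR R * measurableTypeR R)%type -> R) /\
  leb2.-integrable setT (fun x => ((f x) ^+ 2)%:E).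

Definition weak_gradient (f : R * R -> R) (g : R * R -> R * R) : Prop :=
  forall phi, test_function setT phi ->
    (\int[leb2]_x (f x * (grad phi x).1) = - (\int[leb2]_x ((g x).1 * phi x))) /\
    (\int[leb2]_x (f x * (grad phi x).2) = - (\int[leb2]_x ((g x).2 * phi x))).

(* H^1(R^2). An element is a Borel representative of the class of the function
   together with a representative of its weak gradient (which is unique up to
   a null set). *)
Record H1 := MkH1 {
  H1fun :> R * R -> R ;
  wgrad : R * R -> R * R ;
  H1fun_L2 : square_integrable H1fun ;
  wgrad1_L2 : square_integrable (fun x => (wgrad x).1) ;
  wgrad2_L2 : square_integrable (fun x => (wgrad x).2) ;
  wgradP : weak_gradient H1fun wgrad }.

Definition h1norm (f : R * R -> R) (g : R * R -> R * R) : R :=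
  Num.sqrt (\int[leb2]_x (dot (g x) (g x) + (f x) ^+ 2)).

Definition H1norm (u : H1) : R := h1norm u (wgrad u).

(* H_0^1(D), identified through extension by zero with a subspace of H^1(R^2):
   the closure in H^1(R^2) of the smooth functions compactly supported in D. *)
Definition H10 (D : set (R * R)) (u : H1) : Prop :=
  exists phi : nat -> R * R -> R,
    (forall n, test_function D (phi n)) /\
    h1norm (fun x => u x - phi n x) (fun x => wgrad u x - grad (phi n) x)
      @[n --> \oo] --> (0 : R).

Definition trivial (u : H1) : Prop := {ae leb2, forall x, u x = 0}.

(* On the diagonal x = y, a null set, the value is irrelevant. *)
Definition green (r : R) (x y : R * R) : R :=
  ln (1 / enorm (x - y)) -
  ln (1 / (if x == 0 then r
           else enorm ((r / enorm x) *: x - (enorm x / r) *: y))).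

Definition energy (r : R) (u : H1) : R :=
  1 / 2 * (\int[leb2]_(x in disc r)
             (dot (wgrad u x) (wgrad u x) + `|u x| ^+ 2)) -
  1 / 4 * (\int[leb2]_(y in disc r) (\int[leb2]_(x in disc r)
             (green r x y * `|u y| ^+ 2 * `|u x| ^+ 2))).

Definition solution (r : R) (u : H1) : Prop :=
  H10 (disc r) u /\
  forall v : H1, H10 (disc r) v ->
    \int[leb2]_(x in disc r) (dot (wgrad u x) (wgrad v x) + u x * v x) =
    \int[leb2]_(x in disc r)
      ((\int[leb2]_(y in disc r) (green r x y * (u y) ^+ 2)) * u x * v x).

Definition ground_state (r : R) (u : H1) : Prop :=
  [/\ solution r u, ~ trivial u &
      forall v : H1, solution r v -> ~ trivial v -> energy r u <= energy r v].

Definition positive_ground_state (r : R) (u : H1) : Prop :=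
  ground_state r u /\ {ae leb2, forall x, disc r x -> 0 < u x}.

End Plane.

(* Main.v *)
Require Import Defs.
From HB Require Import structures.
From mathcomp Require Import all_boot all_order all_algebra.
From mathcomp Require Import all_classical all_reals all_analysis.
From mathcomp Require Import measurable_realfun.
From mathcomp Require Import ring lra.
Import Order.TTheory GRing.Theory Num.Theory.
Import numFieldNormedType.Exports.
Local Open Scope classical_set_scope.
Local Open Scope ring_scope.
Set Implicit Arguments.
Unset Strict Implicit.
Unset Printing Implicit Defensive.

(** Testing the equation with the solution itself shows that the quadratic and
    the quartic part of the energy balance, so that a solution has energy equal
    to a quarter of its squared norm ([energy_solution]). A ground state is
    therefore no larger than any other nontrivial solution, and it suffices to
    produce, for large [r], one nontrivial solution of small norm.

    Such a solution comes from maximizing the quartic form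
    Q(v) = int int G(x, y) v(y)^2 v(x)^2 on the unit sphere of H_0^1(D_r). If
    S_r is the maximum, the maximizer divided by the square root of S_r solves
    the equation, and its squared norm is 1 / S_r ([critical_jet_exists]). On the
    unit disc the Green function of D_r is at least ln (r / 4) ([green_ge]), so
    one fixed nonzero test function supported there gives S_r >= c ln (r / 4)
    ([ground_state_bound]); the ground state at [r = 1] shows that there is such
    a test function. Hence the squared norm of the ground state is
    O (1 / ln r).

    The maximum is attained for the following reasons. The quartic form is
    bounded, and it is continuous for the L^2 norm on bounded sets, because the
    potential of v^2 is bounded by a multiple of the squared norm of v: the
    logarithmic singularity of G is dominated by a function of the first
    coordinates only, which is a sum of indicators of strips of geometrically
    decreasing width ([green_kernel_le]), and the mass of v^2 in a strip is at
    most its width times the squared norm ([strip_le]). Bounded sequences are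
    precompact in L^2 ([Tst_compact]), by a Poincare inequality on small squares
    ([poincare_cell], [ehrling]). Along a maximizing sequence that is Cauchy in
    L^2 the midpoints are nearly optimal too, and the parallelogram identity then
    makes the sequence Cauchy in the full norm ([almost_max_close]), so that the
    completeness of L^2 ([riesz_fischer]) provides the maximizer.

    A Sobolev function is handled together with its gradient as a triple of L^2
    functions, called a jet, and H_0^1(D_r) is the closure of the jets of test
    functions. *)

(** * Square-integrable functions over a measure *)

Lemma sum_expr_le2 (R : realType) (x : R) n : 0 <= x <= 2^-1 ->
  \sum_(k < n) x ^+ k <= 2.
Proof.
move=> /andP[x0 x1]; suff : \sum_(k < n) x ^+ k + 2 * x ^+ n <= 2.
  by apply: le_trans; rewrite lerDl mulr_ge0// exprn_ge0.
elim: n => [|n ih]; first by rewrite big_ord0 expr0 mulr1 add0r.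
apply: le_trans ih; rewrite big_ord_recr/= exprS -addrA lerD2l.
by have := exprn_ge0 n x0; nra.
Qed.

Lemma nneseries_le (R : realType) (u : nat -> R) (M : R) :
  (forall k, 0 <= u k) -> (forall n, \sum_(k < n) u k <= M) ->
  (\sum_(k <oo) (u k)%:E <= M%:E)%E.
Proof.
move=> u0 uM; apply: lime_le.
  by apply: is_cvg_nneseries => k _ _; rewrite lee_fin.
by apply: nearW => n; rewrite big_mkord sumEFin lee_fin.
Qed.

Lemma discriminant_le0 (R : realType) (a b c : R) : 0 <= c ->
  (forall t, 0 <= a + t * (2 * b) + t ^+ 2 * c) -> b ^+ 2 <= a * c.
Proof.
rewrite le_eqVlt => /predU1P[<-|c0] q.
  have [->|b0] := eqVneq b 0; first by rewrite expr0n mulr0.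
  have := q (- (a + 1) / (2 * b)); rewrite mulr0 addr0 divfK ?mulf_neq0//.
  lra.
have := q (- b / c).
rewrite (_ : _ + _ = (a * c - b ^+ 2) / c).
  by rewrite ler_pdivlMr// mul0r subr_ge0.
by field; rewrite gt_eqF.
Qed.

Section L2.
Context {d : measure_display} {T : measurableType d} {R : realType}.
Variable mu : {measure set T -> \bar R}.
Implicit Types f g h : T -> R.

Definition L1 f := mu.-integrable setT (EFin \o f).
Definition L2 f := measurable_fun setT f /\ L1 (fun x => f x ^+ 2).
Definition ip f g : R := \int[mu]_x (f x * g x).

Lemma L1_measurable {f} : L1 f -> measurable_fun setT f.
Proof. by move=> /integrableP[/measurable_EFinP]. Qed.

Lemma le_L1 f g : measurable_fun setT f -> L1 g ->
  (forall x, `|f x| <= `|g x|) -> L1 f.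
Proof.
move=> mf ig fg; apply: le_integrable ig => //; first exact/measurable_EFinP.
by move=> x _ /=; rewrite lee_fin.
Qed.

Lemma L1D f g : L1 f -> L1 g -> L1 (fun x => f x + g x).
Proof. by move=> lf lg; have := integrableD measurableT lf lg. Qed.

Lemma L1B f g : L1 f -> L1 g -> L1 (fun x => f x - g x).
Proof. by move=> lf lg; have := integrableB measurableT lf lg. Qed.

Lemma L1Z k f : L1 f -> L1 (fun x => k * f x).
Proof. by move=> lf; have := integrableZl measurableT k lf. Qed.

Lemma L1_abs f : L1 f -> L1 (fun x => `|f x|).
Proof. exact: integrable_norm. Qed.

Lemma L2M f g : L2 f -> L2 g -> L1 (fun x => f x * g x).
Proof.
move=> [mf lf] [mg lg].
apply: (@le_L1 _ (fun x => f x ^+ 2 + g x ^+ 2)).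
- exact: measurable_funM.
- exact: L1D.
- move=> x; rewrite [leRHS]ger0_norm ?addr_ge0 ?sqr_ge0// normrM.
  rewrite -(real_normK (num_real (f x))) -(real_normK (num_real (g x))).
  have := normr_ge0 (f x); have := normr_ge0 (g x).
  move: `|f x| `|g x| => a b a0 b0; nra.
Qed.

Lemma L2Z k f : L2 f -> L2 (fun x => k * f x).
Proof.
move=> [mf lf]; split; first exact: measurable_funM.
under [X in L1 X]funext do rewrite exprMn.
exact: L1Z.
Qed.

Lemma L2D f g : L2 f -> L2 g -> L2 (fun x => f x + g x).
Proof.
move=> lf lg; have := L2M lf lg; case: lf lg => mf lf [mg lg] lfg.
split; first exact: measurable_funD.
rewrite [X in L1 X](_ : _ = fun x => (f x ^+ 2 + 2 * (f x * g x)) + g x ^+ 2).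
  apply: L1D => //; apply: L1D => //; exact: L1Z.
by apply/funext => x; ring.
Qed.

Lemma L2B f g : L2 f -> L2 g -> L2 (fun x => f x - g x).
Proof.
move=> lf lg; have := L2D lf (L2Z (-1) lg).
by congr L2; apply/funext => x; rewrite mulN1r.
Qed.

Lemma L2_0 : L2 (fun=> 0).
Proof.
split=> //; under [X in L1 X]funext do rewrite expr0n/=.
exact: (integrable0 mu setT).
Qed.

Lemma ipC f g : ip f g = ip g f.
Proof. by rewrite /ip; congr fine; apply: eq_integral => x _; rewrite mulrC. Qed.

Lemma ipDl f g h : L2 f -> L2 g -> L2 h ->
  ip (fun x => f x + g x) h = ip f h + ip g h.
Proof.
move=> lf lg lh; rewrite /ip -RintegralD//; try exact: L2M.
by apply: eq_Rintegral => x _; rewrite mulrDl.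
Qed.

Lemma ipZl k f g : L2 f -> L2 g -> ip (fun x => k * f x) g = k * ip f g.
Proof.
move=> lf lg; rewrite /ip -RintegralZl//; last exact: L2M.
by apply: eq_Rintegral => x _; rewrite mulrA.
Qed.

Lemma ip_ge0 f : 0 <= ip f f.
Proof. by apply: Rintegral_ge0 => x _; rewrite -expr2 sqr_ge0. Qed.

Lemma L1_fin f : L1 f -> (\int[mu]_x (f x)%:E)%E = (\int[mu]_x f x)%:E.
Proof. by move=> lf; rewrite /Rintegral fineK//; exact: integrable_fin_num. Qed.

Lemma ae_eq_int f g : measurable_fun setT f -> measurable_fun setT g ->
  {ae mu, forall x, f x = g x} ->
  (\int[mu]_x (f x)%:E = \int[mu]_x (g x)%:E)%E.
Proof.
move=> mf mg fg; apply: ae_eq_integral => //; try exact/measurable_EFinP.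
by apply: filterS fg => x fgx _; rewrite fgx.
Qed.

Lemma L1_of_lty f : measurable_fun setT f ->
  (\int[mu]_x `|f x|%:E < +oo)%E -> L1 f.
Proof. by move=> mf fy; apply/integrableP; split; [exact/measurable_EFinP|]. Qed.

Lemma L1_indic A : measurable A -> (mu A < +oo)%E -> L1 \1_A.
Proof.
move=> mA Afin; apply: L1_of_lty; first exact: measurable_indic.
under eq_integral do rewrite ger0_norm//.
by rewrite integral_indic// setIT.
Qed.

Lemma integrable_indicM D f : measurable D ->
  mu.-integrable D (EFin \o f) <-> L1 (fun x => f x * \1_D x).
Proof.
move=> mD; apply: (iff_trans (integrable_mkcond (EFin \o f) mD)).
suff -> : (EFin \o f) \_ D = EFin \o (fun x => f x * \1_D x) by [].
apply/funext => x; rewrite patchE /= indicE.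
by case: ifP => _; rewrite ?mulr1 ?mulr0.
Qed.

Lemma Rintegral_indicM D f : \int[mu]_(x in D) f x = \int[mu]_x (f x * \1_D x).
Proof.
rewrite Rintegral_mkcond; apply: eq_Rintegral => x _; rewrite patchE indicE.
by case: ifP => _; rewrite ?mulr1 ?mulr0.
Qed.

Lemma sqr_indic (D : set T) x : (\1_D x : R) ^+ 2 = \1_D x.
Proof. by rewrite indicE; case: (_ \in _); rewrite ?expr1n// expr0n. Qed.

Lemma ip_expand t f g : L2 f -> L2 g ->
  ip (fun x => f x + t * g x) (fun x => f x + t * g x) =
  ip f f + t * (2 * ip f g) + t ^+ 2 * ip g g.
Proof.
move=> lf lg; have ltg := L2Z t lg.
rewrite ipDl//; last exact: L2D.
rewrite ipC ipDl// (ipC _ (fun x => f x + _)) ipDl// !ipZl// (ipC f (fun x => t * g x)).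
by rewrite !ipZl// (ipC g f) (ipC g (fun x => t * g x)) ipZl//; ring.
Qed.

Lemma cauchy_schwarz f g : L2 f -> L2 g -> ip f g ^+ 2 <= ip f f * ip g g.
Proof.
move=> lf lg.
have q t : 0 <= ip f f + t * (2 * ip f g) + t ^+ 2 * ip g g.
  by rewrite -ip_expand//; exact: ip_ge0.
exact: discriminant_le0 (ip_ge0 g) q.
Qed.

Lemma L2_abs f : L2 f -> L2 (fun x => `|f x|).
Proof.
move=> [mf lf]; split; first exact: measurableT_comp.
by under [X in L1 X]funext do rewrite real_normK ?num_real//.
Qed.

Lemma ip_abs f : ip (fun x => `|f x|) (fun x => `|f x|) = ip f f.
Proof.
by apply: eq_Rintegral => x _; rewrite -!expr2 real_normK ?num_real.
Qed.

Lemma cauchy_schwarz_abs f g : L2 f -> L2 g ->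
  (\int[mu]_x `|f x * g x|) ^+ 2 <= ip f f * ip g g.
Proof.
move=> lf lg; have := cauchy_schwarz (L2_abs lf) (L2_abs lg); rewrite !ip_abs.
by congr (_ ^+ 2 <= _); apply: eq_Rintegral => x _; rewrite normrM.
Qed.

Lemma le_ip f g : L2 g -> (forall x, `|f x| <= `|g x|) ->
  measurable_fun setT f -> L2 f /\ ip f f <= ip g g.
Proof.
move=> [mg lg] fg mf; have fg2 x : `|f x ^+ 2| <= `|g x ^+ 2|.
  by rewrite !normrX lerXn2r// ?nnegrE.
have lf : L2 f by split=> //; apply: le_L1 fg2 => //; exact: measurable_funX.
split=> //; apply: le_Rintegral => //; first by case: lf.
by move=> x _; have := fg2 x; rewrite !ger0_norm ?sqr_ge0.
Qed.

End L2.

Section riesz_fischer.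
Context {d : measure_display} {T : measurableType d} {R : realType}.
Variable mu : {measure set T -> \bar R}.
Variable f : nat -> T -> R.
Hypothesis lf : forall n, L2 mu (f n).
Let diff m n x := f m x - f n x.
Hypothesis cf : forall k m, (k <= m)%N ->
  ip mu (diff m k) (diff m k) <= 8^-1 ^+ k.

(* The weight 2^k leaves the series of squares summable, since 2^k 8^-k = 4^-k. *)
Let w k x := 2 ^+ k * diff k.+1 k x ^+ 2.
Let s x := (\sum_(k <oo) (w k x)%:E)%E.

Let w0 k x : 0 <= w k x. Proof. by rewrite mulr_ge0// sqr_ge0. Qed.

Let mdiff m n : measurable_fun setT (diff m n).
Proof. by apply: measurable_funB; have [] := lf m; have [] := lf n. Qed.

Let mw k : measurable_fun setT (w k).
Proof. by apply: measurable_funM => //; exact: measurable_funX. Qed.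

Let ms : measurable_fun setT s.
Proof.
apply: ge0_emeasurable_sum => [k x _ _|k _]; first by rewrite lee_fin.
exact/measurable_EFinP.
Qed.

Let ints : (\int[mu]_x s x < +oo)%E.
Proof.
rewrite integral_nneseries//; last 2 first.
  by move=> k; exact/measurable_EFinP.
  by move=> k x _; rewrite lee_fin.
apply: (@le_lt_trans _ _ (\sum_(k <oo) (4^-1 ^+ k)%:E)%E).
  apply: lee_nneseries => [k _ _|k _].
    by apply: integral_ge0 => x _; rewrite lee_fin.
  have ldk : L2 mu (diff k.+1 k) by exact: L2B.
  rewrite L1_fin; last by apply: L1Z; case: ldk.
  rewrite lee_fin /w RintegralZl//; last by case: ldk.
  have -> : 4^-1 ^+ k = 2 ^+ k * 8^-1 ^+ k :> R.
    by rewrite -exprMn; congr (_ ^+ _); field.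
  by rewrite ler_pM2l ?exprn_gt0//; have := cf (leqnSn k).
apply: (@le_lt_trans _ _ 2%:E); last exact: ltry.
by apply: nneseries_le => [k|n]; [rewrite exprn_ge0|apply: sum_expr_le2; lra].
Qed.

Let A := [set x | (s x < +oo)%E].

Let mA : measurable A.
Proof.
by rewrite -[A]setTI; exact: emeasurable_fun_infty_o.
Qed.

Let aeA : {ae mu, forall x, A x}.
Proof.
have is_ : mu.-integrable setT s.
  apply/integrableP; split=> //; under eq_integral => x _.
    rewrite gee0_abs; last by apply: nneseries_ge0 => k _ _; rewrite lee_fin.
    over.
  exact: ints.
have := integrable_ae measurableT is_; apply: filterS => x /(_ I) xfin.
by rewrite /A/= ltey_eq xfin.
Qed.

(** The weights turn summability of the squares into summability of the
    increments, by |a| <= 2^k a^2 + 2^-k. *)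
Let cvgA x : A x -> cvgn (f ^~ x).
Proof.
move=> Ax; have sfin : s x \is a fin_num.
  rewrite ge0_fin_numE//.
  by apply: nneseries_ge0 => k _ _; rewrite lee_fin.
have sx n : \sum_(k < n) w k x <= fine (s x).
  rewrite -lee_fin fineK// -sumEFin -(big_mkord xpredT (fun k => (w k x)%:E)).
  by apply: nneseries_lim_ge => k _ _; rewrite lee_fin.
have : cvgn (series (fun k => diff k.+1 k x)).
  apply: normed_cvg; apply: nondecreasing_is_cvgn.
    by apply: nondecreasing_series => k; rewrite normr_ge0.
  exists (fine (s x) + 2) => _ [n _ <-] /=.
  apply: (@le_trans _ _ (\sum_(0 <= k < n) (w k x + 2^-1 ^+ k))).
    apply: ler_sum => k _; rewrite /w exprVn.
    have : (0 : R) < 2 ^+ k by rewrite exprn_gt0.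
    move: (2 ^+ k) (diff _ _ _) => a b a0.
    rewrite -(real_normK (num_real b)); have := normr_ge0 b.
    move: `|b| => c c0; rewrite -(@ler_pM2r _ a)// mulrDl mulVf ?gt_eqF//.
    nra.
  rewrite big_mkord big_split/= lerD ?sx//; apply: sum_expr_le2; lra.
move=> /(@cvgD _ _ _ \oo _ (cst (f 0 x)) _ (f 0 x) _ (cvg_cst _)) /cvgP.
have -> // : cst (f 0 x) + series (fun k => diff k.+1 k x) = f ^~ x.
apply/funext => n.
transitivity (f 0 x + \sum_(0 <= k < n) (f k.+1 x - f k x)); first by [].
by rewrite (telescope_sumr (f ^~ x)) // addrC subrK.
Qed.

(* Cutting off to the full-measure set [A] makes the sequence converge at every
   point, so that its limit is measurable. *)
Let h k x := f k x * \1_A x.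

Let mh k : measurable_fun setT (h k).
Proof.
by apply: measurable_funM; [case: (lf k)|exact: measurable_indic].
Qed.

(** Completeness of L^2, with the rate of convergence kept: the rate comes from
    Fatou's lemma applied to the differences [f m - f k] as [m] goes to infinity. *)
Lemma riesz_fischer : exists g, L2 mu g /\
  forall k, ip mu (fun x => g x - f k x) (fun x => g x - f k x) <= 8^-1 ^+ k.
Proof.
pose g x := limn (h ^~ x).
have hg x : h ^~ x @ \oo --> g x.
  apply: (_ : cvgn (h ^~ x)); rewrite /h indicE.
  have [xA|xA] := boolP (x \in A).
    by under eq_fun do rewrite mulr1; apply: cvgA; rewrite inE in xA.
  by under eq_fun do rewrite mulr0; exact: is_cvg_cst.
have mg : measurable_fun setT g by exact: (measurable_fun_cvg mh).
have hf m k : {ae mu, forall x, (h m x - h k x) ^+ 2 = diff m k x ^+ 2}.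
  by apply: filterS aeA => x Ax; rewrite /h indicE mem_set// !mulr1.
have gf k : {ae mu, forall x, (g x - f k x) ^+ 2 = (g x - h k x) ^+ 2}.
  by apply: filterS aeA => x Ax; rewrite /h indicE mem_set// !mulr1.
have mhm m k : measurable_fun setT (fun x => ((h m x - h k x) ^+ 2)%:E).
  by apply/measurable_EFinP/measurable_funX/measurable_funB.
have key k : (\int[mu]_x ((g x - f k x) ^+ 2)%:E <= (8^-1 ^+ k)%:E)%E.
  have mgf : measurable_fun setT (fun x => (g x - f k x) ^+ 2).
    by apply/measurable_funX/measurable_funB => //; case: (lf k).
  rewrite (ae_eq_int mgf _ (gf k)); last exact/measurable_funX/measurable_funB.
  rewrite (_ : (fun x => _) =
      (fun x => limn_einf (fun m => ((h m x - h k x) ^+ 2)%:E))); last first.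
    apply/funext => x; apply/esym; rewrite is_cvg_limn_einfE; last first.
      apply: cvgP; apply: cvg_EFin; first exact: nearW.
      apply: cvgM; apply: cvgB; [exact: hg|exact: cvg_cst|exact: hg|exact: cvg_cst].
    apply/cvg_lim => //; apply: cvg_EFin; first exact: nearW.
    by apply: cvgM; apply: cvgB; [exact: hg|exact: cvg_cst|exact: hg|exact: cvg_cst].
  apply: le_trans; first by apply: fatou => // m x _; rewrite lee_fin sqr_ge0.
  rewrite limn_einf_lim; apply: lime_le; first exact: is_cvg_einfs.
  exists k => // n /= kn; apply: (@le_trans _ _
      (\int[mu]_x ((h n x - h k x) ^+ 2)%:E)%E).
    by apply: ereal_inf_lbound; exists n => /=.
  rewrite (ae_eq_int _ _ (hf n k)); last 2 first.
    exact/measurable_funX/measurable_funB.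
    exact/measurable_funX.
  have := cf kn; rewrite -lee_fin /ip -L1_fin//.
  by have [] : L2 mu (diff n k) by exact: L2B.
have lgf k : L2 mu (fun x => g x - f k x).
  have mgf : measurable_fun setT (fun x => g x - f k x).
    by apply: measurable_funB => //; case: (lf k).
  split=> //; apply: L1_of_lty; first exact: measurable_funX.
  under eq_integral do rewrite ger0_norm ?sqr_ge0//.
  exact: le_lt_trans (key k) (ltry _).
exists g; split.
  have := L2D (lgf 0) (lf 0); congr (L2 mu _).
  by apply/funext => x; rewrite subrK.
move=> k; have := key k; rewrite L1_fin ?lee_fin//.
by case: (lgf k).
Qed.

End riesz_fischer.

(** * The quadratic form of a symmetric kernel *)

Section kernel_form.
Context {d : measure_display} {T : measurableType d} {R : realType}.
Variable mu : {sigma_finite_measure set T -> \bar R}.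
Variable K : T * T -> R.
Hypothesis mK : measurable_fun setT K.
Hypothesis symK : forall x y, K (x, y) = K (y, x).
Implicit Types p q : T -> R.

Definition potential p x : R := \int[mu]_y (K (x, y) * p y).

Definition kform p q : R := \int[mu]_x (potential p x * q x).

(** With the absolute value inside the integral, this makes the double integrals
    below absolutely convergent against any integrable function. *)
Definition bounded_potential C p :=
  L1 mu p /\ forall x, (\int[mu]_y `|K (x, y) * p y|%:E <= C%:E)%E.

Let mKp p : measurable_fun setT p ->
  measurable_fun setT (fun z : T * T => K z * p z.2).
Proof. by move=> mp; apply: measurable_funM => //; exact: measurableT_comp. Qed.

Let mKpx p x : measurable_fun setT p ->
  measurable_fun setT (fun y => K (x, y) * p y).
Proof.
by move=> mp; apply: measurable_funM => //; exact: measurableT_comp.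
Qed.

Lemma bounded_potential_L1 C p x : bounded_potential C p ->
  L1 mu (fun y => K (x, y) * p y).
Proof.
move=> [lp Kp]; apply: L1_of_lty; first exact/mKpx/(L1_measurable lp).
exact: le_lt_trans (Kp x) (ltry _).
Qed.

Lemma le_bounded_potential C p q : measurable_fun setT q ->
  (forall y, `|q y| <= `|p y|) -> bounded_potential C p ->
  bounded_potential C q.
Proof.
move=> mq qp [lp Kp]; split; first exact: le_L1 lp qp.
have mp := L1_measurable lp.
move=> x; apply: le_trans (Kp x); apply: ge0_le_integral => //.
- exact/measurable_EFinP/measurableT_comp/mKpx.
- exact/measurable_EFinP/measurableT_comp/mKpx.
- by move=> y _; rewrite lee_fin !normrM ler_wpM2l.
Qed.

Lemma bounded_potentialD C C' p q : bounded_potential C p ->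
  bounded_potential C' q -> bounded_potential (C + C') (fun y => p y + q y).
Proof.
move=> [lp Kp] [lq Kq]; split; first exact: L1D.
have [mp mq] := (L1_measurable lp, L1_measurable lq).
move=> x; rewrite EFinD; apply: le_trans (leeD (Kp x) (Kq x)).
rewrite -ge0_integralD//; try by [move=> y _; rewrite lee_fin|
  exact/measurable_EFinP/measurableT_comp/mKpx].
apply: ge0_le_integral => //.
- exact/measurable_EFinP/measurableT_comp/mKpx/measurable_funD.
- by apply: emeasurable_funD; exact/measurable_EFinP/measurableT_comp/mKpx.
- by move=> y _; rewrite -EFinD lee_fin mulrDr ler_normD.
Qed.

Lemma bounded_potentialZ C k p : bounded_potential C p ->
  bounded_potential (`|k| * C) (fun y => k * p y).
Proof.
move=> [lp Kp]; split; first exact: L1Z.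
have mp := L1_measurable lp.
move=> x; under eq_integral do rewrite mulrCA normrM EFinM.
rewrite ge0_integralZl_EFin//; last exact/measurable_EFinP/measurableT_comp/mKpx.
by rewrite EFinM lee_wpmul2l// lee_fin.
Qed.

(** The positive and the negative part of the integrand are treated separately,
    because without a decay of the potential the integrand need not be integrable
    on the product space. *)
Lemma measurable_potential p : measurable_fun setT p ->
  measurable_fun setT (potential p).
Proof.
move=> mp; apply: (measurableT_comp (@fine_measurable R setT measurableT)) => //.
pose f (z : T * T) := (K z * p z.2)%:E.
have mf : measurable_fun setT f by apply/measurable_EFinP; exact: mKp.
rewrite (_ : (fun x => _) =
    (fun x => \int[mu]_y f^\+ (x, y) - \int[mu]_y f^\- (x, y))%E); last first.
  apply/funext => x; rewrite integralE; congr (_ - _)%E;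
    by apply: eq_integral => y _; rewrite ?funeposE ?funenegE.
apply: emeasurable_funB.
- by apply: measurable_fun_fubini_tonelli_F => //; exact: measurable_funepos.
- by apply: measurable_fun_fubini_tonelli_F => //; exact: measurable_funeneg.
Qed.

Lemma normr_potential_le C p x : bounded_potential C p -> `|potential p x| <= C.
Proof.
move=> bp; have lx := bounded_potential_L1 x bp.
rewrite -lee_fin; apply: le_trans (bp.2 x).
rewrite L1_fin ?lee_fin; last exact: L1_abs.
exact: le_normr_Rintegral.
Qed.

Lemma potentialD C C' p q x : bounded_potential C p -> bounded_potential C' q ->
  potential (fun y => p y + q y) x = potential p x + potential q x.
Proof.
move=> bp bq; rewrite /potential -RintegralD//; last 2 first.
  exact: bounded_potential_L1 bp.
  exact: bounded_potential_L1 bq.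
by apply: eq_Rintegral => y _; rewrite mulrDr.
Qed.

Lemma potentialZ C k p x : bounded_potential C p ->
  potential (fun y => k * p y) x = k * potential p x.
Proof.
move=> bp; rewrite /potential -RintegralZl//; last exact: bounded_potential_L1 bp.
by apply: eq_Rintegral => y _; rewrite mulrCA.
Qed.

Lemma L1_potentialM C p q : bounded_potential C p -> L1 mu q ->
  L1 mu (fun x => potential p x * q x).
Proof.
move=> bp lq; apply: (le_L1 (g := fun x => C * q x)).
- apply: measurable_funM; last exact: L1_measurable lq.
  exact/measurable_potential/(L1_measurable bp.1).
- exact: L1Z.
- move=> x; rewrite !normrM ler_wpM2r//.
  by rewrite (le_trans (normr_potential_le x bp))// ler_norm.
Qed.

Lemma kformDr C p q q' : bounded_potential C p -> L1 mu q -> L1 mu q' ->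
  kform p (fun x => q x + q' x) = kform p q + kform p q'.
Proof.
move=> bp lq lq'; rewrite /kform -RintegralD//; try exact: L1_potentialM bp _.
by apply: eq_Rintegral => x _; rewrite mulrDr.
Qed.

Lemma kformZr C k p q : bounded_potential C p -> L1 mu q ->
  kform p (fun x => k * q x) = k * kform p q.
Proof.
move=> bp lq; rewrite /kform -RintegralZl//; last exact: L1_potentialM bp _.
by apply: eq_Rintegral => x _; rewrite mulrCA.
Qed.

Lemma kformDl C C' p p' q : bounded_potential C p -> bounded_potential C' p' ->
  L1 mu q -> kform (fun x => p x + p' x) q = kform p q + kform p' q.
Proof.
move=> bp bp' lq; rewrite /kform -RintegralD//; last 2 first.
  exact: L1_potentialM bp _.
  exact: L1_potentialM bp' _.
by apply: eq_Rintegral => x _; rewrite (potentialD _ bp bp') mulrDl.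
Qed.

Lemma kformZl C k p q : bounded_potential C p -> L1 mu q ->
  kform (fun x => k * p x) q = k * kform p q.
Proof.
move=> bp lq; rewrite /kform -RintegralZl//; last exact: L1_potentialM bp _.
by apply: eq_Rintegral => x _; rewrite (potentialZ _ _ bp) mulrA.
Qed.

Lemma normr_kform_le C p q : bounded_potential C p -> L1 mu q ->
  `|kform p q| <= C * \int[mu]_x `|q x|.
Proof.
move=> bp lq; have lpq := L1_potentialM bp lq.
apply: le_trans; first exact: le_normr_Rintegral.
have laq : L1 mu (fun x => `|q x|) by exact: L1_abs.
rewrite -RintegralZl//; apply: le_Rintegral => //.
- exact: L1_abs.
- exact: L1Z.
- by move=> x _; rewrite normrM ler_wpM2r// (normr_potential_le x bp).
Qed.

(** Fubini's theorem: a bounded potential on one side and integrability on the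
    other make the kernel times [p y * q x] integrable on the product. *)
Lemma kformC C C' p q : bounded_potential C p -> bounded_potential C' q ->
  kform p q = kform q p.
Proof.
move=> bp bq; have [mp mq] := (L1_measurable bp.1, L1_measurable bq.1).
pose f (z : T * T) := (K z * p z.2 * q z.1)%:E.
have mf : measurable_fun setT f.
  apply/measurable_EFinP/measurable_funM; first exact: mKp.
  exact: measurableT_comp.
have intf : (mu \x mu)%E.-integrable setT f.
  apply/integrable12ltyP => //.
  apply: (@le_lt_trans _ _ (\int[mu]_x (C * `|q x|)%:E)%E).
    apply: ge0_le_integral => //.
    - by move=> x _; exact: integral_ge0.
    - apply: (measurable_fun_fubini_tonelli_F (abse \o f)) => [|z].
        exact: measurableT_comp.
      exact: abse_ge0.
    - apply/measurable_EFinP/measurable_funM => //; exact: measurableT_comp.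
    - move=> x _; rewrite /f /=.
      under eq_integral do rewrite normrM mulrC EFinM.
      rewrite ge0_integralZl_EFin//; last exact/measurable_EFinP/measurableT_comp/mKpx.
      by rewrite muleC EFinM lee_wpmul2r ?lee_fin//; exact: bp.2.
  rewrite L1_fin ?ltry//; apply: L1Z; apply: L1_abs; exact: bq.1.
rewrite /kform /Rintegral; congr fine; transitivity (\int[mu]_x \int[mu]_y f (x, y))%E.
  apply: eq_integral => x _; rewrite /f/= L1_fin.
    by rewrite RintegralZr//; exact: bounded_potential_L1 bp.
  under [X in L1 _ X]funext do rewrite mulrC.
  by apply: L1Z; exact: bounded_potential_L1 bp.
rewrite (Fubini intf); apply: eq_integral => y _; rewrite /f/=.
under eq_integral do rewrite symK mulrAC.
rewrite L1_fin.
  by rewrite RintegralZr//; exact: bounded_potential_L1 bq.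
under [X in L1 _ X]funext do rewrite mulrC.
by apply: L1Z; exact: bounded_potential_L1 bq.
Qed.

End kernel_form.

(** * Jets: a function together with its gradient *)

(** The three components stand for a function and its two partial derivatives. *)
Definition jet (T R : Type) : Type := (T -> R) * (T -> R) * (T -> R).

Section jets.
Context {d : measure_display} {T : measurableType d} {R : realType}.
Variable mu : {measure set T -> \bar R}.

Implicit Types F G H : jet T R.

Definition L2J F := [/\ L2 mu F.1.1, L2 mu F.1.2 & L2 mu F.2].

Definition ipJ F G := ip mu F.1.1 G.1.1 + ip mu F.1.2 G.1.2 + ip mu F.2 G.2.

Definition lin (a : R) F (b : R) G : jet T R :=
  (fun x => a * F.1.1 x + b * G.1.1 x, fun x => a * F.1.2 x + b * G.1.2 x,
   fun x => a * F.2 x + b * G.2 x).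

Local Notation N F := (ipJ F F).

Lemma L2_lin a (f : T -> R) b g : L2 mu f -> L2 mu g ->
  L2 mu (fun x => a * f x + b * g x).
Proof. by move=> lf lg; apply: L2D; exact: L2Z. Qed.

Lemma L2J_lin a F b G : L2J F -> L2J G -> L2J (lin a F b G).
Proof. by move=> [? ? ?] [? ? ?]; split; exact: L2_lin. Qed.

Lemma ip_linl a (f : T -> R) b g h : L2 mu f -> L2 mu g -> L2 mu h ->
  ip mu (fun x => a * f x + b * g x) h = a * ip mu f h + b * ip mu g h.
Proof. by move=> lf lg lh; rewrite ipDl ?ipZl//; exact: L2Z. Qed.

Lemma ipJ_linl a F b G H : L2J F -> L2J G -> L2J H ->
  ipJ (lin a F b G) H = a * ipJ F H + b * ipJ G H.
Proof. by move=> [? ? ?] [? ? ?] [? ? ?]; rewrite /ipJ/= !ip_linl//; ring. Qed.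

Lemma ipJC F G : ipJ F G = ipJ G F.
Proof. by rewrite /ipJ; congr (_ + _ + _); exact: ipC. Qed.

Lemma normJ_lin a F b G : L2J F -> L2J G ->
  N (lin a F b G) = a ^+ 2 * N F + 2 * a * b * ipJ F G + b ^+ 2 * N G.
Proof.
move=> lF lG; have lL := L2J_lin a b lF lG.
by rewrite ipJ_linl// (ipJC F) (ipJC G) !ipJ_linl// (ipJC G F); ring.
Qed.

Lemma normJ_ge0 F : 0 <= N F.
Proof. by rewrite /ipJ !addr_ge0// ip_ge0. Qed.

Lemma le_ip_normJ F : ip mu F.1.1 F.1.1 <= N F.
Proof. by rewrite /ipJ -addrA lerDl addr_ge0// ip_ge0. Qed.

Lemma normJ_lin_le a F b G : L2J F -> L2J G ->
  N (lin a F b G) <= 2 * a ^+ 2 * N F + 2 * b ^+ 2 * N G.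
Proof.
move=> lF lG; have := normJ_ge0 (lin a F (- b) G).
by rewrite !normJ_lin// sqrrN mulrN mulNr; lra.
Qed.

Lemma cauchy_schwarzJ F G : L2J F -> L2J G -> ipJ F G ^+ 2 <= N F * N G.
Proof.
move=> lF lG; have q t : 0 <= N F + t * (2 * ipJ F G) + t ^+ 2 * N G.
  have := normJ_ge0 (lin 1 F t G); rewrite normJ_lin// expr1n mul1r; congr (0 <= _).
  by ring.
exact: discriminant_le0 (normJ_ge0 G) q.
Qed.

Definition cvJ (F_ : nat -> jet T R) F := N (lin 1 F (-1) (F_ n)) @[n --> \oo] --> (0 : R).

Lemma cvg0_sqr_le (x u : nat -> R) (B : R) :
  u n @[n --> \oo] --> (0 : R) -> (forall n, x n ^+ 2 <= u n * B) ->
  x n @[n --> \oo] --> (0 : R).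
Proof.
move=> u0 xu; apply/cvgr0Pnorm_lt => e e0.
have uB : u n * B @[n --> \oo] --> (0 : R) by rewrite -(mul0r B); apply: cvgM => //; exact: cvg_cst.
apply: filterS (cvgr_lt _ uB _ (exprn_gt0 2 e0)) => n uBn.
rewrite -(ltr_pXn2r (n := 2))// ?nnegrE ?(ltW e0)// real_normK ?num_real//.
exact: le_lt_trans (xu n) uBn.
Qed.

Lemma cvJ_ipJ (F_ : nat -> jet T R) F G : (forall n, L2J (F_ n)) -> L2J F -> L2J G -> cvJ F_ F ->
  ipJ (F_ n) G @[n --> \oo] --> ipJ F G.
Proof.
move=> lF_ lF lG FF; apply/subr_cvg0; apply: (cvg0_sqr_le FF (B := N G)) => n.
have lD := L2J_lin 1 (-1) lF (lF_ n).
have := cauchy_schwarzJ lD lG; rewrite ipJ_linl//.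
by rewrite -sqrrN; congr (_ ^+ 2 <= _); ring.
Qed.

Lemma cvJ_normJ (F_ : nat -> jet T R) F : (forall n, L2J (F_ n)) -> L2J F -> cvJ F_ F ->
  N (F_ n) @[n --> \oo] --> N F.
Proof.
move=> lF_ lF FF.
have E : (fun n => N (F_ n)) =
    (fun n => 2 * ipJ (F_ n) F - N F + N (lin 1 F (-1) (F_ n))).
  by apply/funext => n; rewrite normJ_lin// (ipJC (F_ n)); ring.
have h : 2 * ipJ (F_ n) F - N F + N (lin 1 F (-1) (F_ n)) @[n --> \oo] -->
    2 * ipJ F F - N F + 0.
  apply: cvgD; last exact: FF.
  apply: cvgB; last exact: cvg_cst.
  by apply: cvgM; [exact: cvg_cst|exact: (cvJ_ipJ lF_ lF lF FF)].
by move: h; rewrite -E (_ : 2 * _ - _ + 0 = N F)//; ring.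
Qed.

Lemma normJ_linB_sym F G : L2J F -> L2J G ->
  N (lin 1 F (-1) G) = N (lin 1 G (-1) F).
Proof. by move=> lF lG; rewrite !normJ_lin// (ipJC F); ring. Qed.

Lemma cvJ_lin a (F_ : nat -> jet T R) F b (G_ : nat -> jet T R) G :
  (forall n, L2J (F_ n)) -> L2J F ->
  (forall n, L2J (G_ n)) -> L2J G -> cvJ F_ F -> cvJ G_ G ->
  cvJ (fun n => lin a (F_ n) b (G_ n)) (lin a F b G).
Proof.
move=> lF_ lF lG_ lG FF GG; pose v n := 2 * a ^+ 2 * N (lin 1 F (-1) (F_ n)) +
  2 * b ^+ 2 * N (lin 1 G (-1) (G_ n)).
have v0 : v n @[n --> \oo] --> 2 * a ^+ 2 * 0 + 2 * b ^+ 2 * 0.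
  by apply: cvgD; apply: cvgM; [exact: cvg_cst|exact: FF|exact: cvg_cst|exact: GG].
rewrite !mulr0 addr0 in v0.
apply: (squeeze_cvgr _ (cvg_cst 0) v0); apply: nearW => n.
rewrite normJ_ge0/=; have lD := L2J_lin 1 (-1) lF (lF_ n).
have lD' := L2J_lin 1 (-1) lG (lG_ n).
apply: le_trans (normJ_lin_le a b lD lD').
rewrite (_ : lin 1 (lin a F b G) _ _ = lin a (lin 1 F (-1) (F_ n)) b (lin 1 G (-1) (G_ n)))//.
by rewrite /lin/=; congr (_, _, _); apply/funext => x; ring.
Qed.

End jets.

(** * Existence of a maximizer and its Euler-Lagrange equation *)

(** The first-order condition at a minimum: the terms of higher order are at most
    a constant times t^2 for |t| <= 1, so they cannot compensate a linear term of
    either sign. *)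
Lemma poly4_ge0 (R : realType) (a x y z : R) :
  (forall t, 0 <= t * a + t ^+ 2 * x + t ^+ 3 * y + t ^+ 4 * z) -> a = 0.
Proof.
move=> h; pose M := `|x| + `|y| + `|z|.
have M0 : 0 <= M by rewrite /M !addr_ge0.
have tail s : `|s| <= 1 -> s ^+ 2 * x + s ^+ 3 * y + s ^+ 4 * z <= s ^+ 2 * M.
  move=> s1; rewrite (_ : _ + _ = s ^+ 2 * (x + s * y + s ^+ 2 * z)); last by ring.
  rewrite ler_wpM2l ?sqr_ge0// /M !lerD ?ler_norm//.
    rewrite (le_trans (ler_norm _))// normrM ler_piMl//.
  by rewrite (le_trans (ler_norm _))// normrM ler_piMl// normrX exprn_ile1.
have key s : 0 < s <= 1 -> `|a| <= s * M.
  move=> /andP[s0 s1]; have ns : `|s| <= 1 by rewrite gtr0_norm.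
  have nNs : `|- s| <= 1 by rewrite normrN.
  have hs := le_trans (h s) (_ : _ <= s * a + s ^+ 2 * M).
  have hN := le_trans (h (- s)) (_ : _ <= - s * a + (- s) ^+ 2 * M).
  have {}hs : 0 <= s * a + s ^+ 2 * M by apply: hs; rewrite -!addrA lerD2l addrA tail.
  have {}hN : 0 <= - s * a + (- s) ^+ 2 * M.
    by apply: hN; rewrite -!addrA lerD2l addrA tail.
  have {}hs : 0 <= a + s * M by rewrite -(pmulr_rge0 _ s0) mulrDr mulrA -expr2.
  have {}hN : 0 <= - a + s * M.
    by rewrite -(pmulr_rge0 _ s0) mulrDr mulrA -expr2 mulrN -mulNr -(sqrrN s).
  by rewrite ler_norml; apply/andP; split; lra.
apply/eqP; rewrite -normr_eq0; apply/negP => /negP a0.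
have a0' : 0 < `|a| by rewrite lt_neqAle eq_sym a0 normr_ge0.
have := key (Num.min 1 (`|a| / (2 * (M + 1)))).
have d0 : 0 < `|a| / (2 * (M + 1)) by rewrite divr_gt0// mulr_gt0//; lra.
rewrite lt_min ltr01 d0 ge_min lexx => /(_ isT); apply/negP; rewrite -ltNge.
apply: (@le_lt_trans _ _ (`|a| / (2 * (M + 1)) * M)).
  by rewrite ler_wpM2r// ge_min lexx orbT.
rewrite mulrAC ltr_pdivrMr ?mulr_gt0//; [|lra].
by rewrite ltr_pM2l//; lra.
Qed.

Section variational.
Context {d : measure_display} {T : measurableType d} {R : realType}.
Variable mu : {sigma_finite_measure set T -> \bar R}.
Variable K : T * T -> R.
Hypothesis mK : measurable_fun setT K.
Hypothesis symK : forall x y, K (x, y) = K (y, x).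
Implicit Types F G H : jet T R.

Local Notation N F := (ipJ mu F F).
Local Notation A := (kform mu K).

Variable Tst : jet T R -> Prop.
Hypothesis Tst_L2 : forall F, Tst F -> L2J mu F.
Hypothesis Tst_lin : forall a F b G, Tst F -> Tst G -> Tst (lin a F b G).

Definition jet_closure F := L2J mu F /\
  exists F_ : nat -> jet T R, (forall n, Tst (F_ n)) /\ cvJ mu F_ F.

Variable C : R.
Hypothesis C0 : 0 <= C.
Hypothesis Tst_potential : forall F, jet_closure F ->
  bounded_potential mu K (C * N F) (fun x => F.1.1 x ^+ 2).
Hypothesis Tst_compact : forall F_ : nat -> jet T R, (forall n, Tst (F_ n)) ->
  (forall n, N (F_ n) <= 1) -> forall U : set_system nat, UltraFilter U ->
  forall e : R, 0 < e -> exists2 B, U B & forall n m, B n -> B m ->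
    ip mu (fun x => (F_ n).1.1 x - (F_ m).1.1 x)
          (fun x => (F_ n).1.1 x - (F_ m).1.1 x) <= e.

Definition quartic F := A (fun x => F.1.1 x ^+ 2) (fun x => F.1.1 x ^+ 2).

Lemma jet_closure_lin a F b G : jet_closure F -> jet_closure G ->
  jet_closure (lin a F b G).
Proof.
move=> [lF [F_ [tF FF]]] [lG [G_ [tG GG]]]; split; first exact: L2J_lin.
exists (fun n => lin a (F_ n) b (G_ n)); split; first by move=> n; exact: Tst_lin.
by apply: cvJ_lin => // n; exact: Tst_L2.
Qed.

Lemma cvJ_cst F : L2J mu F -> cvJ mu (fun=> F) F.
Proof.
move=> lF; rewrite /cvJ (_ : (fun=> _) = fun=> 0); first exact: cvg_cst.
by apply/funext => n; rewrite normJ_lin//; ring.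
Qed.

Lemma Tst_closure F : Tst F -> jet_closure F.
Proof.
by move=> tF; split; [exact: Tst_L2|exists (fun=> F); split=> //; exact/cvJ_cst/Tst_L2].
Qed.

Let L1sqr F : jet_closure F -> L1 mu (fun x => F.1.1 x ^+ 2).
Proof. by move=> [[[]]]. Qed.

Let prod_potential F G : jet_closure F -> jet_closure G ->
  bounded_potential mu K (C * N F + C * N G) (fun x => F.1.1 x * G.1.1 x).
Proof.
move=> cF cG; have := bounded_potentialD mK (Tst_potential cF) (Tst_potential cG).
apply: le_bounded_potential => //.
  have [[[mF _] _ _] _] := cF; have [[[mG _] _ _] _] := cG.
  exact: measurable_funM.
move=> x; rewrite normrM [leRHS]ger0_norm ?addr_ge0 ?sqr_ge0//.
rewrite -(real_normK (num_real (F.1.1 x))) -(real_normK (num_real (G.1.1 x))).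
have := normr_ge0 (F.1.1 x); have := normr_ge0 (G.1.1 x).
move: `|F.1.1 x| `|G.1.1 x| => a b a0 b0; nra.
Qed.

(** By the symmetry of the kernel the difference is the form at f^2 + g^2 and
    f^2 - g^2. The potential of the first is bounded, and the second is small in
    L^1 as soon as f - g is small in L^2: on bounded sets, the quartic form is
    continuous for the L^2 norm of the first component alone. *)
Lemma quartic_diff F G : jet_closure F -> jet_closure G ->
  (quartic F - quartic G) ^+ 2 <= (C * (N F + N G)) ^+ 2 *
  (ip mu (fun x => F.1.1 x - G.1.1 x) (fun x => F.1.1 x - G.1.1 x) *
   ip mu (fun x => F.1.1 x + G.1.1 x) (fun x => F.1.1 x + G.1.1 x)).
Proof.
move=> cF cG; have [bF bG] := (Tst_potential cF, Tst_potential cG).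
have [lF lG] := (L1sqr cF, L1sqr cG).
have [[lf _ _] _] := cF; have [[lg _ _] _] := cG.
have lfg := L1B lF lG.
have -> : quartic F - quartic G = A (fun x => F.1.1 x ^+ 2 + G.1.1 x ^+ 2)
    (fun x => F.1.1 x ^+ 2 - G.1.1 x ^+ 2).
  rewrite (kformDl mK bF bG)// /quartic.
  have sub p c : bounded_potential mu K c p ->
      A p (fun x => F.1.1 x ^+ 2 - G.1.1 x ^+ 2) =
      A p (fun x => F.1.1 x ^+ 2) - A p (fun x => G.1.1 x ^+ 2).
    move=> bp; have := kformDr mK bp lF (L1Z (-1) lG).
    rewrite (kformZr mK (-1) bp lG) mulN1r => <-.
    by congr (kform _ _ _ _); apply/funext => x; rewrite mulN1r.
  rewrite !(sub _ _ bF) !(sub _ _ bG) (kformC mK symK bG bF).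
  by rewrite addrA subrK.
have bFG := bounded_potentialD mK bF bG.
have := normr_kform_le mK bFG lfg.
rewrite -(ler_pXn2r (n := 2))// ?nnegrE; last first.
  rewrite mulr_ge0 ?addr_ge0 ?mulr_ge0 ?normJ_ge0//.
  by apply: Rintegral_ge0.
rewrite real_normK ?num_real// => /le_trans; apply.
rewrite exprMn -mulrDr ler_wpM2l ?sqr_ge0//.
apply: le_trans (cauchy_schwarz_abs (L2B lf lg) (L2D lf lg)).
by rewrite le_eqVlt; apply/orP; left; apply/eqP; congr (_ ^+ 2);
  apply: eq_Rintegral => x _; congr (`|_|); ring.
Qed.

Lemma quartic_scale a F : jet_closure F -> quartic (lin a F 0 F) = a ^+ 4 * quartic F.
Proof.
move=> cF; have bF := Tst_potential cF; have lF := L1sqr cF.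
rewrite /quartic/= (_ : (fun x => _) = (fun x => a ^+ 2 * F.1.1 x ^+ 2)); last first.
  by apply/funext => x; ring.
by rewrite (kformZl mK (a ^+ 2) bF (L1Z _ lF)) (kformZr mK _ bF lF); ring.
Qed.

Lemma quartic_le F : jet_closure F -> quartic F <= C * N F ^+ 2.
Proof.
move=> cF; have bF := Tst_potential cF; have lF := L1sqr cF.
apply: le_trans (ler_norm _) _; apply: le_trans (normr_kform_le mK bF lF) _.
rewrite expr2 mulrA ler_wpM2l ?mulr_ge0 ?normJ_ge0//.
apply: le_trans (le_ip_normJ mu F).
by rewrite le_eqVlt; apply/orP; left; apply/eqP; apply: eq_Rintegral => x _;
  rewrite ger0_norm ?sqr_ge0.
Qed.

Lemma cvJ_quartic (F_ : nat -> jet T R) F : (forall n, jet_closure (F_ n)) ->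
  jet_closure F -> cvJ mu F_ F -> quartic (F_ n) @[n --> \oo] --> quartic F.
Proof.
move=> cF_ cF FF; have lF_ n : L2J mu (F_ n) := (cF_ n).1; have lF := cF.1.
have cN := cvJ_normJ lF_ lF FF.
have [B [_ hB]] := cvg_seq_bounded (cvgP _ cN).
have {}hB n : N (F_ n) <= `|B| + 1.
  apply: le_trans (ler_norm _) _; apply: hB => //.
  by rewrite (le_lt_trans (ler_norm _))// ltrDl.
pose D := (C * (`|B| + 1 + N F)) ^+ 2 * (2 * (`|B| + 1) + 2 * N F).
apply/subr_cvg0; apply: (cvg0_sqr_le FF (B := D)) => n.
apply: le_trans (quartic_diff (cF_ n) cF) _; rewrite /D mulrCA.
have lD : ip mu (fun x => (F_ n).1.1 x - F.1.1 x) (fun x => (F_ n).1.1 x - F.1.1 x)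
    <= N (lin 1 F (-1) (F_ n)).
  rewrite -normJ_linB_sym//; apply: le_trans (le_ip_normJ mu _).
  rewrite le_eqVlt; apply/orP; left; apply/eqP; congr (ip mu _ _); apply/funext => x /=; ring.
have lS : ip mu (fun x => (F_ n).1.1 x + F.1.1 x) (fun x => (F_ n).1.1 x + F.1.1 x)
    <= 2 * (`|B| + 1) + 2 * N F.
  apply: (@le_trans _ _ (N (lin 1 (F_ n) 1 F))).
    apply: le_trans (le_ip_normJ mu _).
    rewrite le_eqVlt; apply/orP; left; apply/eqP; congr (ip mu _ _); apply/funext => x /=; ring.
  apply: le_trans (normJ_lin_le 1 1 (lF_ n) lF) _.
  by rewrite expr1n !mulr1 lerD2r ler_pM2l// hB.
have NF := normJ_ge0 mu F; have NFn := normJ_ge0 mu (F_ n); have B0 := normr_ge0 B.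
apply: ler_pM => //; [exact: ip_ge0|by rewrite mulr_ge0 ?sqr_ge0 ?ip_ge0|].
apply: ler_pM => //; [exact: sqr_ge0|exact: ip_ge0|].
apply: lerXn2r; rewrite ?nnegrE.
- by apply: mulr_ge0 => //; exact: addr_ge0.
- by apply: mulr_ge0 => //; apply: addr_ge0 => //; exact: addr_ge0.
- by rewrite ler_wpM2l// lerD2r.
Qed.

Variable F0 : jet T R.
Hypothesis tF0 : Tst F0.
Hypothesis qF0 : 0 < quartic F0.

Let values := [set q | exists F, [/\ Tst F, N F <= 1 & q = quartic F]].
Let S := sup values.

Let Tst_scale a F : Tst F -> Tst (lin a F 0 F). Proof. by move=> tF; exact: Tst_lin. Qed.

Let normJ_scale a F : Tst F -> N (lin a F 0 F) = a ^+ 2 * N F.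
Proof. by move=> tF; rewrite normJ_lin; [ring|exact: Tst_L2|exact: Tst_L2]. Qed.

Let has_sup_values : has_sup values.
Proof.
split; first by exists (quartic (lin 0 F0 0 F0)), (lin 0 F0 0 F0); split=> //;
  [exact: Tst_scale|rewrite normJ_scale// expr0n mul0r].
exists C => _ [F [tF NF ->]]; apply: le_trans (quartic_le (Tst_closure tF)) _.
by rewrite ler_piMr// exprn_ile1// normJ_ge0.
Qed.

Let quartic_le_sup F : Tst F -> N F <= 1 -> quartic F <= S.
Proof. by move=> tF NF; apply: ub_le_sup; [case: has_sup_values|exists F]. Qed.

Let S_ge0 : 0 <= S.
Proof.
have := @quartic_le_sup (lin 0 F0 0 F0) (Tst_scale 0 tF0).
rewrite normJ_scale// expr0n mul0r ler01 quartic_scale ?expr0n ?mul0r; last exact: Tst_closure.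
by move=> /(_ isT).
Qed.

Let Tst_quartic_bound F : Tst F -> quartic F <= S * N F ^+ 2.
Proof.
move=> tF; have := normJ_ge0 mu F; rewrite le_eqVlt => /predU1P[NF|NF].
  by have := quartic_le (Tst_closure tF); rewrite -NF expr0n !mulr0.
pose a := (Num.sqrt (N F))^-1.
have a2 : a ^+ 2 = (N F)^-1 by rewrite exprVn sqr_sqrtr// ltW.
have := @quartic_le_sup (lin a F 0 F) (Tst_scale a tF).
rewrite normJ_scale// a2 mulVf ?gt_eqF// lexx => /(_ isT).
rewrite quartic_scale; last exact: Tst_closure.
rewrite (_ : a ^+ 4 = (N F ^+ 2)^-1); last by rewrite -exprVn -a2 -exprM.
by rewrite mulrC ler_pdivrMr// exprn_gt0.
Qed.

(* Positivity is where the jet [F0] enters. *)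
Let S_gt0 : 0 < S.
Proof.
have h := lt_le_trans qF0 (Tst_quartic_bound tF0).
rewrite lt_neqAle S_ge0 andbT; apply/eqP => S0.
by move: h; rewrite -S0 mul0r ltxx.
Qed.

Let quartic_bound F : jet_closure F -> quartic F <= S * N F ^+ 2.
Proof.
move=> cF; have [lF [F_ [tF FF]]] := cF.
have cN := cvJ_normJ (fun n => Tst_L2 (tF n)) lF FF.
have cQ := cvJ_quartic (fun n => Tst_closure (tF n)) cF FF.
have cS : S * N (F_ n) ^+ 2 @[n --> \oo] --> S * N F ^+ 2.
  by apply: cvgM; [exact: cvg_cst|apply: cvgM; exact: cN].
apply: ler_cvg_to cQ cS _; apply: nearW => n; exact: Tst_quartic_bound.
Qed.

(** Two nearly optimal jets that are close in L^2 have a nearly optimal midpoint,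
    whose norm is therefore close to 1; the parallelogram identity then makes the
    two jets close in the full norm. *)
Let almost_max_close F G e : Tst F -> Tst G -> N F <= 1 -> N G <= 1 -> 0 <= e ->
  S * (1 - e) <= quartic F ->
  ip mu (fun x => F.1.1 x - G.1.1 x) (fun x => F.1.1 x - G.1.1 x) <=
    (S * e / (4 * (C + 1))) ^+ 2 ->
  N (lin 1 F (-1) G) <= 8 * e.
Proof.
move=> tF tG NF NG e0 QF dFG; pose H := lin 2^-1 F 2^-1 G.
have [lF lG] := (Tst_L2 tF, Tst_L2 tG).
have tH : Tst H by exact: Tst_lin.
have NH1 : N H <= 1.
  apply: le_trans (normJ_lin_le 2^-1 2^-1 lF lG) _.
  by move: NF NG; lra.
have cH := Tst_closure tH; have cF := Tst_closure tF.
have QHF : `|quartic F - quartic H| <= S * e.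
  rewrite -(ler_pXn2r (n := 2))// ?nnegrE ?mulr_ge0// real_normK ?num_real//.
  apply: le_trans (quartic_diff cF cH) _.
  have d1 : ip mu (fun x => F.1.1 x - H.1.1 x) (fun x => F.1.1 x - H.1.1 x) <=
      (S * e / (4 * (C + 1))) ^+ 2.
    apply: le_trans dFG.
    have -> : (fun x => F.1.1 x - H.1.1 x) = (fun x => 2^-1 * (F.1.1 x - G.1.1 x)).
      by apply/funext => x /=; field.
    have ld : L2 mu (fun x => F.1.1 x - G.1.1 x) by case: lF lG => [? _ _] [? _ _]; exact: L2B.
    rewrite ipZl ?(ipC _ _ (fun x => 2^-1 * _)) ?ipZl//; try exact: L2Z.
    by have := ip_ge0 mu (fun x => F.1.1 x - G.1.1 x); lra.
  have d2 : ip mu (fun x => F.1.1 x + H.1.1 x) (fun x => F.1.1 x + H.1.1 x) <= 4.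
    apply: (@le_trans _ _ (N (lin 1 F 1 H))).
      apply: le_trans (le_ip_normJ mu _); rewrite le_eqVlt; apply/orP; left; apply/eqP.
      by congr (ip mu _ _); apply/funext => x /=; ring.
    apply: le_trans (normJ_lin_le 1 1 lF (Tst_L2 tH)) _.
    by move: NF NH1; lra.
  apply: (@le_trans _ _ ((C * 2) ^+ 2 * ((S * e / (4 * (C + 1))) ^+ 2 * 4))).
    apply: ler_pM; [exact: sqr_ge0|by rewrite mulr_ge0 ?ip_ge0| |].
      apply: lerXn2r; rewrite ?nnegrE.
      - by apply: mulr_ge0 => //; apply: addr_ge0; exact: normJ_ge0.
      - by rewrite mulr_ge0.
      - by rewrite ler_wpM2l//; move: NF NH1; lra.
    by apply: ler_pM => //; exact: ip_ge0.
  have -> : (C * 2) ^+ 2 * ((S * e / (4 * (C + 1))) ^+ 2 * 4) =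
      (S * e) ^+ 2 * (C / (C + 1)) ^+ 2.
    by field; rewrite gt_eqF//; move: C0; lra.
  rewrite ler_piMr ?sqr_ge0// exprn_ile1// ?divr_ge0//; first by move: C0; lra.
  by rewrite ler_pdivrMr; move: C0; lra.
have QH : S * (1 - 2 * e) <= quartic H.
  by move: QHF; rewrite ler_norml => /andP[_]; move: QF; rewrite !mulrBr; lra.
have QH' : quartic H <= S * N H.
  apply: le_trans (quartic_bound cH) _; rewrite ler_wpM2l// expr2 ler_piMl//.
  exact: normJ_ge0.
have NHe : 1 - 2 * e <= N H by rewrite -(ler_pM2l S_gt0); exact: le_trans QH QH'.
have := normJ_lin 1 (-1) lF lG; have := normJ_lin 2^-1 2^-1 lF lG.
by move: NHe; rewrite -/H; move: (ipJ mu F G) NF NG => b; lra.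
Qed.

Let max_sequence : exists F_ : nat -> jet T R, forall n,
  [/\ Tst (F_ n), N (F_ n) <= 1 & S * (1 - n.+1%:R^-1) <= quartic (F_ n)].
Proof.
suff /choice[F_ hF] : forall n, exists F,
  [/\ Tst F, N F <= 1 & S * (1 - n.+1%:R^-1) <= quartic F] by exists F_.
move=> n.
have e0 : 0 < S * n.+1%:R^-1 by rewrite mulr_gt0.
have [_ [F [tF NF ->]] hF] := sup_adherent e0 has_sup_values.
by exists F; split=> //; rewrite mulrBr mulr1 ltW.
Qed.

(** For every precision, an ultrafilter contains a set of indices on which the jets
    of a maximizing sequence are that close to each other; picking one index in the
    intersection of the first [k] sets gives a rate of convergence. *)
Let fast_sequence : exists F_ : nat -> jet T R,
  [/\ forall n, Tst (F_ n) /\ N (F_ n) <= 1,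
      forall n, S * (1 - n.+1%:R^-1) <= quartic (F_ n) &
      forall k m, (k <= m)%N -> N (lin 1 (F_ m) (-1) (F_ k)) <= 8^-1 ^+ k].
Proof.
have [F_ hF] := max_sequence.
have tF n : Tst (F_ n) by case: (hF n).
have NF n : N (F_ n) <= 1 by case: (hF n).
have [U [uU oU]] := @ultraFilterLemma _ (@eventually) _.
have step k : exists B, U B /\ forall n m, B n -> B m ->
    N (lin 1 (F_ n) (-1) (F_ m)) <= 8^-1 ^+ k /\ (k <= n)%N.
  (* [almost_max_close] loses a factor 8, whence the exponent k + 1. *)
  pose e : R := 8^-1 ^+ k.+1; have e0 : 0 < e by rewrite exprn_gt0.
  have [|B UB hB] := @Tst_compact F_ tF NF U uU ((S * e / (4 * (C + 1))) ^+ 2).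
    by rewrite exprn_gt0// divr_gt0 ?mulr_gt0//; move: C0; lra.
  exists (B `&` [set n | (maxn k (Num.bound e^-1) <= n)%N]); split.
    by apply: filterI => //; apply: oU; exists (maxn k (Num.bound e^-1)).
  move=> n m [Bn /=]; rewrite geq_max => /andP[kn en] [Bm _]; split=> //.
  have -> : 8^-1 ^+ k = 8 * e by rewrite /e exprS mulrA divff// mul1r.
  apply: almost_max_close => //; [exact: ltW| |exact: hB].
  case: (hF n) => _ _; apply: le_trans; rewrite ler_pM2l// lerD2l lerN2.
  rewrite -[leRHS]invrK lef_pV2 ?posrE ?invr_gt0// ltW//.
  have ei : 0 <= e^-1 by rewrite invr_ge0 ltW.
  by apply: (lt_le_trans (archi_boundP ei)); rewrite ler_nat ltnW.
have [B hB] := choice step.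
have UI k : U [set n | forall j, (j <= k)%N -> B j n].
  elim: k => [|k ih].
    apply: filterS (hB 0%N).1 => n B0 j; rewrite leqn0 => /eqP ->; exact: B0.
  apply: filterS (filterI ih (hB k.+1).1) => n [h1 h2] j.
  by rewrite leq_eqVlt ltnS => /predU1P[->|/h1].
have [n_ hn] := choice (fun k => filter_ex (UI k)).
exists (F_ \o n_); split=> /= [k|k|k m km]; first by split.
  have [_ kn] := (hB k).2 _ _ (hn k k (leqnn k)) (hn k k (leqnn k)).
  case: (hF (n_ k)) => _ _; apply: le_trans; rewrite ler_pM2l// lerD2l lerN2.
  by rewrite lef_pV2 ?posrE// ler_nat ltnS.
by have [] := (hB k).2 (n_ m) (n_ k) (hn m k km) (hn k k (leqnn k)).
Qed.

Let maximizer : exists F, [/\ jet_closure F, N F = 1 & quartic F = S].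
Proof.
have [F_ [tNF QF cF]] := fast_sequence.
have tF n := (tNF n).1; have NF n := (tNF n).2.
have lF n := Tst_L2 (tF n).
have comp (c : jet T R -> T -> R) : (forall n, L2 mu (c (F_ n))) ->
    (forall a G b H, c (lin a G b H) = (fun x => a * c G x + b * c H x)) ->
    (forall G, ip mu (c G) (c G) <= N G) ->
    exists g, L2 mu g /\ forall k, ip mu (fun x => g x - c (F_ k) x)
      (fun x => g x - c (F_ k) x) <= 8^-1 ^+ k.
  move=> lc clin cN; apply: riesz_fischer => // k m km.
  apply: le_trans (cF k m km); apply: le_trans (cN _); rewrite clin.
  rewrite le_eqVlt; apply/orP; left; apply/eqP; congr (ip mu _ _); apply/funext => x; ring.
have [f [lf hf]] := comp (fun F => F.1.1) (fun n => let: And3 h _ _ := lF n in h)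
  (fun _ _ _ _ => erefl) (le_ip_normJ mu).
have [g [lg hg]] : exists g, L2 mu g /\ forall k,
    ip mu (fun x => g x - (F_ k).1.2 x) (fun x => g x - (F_ k).1.2 x) <= 8^-1 ^+ k.
  apply: (comp (fun F => F.1.2)) => //; first by move=> n; case: (lF n).
  by move=> G; rewrite /ipJ -addrA addrCA lerDl addr_ge0// ip_ge0.
have [h [lh hh]] : exists h, L2 mu h /\ forall k,
    ip mu (fun x => h x - (F_ k).2 x) (fun x => h x - (F_ k).2 x) <= 8^-1 ^+ k.
  apply: (comp (fun F => F.2)) => //; first by move=> n; case: (lF n).
  by move=> G; rewrite /ipJ addrC lerDl addr_ge0// ip_ge0.
pose F : jet T R := (f, g, h); have lFF : L2J mu F by [].
have FF : cvJ mu F_ F.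
  have b0 : 3 * 8^-1 ^+ n @[n --> \oo] --> (0 : R).
    rewrite -(mulr0 3); apply: cvgM; first exact: cvg_cst.
    by apply: cvg_expr; rewrite gtr0_norm ?invr_gt0// invf_lt1// ltr1n.
  apply: (squeeze_cvgr _ (cvg_cst 0) b0); apply: nearW => n; rewrite normJ_ge0/=.
  apply: (@le_trans _ _ (8^-1 ^+ n + 8^-1 ^+ n + 8^-1 ^+ n)).
    rewrite /ipJ; apply: lerD; first apply: lerD.
    - apply: le_trans (hf n); rewrite le_eqVlt; apply/orP; left; apply/eqP.
      by congr (ip mu _ _); apply/funext => x /=; ring.
    - apply: le_trans (hg n); rewrite le_eqVlt; apply/orP; left; apply/eqP.
      by congr (ip mu _ _); apply/funext => x /=; ring.
    - apply: le_trans (hh n); rewrite le_eqVlt; apply/orP; left; apply/eqP.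
      by congr (ip mu _ _); apply/funext => x /=; ring.
  by move: (8^-1 ^+ n) => a; lra.
have cFF : jet_closure F by split=> //; exists F_.
have QFS : quartic F = S.
  have cQ := cvJ_quartic (fun n => Tst_closure (tF n)) cFF FF.
  have cS : S * (1 - n.+1%:R^-1) @[n --> \oo] --> S * (1 - 0).
    apply: cvgM; first exact: cvg_cst.
    by apply: cvgB; [exact: cvg_cst|exact: cvg_harmonic].
  rewrite subr0 mulr1 in cS.
  apply/eqP; rewrite eq_le; apply/andP; split.
    apply: (ler_cvg_to cQ (cvg_cst S)); apply: nearW => n; exact: quartic_le_sup.
  by apply: (ler_cvg_to cS cQ); exact: nearW.
have NF1 : N F <= 1.
  by apply: (ler_cvg_to (cvJ_normJ lF lFF FF) (cvg_cst (1 : R))); exact: nearW.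
exists F; split=> //; apply/eqP; rewrite eq_le NF1/=.
have := quartic_bound cFF; rewrite QFS -{1}[S]mulr1 ler_pM2l//.
by apply: contraTT; rewrite -!ltNge => NF1'; rewrite exprn_ilt1// normJ_ge0.
Qed.

Let quartic_expand F H : jet_closure F -> jet_closure H -> exists x y z, forall t,
  quartic (lin 1 F t H) = quartic F +
    t * (4 * A (fun x => F.1.1 x ^+ 2) (fun x => F.1.1 x * H.1.1 x)) +
    t ^+ 2 * x + t ^+ 3 * y + t ^+ 4 * z.
Proof.
move=> cF cH; set p := fun x => F.1.1 x ^+ 2; set q := fun x => F.1.1 x * H.1.1 x.
pose r x := H.1.1 x ^+ 2.
have bp := Tst_potential cF; have br := Tst_potential cH.
have bq := prod_potential cF cH.
exists (2 * A p r + 4 * A q q), (4 * A q r), (A r r) => t.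
have btq := bounded_potentialZ mK (2 * t) bq.
have btr := bounded_potentialZ mK (t ^+ 2) br.
have btqr := bounded_potentialD mK btq btr.
have bs := bounded_potentialD mK bp btqr.
pose s x := p x + (2 * t * q x + t ^+ 2 * r x).
have -> : quartic (lin 1 F t H) = A s s.
  have E : (fun x => (lin 1 F t H).1.1 x ^+ 2) = s.
    by apply/funext => x; rewrite /s /p /q /r /=; ring.
  by rewrite /quartic E.
have Al g : L1 mu g -> A s g = A p g + (2 * t * A q g + t ^+ 2 * A r g).
  move=> lg; rewrite (kformDl mK bp btqr lg) (kformDl mK btq btr lg).
  by rewrite (kformZl mK (2 * t) bq lg) (kformZl mK (t ^+ 2) br lg).
rewrite Al; last by case: bs.
rewrite (kformC mK symK bp bs) (kformC mK symK bq bs) (kformC mK symK br bs).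
rewrite !Al; [|by case: br|by case: bq|by case: bp].
rewrite (kformC mK symK bq bp) (kformC mK symK br bp) (kformC mK symK br bq).
rewrite /quartic -/p.
by move: (A p p) (A p q) (A p r) (A q q) (A q r) (A r r) => a b c e g h; ring.
Qed.

(** The maximizer of the quartic form on the unit sphere, rescaled so that the
    Lagrange multiplier is 1; this makes its squared norm the reciprocal of the best
    constant, whence the last clause. *)
Theorem critical_jet_exists : exists U, [/\ jet_closure U, 0 < N U,
  forall H, jet_closure H ->
    ipJ mu U H = A (fun x => U.1.1 x ^+ 2) (fun x => U.1.1 x * H.1.1 x) &
  forall F, Tst F -> N U * quartic F <= N F ^+ 2].
Proof.
have [F [cF NF QF]] := maximizer; have [lF _] := cF.
have EL H : jet_closure H ->
    S * ipJ mu F H = A (fun x => F.1.1 x ^+ 2) (fun x => F.1.1 x * H.1.1 x).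
  move=> cH; have [lH _] := cH; have [x [y [z hQ]]] := quartic_expand cF cH.
  set a := A _ _ in hQ *; set b := ipJ mu F H.
  suff h : 4 * (S * b - a) = 0 by move/eqP: h; rewrite mulf_eq0 pnatr_eq0/= subr_eq0 => /eqP.
  pose e := N H; apply: (@poly4_ge0 _ _ (S * (4 * b ^+ 2 + 2 * e) - x)
    (4 * S * b * e - y) (S * e ^+ 2 - z)) => t.
  have := quartic_bound (jet_closure_lin 1 t cF cH).
  rewrite hQ QF normJ_lin// NF -/b -/e -subr_ge0; congr (0 <= _); ring.
(* The equation is cubic in the unknown: scaling by [c] multiplies its right-hand
   side by c^3 and the left-hand side by [c], and c^2 S = 1 restores equality. *)
pose c := Num.sqrt S^-1; have c2 : c ^+ 2 = S^-1 by rewrite sqr_sqrtr// invr_ge0.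
exists (lin c F 0 F); have NU : N (lin c F 0 F) = S^-1.
  by rewrite normJ_lin// NF c2; ring.
split; first exact: jet_closure_lin.
- by rewrite NU invr_gt0.
- move=> H cH; have [lH _] := cH; rewrite ipJ_linl// mul0r addr0.
  have bF := Tst_potential cF; have lFH : L1 mu (fun x => F.1.1 x * H.1.1 x).
    by have [[? _ _] [? _ _]] := (lF, lH); exact: L2M.
  transitivity (A (fun x => c ^+ 2 * F.1.1 x ^+ 2) (fun x => c * (F.1.1 x * H.1.1 x))).
    rewrite (kformZl mK (c ^+ 2) bF (L1Z _ lFH)) (kformZr mK _ bF lFH) -EL// c2.
    by rewrite [c * (S * _)]mulrCA mulKf ?gt_eqF.
  have -> : (fun x => c ^+ 2 * F.1.1 x ^+ 2) = (fun x => (lin c F 0 F).1.1 x ^+ 2).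
    by apply/funext => x /=; ring.
  have -> // : (fun x => c * (F.1.1 x * H.1.1 x)) = (fun x => (lin c F 0 F).1.1 x * H.1.1 x).
  by apply/funext => x /=; ring.
- move=> G tG; rewrite NU ler_pdivrMl//; exact: Tst_quartic_bound.
Qed.

End variational.

(** * Continuous and C^1 functions on the plane *)

Section plane.
Context {R : realType}.
Local Notation plane := (measurableTypeR R * measurableTypeR R)%type.
Local Notation lam := (@lebesgue_measure R).
Implicit Types f g : R * R -> R.

Lemma rat_between_ball (x e : R) : 0 < e -> exists p q : rat,
  ratr p < x < ratr q /\ (forall t, ratr p < t < ratr q -> ball x e t).
Proof.
move=> e0; have /rat_in_itvoo[p] : x - e < x by lra.
rewrite in_itv/= => /andP[p1 p2].
have /rat_in_itvoo[q] : x < x + e by lra.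
rewrite in_itv/= => /andP[q1 q2].
exists p, q; split; first by rewrite p2 q1.
move=> t /andP[pt tq]; rewrite /ball/= ltr_norml; apply/andP; split; lra.
Qed.

(** The sigma-algebra on the plane is the product one, so an open set is written
    as a countable union of rational boxes. *)
Lemma open_measurable_plane (U : set (R * R)) : open U ->
  measurable (U : set plane).
Proof.
move=> oU.
pose box (q : (rat * rat) * (rat * rat)) : set plane :=
  `]ratr q.1.1, ratr q.1.2[%classic `*` `]ratr q.2.1, ratr q.2.2[%classic.
have -> : U = \bigcup_q (if `[< box q `<=` U >] then box q else set0).
  rewrite eqEsubset; split=> [x Ux|x [q _]]; last first.
    by case: asboolP => // qU /qU.
  have /nbhs_ballP[e /= e0 eU] : nbhs x U by exact: open_nbhs_nbhs.
  have [p1 [q1 [x1 h1]]] := rat_between_ball x.1 e0.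
  have [p2 [q2 [x2 h2]]] := rat_between_ball x.2 e0.
  exists ((p1, q1), (p2, q2)) => //; case: asboolP; last first.
    move=> nU; exfalso; apply: nU => t [/=]; rewrite !in_itv/= => t1 t2.
    apply: (eU t); split.
    - exact: h1.
    - exact: h2.
  by move=> _; split; rewrite /= in_itv.
apply: countable_bigcupT_measurable => [|q]; first exact: countableP.
by case: ifP => // _; apply: measurableX; exact: measurable_itv.
Qed.

Lemma continuous_measurable_plane f : continuous f ->
  measurable_fun setT (f : plane -> R).
Proof.
move=> /continuousP cf; apply: (measurability _ (RGenOpens.measurableE R)).
move=> _ [_ [a [b ->] <-]]; rewrite setTI; apply: open_measurable_plane.
exact/cf/interval_open.
Qed.

Lemma continuous_row f y : continuous f -> continuous (fun t => f (t, y)).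
Proof.
move=> cf t; apply: (@continuous_comp _ _ _ (fun t => (t, y)) f); last exact: cf.
by apply: (cvg_pair (G := nbhs t) (H := nbhs y)); [exact: cvg_id|exact: cvg_cst].
Qed.

Lemma continuous_column f x : continuous f -> continuous (fun t => f (x, t)).
Proof.
move=> cf t; apply: (@continuous_comp _ _ _ (fun t => (x, t)) f); last exact: cf.
by apply: (cvg_pair (G := nbhs x) (H := nbhs t)); [exact: cvg_cst|exact: cvg_id].
Qed.

Local Notation e1 := ((1, 0) : R * R).
Local Notation e2 := ((0, 1) : R * R).

Let row_quotient f t y : (fun h : R => h^-1 *: (f (h *: e1 + (t, y)) - f (t, y))) =
  (fun h => h^-1 *: (f (h *: 1 + t, y) - f (t, y))).
Proof.
apply/funext => h; congr (_ *: (f _ - _)).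
by apply/pair_equal_spec; split; rewrite //= scaler0 add0r.
Qed.

Let column_quotient f x t : (fun h : R => h^-1 *: (f (h *: e2 + (x, t)) - f (x, t))) =
  (fun h => h^-1 *: (f (x, h *: 1 + t) - f (x, t))).
Proof.
apply/funext => h; congr (_ *: (f _ - _)).
by apply/pair_equal_spec; split; rewrite //= scaler0 add0r.
Qed.

Lemma derivable_row f t y :
  derivable f (t, y) e1 -> derivable (fun s => f (s, y)) t 1.
Proof. by rewrite /derivable row_quotient. Qed.

Lemma derivable_column f x t :
  derivable f (x, t) e2 -> derivable (fun s => f (x, s)) t 1.
Proof. by rewrite /derivable column_quotient. Qed.

Lemma derive_row f t y : 'D_1 (fun s => f (s, y)) t = 'D_e1 f (t, y).
Proof. by rewrite /derive row_quotient. Qed.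

Lemma derive_column f x t : 'D_1 (fun s => f (x, s)) t = 'D_e2 f (x, t).
Proof. by rewrite /derive column_quotient. Qed.

Definition C1 f := [/\ continuous f,
  forall x, derivable f x e1, forall x, derivable f x e2,
  continuous ('D_e1 f) & continuous ('D_e2 f)].

(** The condition outside the box is open, so it passes to the derivatives. *)
Definition box_supported (M : R) f :=
  forall x, M < `|x.1| \/ M < `|x.2| -> f x = 0.

Lemma smooth_C1 f : smooth f -> C1 f.
Proof. by move=> /(_ 1%N) [cf [d1 d2 [c1 _] [c2 _]]]; exact: And5 cf d1 d2 c1 c2. Qed.

Let near_outside (M : R) (x : R * R) : M < `|x.1| \/ M < `|x.2| ->
  \near x, M < `|x.1| \/ M < `|x.2|.
Proof.
have c1 : continuous (fun x : R * R => `|x.1|).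
  by move=> z; apply: cvg_norm; exact: cvg_fst.
have c2 : continuous (fun x : R * R => `|x.2|).
  by move=> z; apply: cvg_norm; exact: cvg_snd.
case=> [Mx|Mx].
- by apply: filterS (cvgr_gt _ (c1 x) _ Mx) => z; left.
- by apply: filterS (cvgr_gt _ (c2 x) _ Mx) => z; right.
Qed.

Lemma box_supported_derive M f v : box_supported M f -> box_supported M ('D_v f).
Proof.
move=> sf x /near_outside nx; transitivity ('D_v (cst (0 : R)) x).
  by apply: near_eq_derive; apply: filterS nx => z /sf.
by rewrite derive_cst.
Qed.

Definition box (M : R) : set plane := `[- M, M]%classic `*` `[- M, M]%classic.

Lemma measurable_box M : measurable (box M).
Proof. by apply: measurableX; exact: measurable_itv. Qed.

Lemma box_finite M : (leb2 R (box M) < +oo)%E.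
Proof.
have E : leb2 R (box M) = (lam `[(- M)%R, M]%classic * lam `[(- M)%R, M]%classic)%E.
  by rewrite /leb2/= product_measure1E.
have fin : (lam `[(- M)%R, M]%classic < +oo)%E.
  by rewrite lebesgue_measure_itv/=; case: ifP => _; rewrite ?ltry.
by rewrite E lte_mul_pinfty// ge0_fin_numE.
Qed.

Lemma continuous_bounded_box M f : continuous f ->
  exists C, forall x, box M x -> `|f x| <= C.
Proof.
move=> cf; have cptM : compact (`[- M, M]%classic `*` `[- M, M]%classic : set (R * R)).
  by apply: compact_setX; exact: segment_compact.
have := @continuous_compact _ _ f _ (continuous_subspaceT cf) cptM.
move=> /compact_bounded[C [_ /(_ (C + 1))]]; rewrite ltrDl ltr01 => /(_ isT) h.
by exists (C + 1) => x bx; apply: h; exists x.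
Qed.

Lemma continuous_box_supported_L1 M f : continuous f -> box_supported M f ->
  L1 (leb2 R) f.
Proof.
move=> cf sf; have [C hC] := continuous_bounded_box M cf.
have mf := continuous_measurable_plane cf.
apply: (le_L1 (g := fun x => C * \1_(box M) x)) => //.
  by apply: L1Z; apply: L1_indic; [exact: measurable_box|exact: box_finite].
move=> x; rewrite indicE; have [xM|xM] := boolP (x \in box M).
  by rewrite mulr1 (le_trans (hC _ _)) ?ler_norm//; rewrite inE in xM.
rewrite sf ?normr0//; apply: contrapT => /not_orP[/negP h1 /negP h2].
move: xM; rewrite notin_setE; apply; split=> /=; rewrite in_itv/= -ler_norml leNgt.
all: by [exact: h1|exact: h2].
Qed.

End plane.

(** * Calculus on the line *)

Section one_variable.
Context {R : realType}.
Local Notation lam := (@lebesgue_measure R).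
Implicit Types g : R -> R.

Lemma FTC g a b : a <= b -> (forall t, derivable g t 1) -> continuous ('D_1 g) ->
  \int[lam]_(t in `[a, b]) 'D_1 g t = g b - g a.
Proof.
rewrite le_eqVlt => /predU1P[<- _ _|ab dg cg'].
  by rewrite set_itv1 Rintegral_set1 subrr.
have cg : continuous g by move=> t; exact/differentiable_continuous/derivable1_diffP.
rewrite /Rintegral (@continuous_FTC2 _ _ g) //.
- exact: continuous_subspaceT.
- by split=> [t _||]; [exact: dg|apply: cvg_at_right_filter; exact: cg|
    apply: cvg_at_left_filter; exact: cg].
- by move=> t _; rewrite derive1E.
Qed.

Lemma continuous_L1_itv g a b : continuous g ->
  lam.-integrable `[a, b] (EFin \o g).
Proof.
move=> cg; apply: continuous_compact_integrable; first exact: segment_compact.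
exact: continuous_subspaceT.
Qed.

Lemma continuous_L1_itvco g a b : continuous g -> L1 lam (fun t => g t * \1_(`[a, b[) t).
Proof.
move=> cg; have i1 : lam.-integrable `[a, b[ (EFin \o g).
  apply: integrableS (continuous_L1_itv a b cg) => //.
  by move=> t /=; rewrite !in_itv/= => /andP[-> /ltW].
exact: (integrable_indicM lam g (measurable_itv _)).1 i1.
Qed.

Lemma jensen_itv g a b : a <= b -> continuous g ->
  (\int[lam]_(t in `[a, b]) g t) ^+ 2 <= (b - a) * \int[lam]_(t in `[a, b]) g t ^+ 2.
Proof.
move=> ab cg; set I := `[a, b]%classic.
have L1I (h : R -> R) : continuous h -> L1 lam (fun t => h t * \1_I t).
  move=> ch.
  exact: (integrable_indicM lam h (measurable_itv _)).1 (continuous_L1_itv a b ch).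
have m1 (h : R -> R) : continuous h -> measurable_fun setT (fun t => h t * \1_I t).
  by move=> ch; exact: L1_measurable (L1I _ ch).
have c2 : continuous (fun t => g t ^+ 2) by move=> t; apply: cvgM; exact: cg.
have l1 : L2 lam (\1_I).
  split; first by apply: measurable_indic; exact: measurable_itv.
  under [X in L1 _ X]funext do rewrite sqr_indic.
  under [X in L1 _ X]funext do rewrite -[\1_I _]mul1r.
  by apply: (L1I (cst 1)) => t; exact: cvg_cst.
have lg : L2 lam (fun t => g t * \1_I t).
  split; first exact: m1.
  under [X in L1 _ X]funext do rewrite exprMn sqr_indic.
  exact: L1I.
have := cauchy_schwarz l1 lg.
rewrite /ip (@Rintegral_indicM _ _ _ lam I g) (@Rintegral_indicM _ _ _ lam I (fun t => g t ^+ 2)).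
have lamI : lam I = (b - a)%:E.
  apply: (etrans (lebesgue_measure_itv `[a, b])); rewrite /= lte_fin.
  case: ltP => [//|ba]; have -> : a = b by apply/eqP; rewrite eq_le ab ba.
  by rewrite subrr.
have -> : \int[lam]_x (\1_I x * \1_I x) = b - a.
  under eq_Rintegral do rewrite -expr2 sqr_indic.
  rewrite /Rintegral integral_indic ?setIT//; last exact: measurable_itv.
  exact: (congr1 fine lamI).
congr (_ ^+ 2 <= _ * _).
- by apply: eq_Rintegral => t _; rewrite mulrCA -expr2 sqr_indic.
- by apply: eq_Rintegral => t _; rewrite -expr2 exprMn sqr_indic.
Qed.

(** The difference is the integral of the derivative between the two points, and
    Cauchy-Schwarz costs at most the length of the interval. *)
Lemma diff_sqr_le g a h s t : (forall t, derivable g t 1) ->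
  continuous ('D_1 g) -> s \in `[a, a + h[ -> t \in `[a, a + h[ ->
  (g t - g s) ^+ 2 <= h * \int[lam]_x ('D_1 g x ^+ 2 * \1_(`[a, a + h[) x).
Proof.
move=> dg cg'; wlog st : s t / s <= t.
  move=> H sa ta; have [|/ltW] := leP s t; first by move=> /H; apply.
  by rewrite -sqrrN opprB => /H; apply.
rewrite !in_itv/= => /andP[s1 s2] /andP[t1 t2].
have c2 : continuous (fun t => 'D_1 g t ^+ 2) by move=> x; apply: cvgM; exact: cg'.
rewrite -FTC//; apply: (le_trans (jensen_itv st cg')).
have i0 : 0 <= \int[lam]_(x in `[s, t]) 'D_1 g x ^+ 2.
  by apply: Rintegral_ge0 => x _; rewrite sqr_ge0.
apply: ler_pM => //; [lra|lra|].
rewrite (@Rintegral_indicM _ _ _ lam `[s, t]%classic); apply: le_Rintegral => //.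
- exact: (integrable_indicM lam _ (measurable_itv _)).1 (continuous_L1_itv s t c2).
- exact: continuous_L1_itvco.
- move=> x _; rewrite ler_wpM2l ?sqr_ge0// !indicE; case: (boolP (x \in `[s, t]%classic)) => [|_].
    rewrite inE/= in_itv/= => /andP[sx xt]; rewrite mem_set//=.
    by rewrite in_itv/= (le_trans s1 sx) (le_lt_trans xt t2).
  by rewrite ler0n.
Qed.

End one_variable.

(** * Integration by parts on the plane *)

Section plane_calculus.
Context {R : realType}.
Local Notation plane := (measurableTypeR R * measurableTypeR R)%type.
Local Notation lam := (@lebesgue_measure R).
Local Notation e1 := ((1, 0) : R * R).
Local Notation e2 := ((0, 1) : R * R).
Implicit Types f g : R * R -> R.

Lemma C1M f g : C1 f -> C1 g -> C1 (f * g).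
Proof.
move=> [cf f1 f2 cf1 cf2] [cg g1 g2 cg1 cg2].
split; [by move=> x; apply: cvgM; [exact: cf|exact: cg]|by move=> x; exact: derivableM|
  by move=> x; exact: derivableM| |].
- rewrite (_ : 'D_e1 (f * g) = f * 'D_e1 g + g * 'D_e1 f).
    by move=> x; apply: cvgD; apply: cvgM; [exact: cf|exact: cg1|exact: cg|exact: cf1].
  by apply/funext => x; rewrite deriveM.
- rewrite (_ : 'D_e2 (f * g) = f * 'D_e2 g + g * 'D_e2 f).
    by move=> x; apply: cvgD; apply: cvgM; [exact: cf|exact: cg2|exact: cg|exact: cf2].
  by apply/funext => x; rewrite deriveM.
Qed.

Lemma C1_row f y : C1 f ->
  [/\ continuous (fun t => f (t, y)), forall t, derivable (fun s => f (s, y)) t 1 &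
      continuous ('D_1 (fun t => f (t, y)))].
Proof.
move=> [cf f1 _ cf1 _]; split; first exact: continuous_row.
  by move=> t; exact: derivable_row.
by rewrite (_ : 'D_1 (fun t => f (t, y)) = fun t => 'D_e1 f (t, y));
  [exact: (@continuous_row _ ('D_e1 f))|
  apply/funext => t; rewrite derive_row].
Qed.

Lemma C1_column f x : C1 f ->
  [/\ continuous (fun t => f (x, t)), forall t, derivable (fun s => f (x, s)) t 1 &
      continuous ('D_1 (fun t => f (x, t)))].
Proof.
move=> [cf _ f2 _ cf2]; split; first exact: continuous_column.
  by move=> t; exact: derivable_column.
by rewrite (_ : 'D_1 (fun t => f (x, t)) = fun t => 'D_e2 f (x, t));
  [exact: (@continuous_column _ ('D_e2 f))|
  apply/funext => t; rewrite derive_column].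
Qed.

(* On the line, a compactly supported function has the same value, zero, at both
   ends of a large interval. *)
Let integral_derive_1d (g : R -> R) M : (forall t, derivable g t 1) ->
  continuous ('D_1 g) -> (forall t, M < `|t| -> g t = 0) ->
  (\int[lam]_t ('D_1 g t)%:E = 0)%E.
Proof.
move=> dg cg g0; pose L := `|M| + 1.
have LM : M < L by rewrite /L; have := ler_norm M; lra.
have L0 : 0 < L by rewrite /L; have := normr_ge0 M; lra.
have g'0 t : L < `|t| -> 'D_1 g t = 0.
  move=> Lt; transitivity ('D_1 (cst (0 : R)) t); last by rewrite derive_cst.
  apply: near_eq_derive; have c1 : continuous (fun x : R => `|x|).
    by move=> z; apply: cvg_norm; exact: cvg_id.
  by apply: filterS (cvgr_gt _ (c1 t) _ Lt) => z Lz; rewrite g0// (lt_trans LM).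
have E t : 'D_1 g t = 'D_1 g t * \1_(`[- L, L]) t.
  rewrite indicE; case: (boolP (t \in _)) => [_|]; first by rewrite mulr1.
  rewrite notin_setE/= in_itv/= -ler_norml => /negP; rewrite -ltNge => /g'0 ->.
  by rewrite mul0r.
under eq_integral do rewrite E.
rewrite L1_fin; last first.
  exact: (integrable_indicM lam _ (measurable_itv _)).1 (continuous_L1_itv (- L) L cg).
rewrite -(@Rintegral_indicM _ _ _ lam `[- L, L]%classic ('D_1 g)).
rewrite FTC//; last lra.
by rewrite !g0 ?subrr// ?normrN gtr0_norm.
Qed.

Lemma integral_derive1_eq0 f M : C1 f -> box_supported M f ->
  \int[leb2 R]_x 'D_e1 f x = 0.
Proof.
move=> cf sf; have [_ _ _ cf1 _] := cf.
have l1 := continuous_box_supported_L1 cf1 (box_supported_derive e1 sf).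
rewrite /Rintegral -(integral21_prod_meas1 l1) integral0_eq// => y _.
have [_ dr cr] := C1_row y cf.
rewrite /fubini_G/=; under eq_integral do rewrite -derive_row.
by apply: (integral_derive_1d (M := M)) => // t Mt; apply: sf; left.
Qed.

Lemma integral_derive2_eq0 f M : C1 f -> box_supported M f ->
  \int[leb2 R]_x 'D_e2 f x = 0.
Proof.
move=> cf sf; have [_ _ _ _ cf2] := cf.
have l1 := continuous_box_supported_L1 cf2 (box_supported_derive e2 sf).
rewrite /Rintegral -(integral12_prod_meas1 l1) integral0_eq// => x _.
have [_ dr cr] := C1_column x cf.
rewrite /fubini_F/=; under eq_integral do rewrite -derive_column.
by apply: (integral_derive_1d (M := M)) => // t Mt; apply: sf; right.
Qed.

Let derive_mul f g v x : derivable f x v -> derivable g x v ->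
  'D_v (f * g) x = f x * 'D_v g x + 'D_v f x * g x.
Proof.
move=> df dg; apply: (etrans (deriveM df dg)); congr (_ + _).
exact: (mulrC (g x)).
Qed.

Lemma integration_by_parts1 f g M : C1 f -> C1 g -> box_supported M g ->
  \int[leb2 R]_x (f x * 'D_e1 g x) = - \int[leb2 R]_x ('D_e1 f x * g x).
Proof.
move=> cf cg sg; apply/eqP; rewrite -addr_eq0; apply/eqP.
have [f0 f1 f2 cf1 cf2] := cf; have [g0 g1 g2 cg1 cg2] := cg.
have sfg : box_supported M (f * g).
  by move=> x Mx; rewrite /GRing.mul/= sg// mulr0.
rewrite -RintegralD//.
- apply: etrans (integral_derive1_eq0 (C1M cf cg) sfg); apply: eq_Rintegral => x _.
  exact: (esym (derive_mul (f1 x) (g1 x))).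
- apply: (@continuous_box_supported_L1 _ M); first by move=> x; apply: cvgM; [exact: f0|exact: cg1].
  by move=> x Mx; rewrite (box_supported_derive e1 sg)// mulr0.
- apply: (@continuous_box_supported_L1 _ M); first by move=> x; apply: cvgM; [exact: cf1|exact: g0].
  by move=> x Mx; rewrite sg// mulr0.
Qed.

Lemma integration_by_parts2 f g M : C1 f -> C1 g -> box_supported M g ->
  \int[leb2 R]_x (f x * 'D_e2 g x) = - \int[leb2 R]_x ('D_e2 f x * g x).
Proof.
move=> cf cg sg; apply/eqP; rewrite -addr_eq0; apply/eqP.
have [f0 f1 f2 cf1 cf2] := cf; have [g0 g1 g2 cg1 cg2] := cg.
have sfg : box_supported M (f * g).
  by move=> x Mx; rewrite /GRing.mul/= sg// mulr0.
rewrite -RintegralD//.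
- apply: etrans (integral_derive2_eq0 (C1M cf cg) sfg); apply: eq_Rintegral => x _.
  exact: (esym (derive_mul (f2 x) (g2 x))).
- apply: (@continuous_box_supported_L1 _ M); first by move=> x; apply: cvgM; [exact: f0|exact: cg2].
  by move=> x Mx; rewrite (box_supported_derive e2 sg)// mulr0.
- apply: (@continuous_box_supported_L1 _ M); first by move=> x; apply: cvgM; [exact: cf2|exact: g0].
  by move=> x Mx; rewrite sg// mulr0.
Qed.

End plane_calculus.

(** * Mass in vertical strips *)

Section strip.
Context {R : realType}.
Local Notation plane := (measurableTypeR R * measurableTypeR R)%type.
Local Notation lam := (@lebesgue_measure R).
Local Notation e1 := ((1, 0) : R * R).
Local Notation e2 := ((0, 1) : R * R).
Implicit Types f g : R * R -> R.

(* The square vanishes far to the left, and its derivative 2 g g' is at most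
   g^2 + g'^2. *)
Let sqr_le_line (g : R -> R) M t : continuous g -> (forall s, derivable g s 1) ->
  continuous ('D_1 g) -> (forall s, M < `|s| -> g s = 0) ->
  ((g t ^+ 2)%:E <= \int[lam]_s (g s ^+ 2 + 'D_1 g s ^+ 2)%:E)%E.
Proof.
move=> cg dg cg' g0; pose A := - (`|t| + `|M| + 1).
have tA : A <= t.
  by rewrite /A; have := lerNnormlW (lexx `|t|); have := normr_ge0 M; lra.
have gA : g A = 0.
  apply: g0; rewrite /A normrN ger0_norm; last first.
    by have := normr_ge0 t; have := normr_ge0 M; lra.
  by have := normr_ge0 t; have := ler_norm M; lra.
have DG s : 'D_1 (g * g) s = 2 * (g s * 'D_1 g s).
  apply: (etrans (deriveM (dg s) (dg s))); rewrite /GRing.scale/=; ring.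
have cG : continuous ('D_1 (g * g)).
  rewrite (_ : 'D_1 (g * g) = fun s => 2 * (g s * 'D_1 g s)); last exact/funext.
  by move=> s; apply: cvgM; [exact: cvg_cst|apply: cvgM; [exact: cg|exact: cg']].
have cS : continuous (fun s => g s ^+ 2 + 'D_1 g s ^+ 2).
  by move=> s; apply: cvgD; apply: cvgM; [exact: cg|exact: cg|exact: cg'|exact: cg'].
have dG s : derivable (g * g) s 1 by exact: derivableM.
have := FTC tA dG cG; rewrite /GRing.mul/= gA mulr0 subr0 -expr2 => <-.
apply: (@le_trans _ _ (\int[lam]_(s in `[A, t]) (g s ^+ 2 + 'D_1 g s ^+ 2))%:E).
  rewrite lee_fin; apply: le_Rintegral; first exact: measurable_itv.
  - exact: continuous_L1_itv.
  - exact: continuous_L1_itv.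
  - move=> s _; rewrite DG; move: (g s) ('D_1 g s) => u v.
    by have := sqr_ge0 (u - v); rewrite sqrrB; lra.
rewrite /Rintegral fineK; last first.
  exact: (@integrable_fin_num _ _ _ lam _ (measurable_itv `[A, t]) _ (continuous_L1_itv A t cS)).
apply: ge0_subset_integral => //.
  apply/measurable_EFinP; exact: continuous_measurable_fun.
by move=> s _; rewrite lee_fin addr_ge0 ?sqr_ge0.
Qed.

Let lebesgue_itv_le a b : a <= b -> (lam `[a, b]%classic <= (b - a)%:E)%E.
Proof.
move=> ab; have := lebesgue_measure_itv `[a, b] => /= ->; rewrite lte_fin.
by case: ifP => _; rewrite lee_fin ?subr_ge0.
Qed.

(** The energy controls the mass in every vertical strip, by a constant times
    the width: on each horizontal line [f ^+ 2] is bounded by the integral over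
    that line of the absolute value of its derivative. *)
Lemma strip_le f a b M : a <= b -> C1 f -> box_supported M f ->
  \int[leb2 R]_x (f x ^+ 2 * \1_(`[a, b]) x.1) <=
  (b - a) * \int[leb2 R]_x (f x ^+ 2 + 'D_e1 f x ^+ 2).
Proof.
move=> ab cf sf; have [f0 _ _ cf1 _] := cf.
pose L := fun z : plane => f z ^+ 2 + 'D_e1 f z ^+ 2.
have cL : continuous (L : R * R -> R).
  by move=> s; apply: cvgD; apply: cvgM; [exact: f0|exact: f0|exact: cf1|exact: cf1].
have cf2 : continuous (fun z => f z ^+ 2) by move=> s; apply: cvgM; exact: f0.
have l1L : L1 (leb2 R) L.
  apply: (@continuous_box_supported_L1 _ M) => // x Mx; rewrite /L sf//.
  by rewrite (box_supported_derive e1 sf)// expr0n addr0.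
have mS : measurable_fun setT (fun z : plane => f z ^+ 2 * \1_(`[a, b]) z.1).
  apply: measurable_funM; first exact: continuous_measurable_plane.
  apply: (measurableT_comp (measurable_indic _)) => //; exact: measurable_itv.
have l1S : L1 (leb2 R) (fun z => f z ^+ 2 * \1_(`[a, b]) z.1).
  apply: (le_L1 mS l1L) => x; rewrite normrM ger0_norm ?sqr_ge0// (@ger0_norm _ (\1_ _ _))//.
  rewrite ger0_norm ?addr_ge0 ?sqr_ge0// /L -[leLHS]addr0 lerD ?sqr_ge0//.
  by rewrite ler_piMr ?sqr_ge0// indicE lern1 leq_b1.
rewrite -lee_fin EFinM -!L1_fin//.
have mL : measurable_fun setT (EFin \o L) by case/integrableP: (l1L).
have L0 z : (0 <= (EFin \o L) z)%E by rewrite lee_fin addr_ge0 ?sqr_ge0.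
pose S := fun z : plane => f z ^+ 2 * \1_(`[a, b]) z.1.
have mS' : measurable_fun setT (EFin \o S) by case/integrableP: (l1S).
have S0 z : (0 <= (EFin \o S) z)%E by rewrite lee_fin mulr_ge0 ?sqr_ge0.
rewrite (@fubini_tonelli2 _ _ _ _ _ lam lam _ mS' S0).
rewrite [X in (_ <= _ * X)%E](@fubini_tonelli2 _ _ _ _ _ lam lam _ mL L0).
have mG := @measurable_fun_fubini_tonelli_G _ _ _ _ _ lam _ mL L0.
have G0 y : (0 <= fubini_G lam (EFin \o L) y)%E by exact: integral_ge0.
rewrite -ge0_integralZl//; last by rewrite lee_fin subr_ge0.
apply: ge0_le_integral => //.
- by move=> y _; exact: integral_ge0.
- exact: (@measurable_fun_fubini_tonelli_G _ _ _ _ _ lam _ mS' S0).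
- exact: measurable_funeM.
move=> y _; have [c0 d0 cd] := C1_row y cf.
apply: (@le_trans _ _ (\int[lam]_t (fubini_G lam (EFin \o L) y * (\1_(`[a, b]) t)%:E))%E).
  apply: ge0_le_integral => //.
  - exact: (measurable_fun_pair1 y mS').
  - apply: measurable_funeM; apply/measurable_EFinP.
    by apply: measurable_indic; exact: measurable_itv.
  - move=> t _; rewrite /S /= EFinM lee_wpmul2r ?lee_fin//.
    have h s : M < `|s| -> f (s, y) = 0 by move=> Ms; apply: sf; left.
    have := sqr_le_line t c0 d0 cd h.
    by under eq_integral do rewrite derive_row.
rewrite ge0_integralZl//; last first.
  by apply/measurable_EFinP; apply: measurable_indic; exact: measurable_itv.
rewrite integral_indic ?setIT//.
rewrite muleC lee_wpmul2r//.
exact: lebesgue_itv_le.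
Qed.

End strip.

(** * Poincare's inequality on squares *)

Section poincare.
Context {R : realType}.
Local Notation plane := (measurableTypeR R * measurableTypeR R)%type.
Local Notation lam := (@lebesgue_measure R).
Local Notation e1 := ((1, 0) : R * R).
Local Notation e2 := ((0, 1) : R * R).
Implicit Types f g : R * R -> R.

Definition cell (c : R * R) (h : R) : set plane :=
  `[c.1, c.1 + h[%classic `*` `[c.2, c.2 + h[%classic.

Lemma measurable_cell c h : measurable (cell c h).
Proof. by apply: measurableX; exact: measurable_itv. Qed.

Lemma lebesgue_itvco (a h : R) : 0 <= h -> lam `[a, a + h[%classic = h%:E.
Proof.
move=> h0; have := lebesgue_measure_itv `[a, a + h[ => /= ->; rewrite lte_fin.
case: ltP => [_|ah]; first by rewrite -EFinB addrAC subrr add0r.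
by have -> : h = 0 by lra.
Qed.

Lemma leb2_cell c h : 0 <= h -> leb2 R (cell c h) = (h ^+ 2)%:E.
Proof.
move=> h0; apply: etrans (f_equal2 mule (lebesgue_itvco c.1 h0) (lebesgue_itvco c.2 h0)).
exact: (@product_measure1E _ _ _ _ R lam lam _ _
  (measurable_itv `[c.1, c.1 + h[) (measurable_itv `[c.2, c.2 + h[)).
Qed.

Lemma indic_cell c h (z : plane) : \1_(cell c h) z =
  \1_(`[c.1, c.1 + h[) z.1 * \1_(`[c.2, c.2 + h[) z.2 :> R.
Proof.
rewrite !indicE -natrM mulnb; congr ((_ : bool)%:R).
by apply/idP/andP => [|[]]; rewrite !inE// => -[].
Qed.

Lemma continuous_L1_cell f c h : 0 <= h -> continuous f ->
  L1 (leb2 R) (fun z => f z * \1_(cell c h) z).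
Proof.
move=> h0 cf; pose M := `|c.1| + `|c.2| + h.
have [C hC] := continuous_bounded_box M cf.
apply: (le_L1 (g := fun x => C * \1_(cell c h) x)) => //.
- apply: measurable_funM; first exact: continuous_measurable_plane.
  apply: measurable_indic; exact: measurable_cell.
- apply: L1Z; apply: L1_indic; first exact: measurable_cell.
  by rewrite leb2_cell// ltry.
- move=> z; rewrite !normrM; have [zc|zc] := boolP (z \in cell c h); last first.
    by rewrite indicE (negbTE zc) normr0 !mulr0.
  rewrite ler_wpM2r// (le_trans _ (ler_norm _))// hC//.
  have := normr_ge0 c.1; have := normr_ge0 c.2.
  have := ler_norm c.1; have := ler_norm c.2.
  have := lerNnormlW (lexx `|c.1|); have := lerNnormlW (lexx `|c.2|).
  move: zc; rewrite inE => -[/=]; rewrite !in_itv/= => /andP[? ?] /andP[? ?] *.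
  by split; rewrite /= in_itv/= /M; apply/andP; split; lra.
Qed.

(** Tonelli: [P] depends on one coordinate only, so integrating it over a square
    replaces the other integration by a factor [h]. *)
Lemma integral_row_average f c h : 0 <= h -> continuous f -> (forall z, 0 <= f z) ->
  let P y := \int[lam]_t (f (t, y) * \1_(`[c.1, c.1 + h[) t) in
  L1 (leb2 R) (fun z => P z.2 * \1_(cell c h) z) /\
  \int[leb2 R]_z (P z.2 * \1_(cell c h) z) = h * \int[leb2 R]_z (f z * \1_(cell c h) z).
Proof.
move=> h0 cf f0 P; set I1 := `[c.1, c.1 + h[%classic; set I2 := `[c.2, c.2 + h[%classic.
have m1 : measurable I1 by exact: measurable_itv.
have m2 : measurable I2 by exact: measurable_itv.
pose f1 := EFin \o (fun z : plane => f z * \1_I1 z.1).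
have f10 z : (0 <= f1 z)%E by rewrite lee_fin mulr_ge0.
have mf1 : measurable_fun setT f1.
  apply/measurable_EFinP/measurable_funM; first exact: continuous_measurable_plane.
  by apply: (measurableT_comp (measurable_indic _)).
have EP y : (P y)%:E = fubini_G lam f1 y.
  by rewrite /P -L1_fin//; apply: continuous_L1_itvco; exact: continuous_row.
have mP : measurable_fun setT (fun y => P y).
  apply/measurable_EFinP; rewrite (_ : EFin \o _ = fubini_G lam f1); last first.
    by apply/funext => y; rewrite /= EP.
  exact: (@measurable_fun_fubini_tonelli_G _ _ _ _ _ lam _ mf1 f10).
have P0 y : 0 <= P y by rewrite -lee_fin EP; exact: integral_ge0.
pose c2 := (\int[lam]_y (P y * \1_I2 y)%:E)%E.
have mPI : measurable_fun setT (fun y => (P y * \1_I2 y)%:E).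
  by apply/measurable_EFinP/measurable_funM => //; exact: measurable_indic.
pose PQ := EFin \o (fun z : plane => P z.2 * \1_(cell c h) z).
have PQ0 z : (0 <= PQ z)%E by rewrite lee_fin mulr_ge0.
have mPQ : measurable_fun setT PQ.
  apply/measurable_EFinP/measurable_funM; first exact: measurableT_comp.
  apply: measurable_indic; exact: measurable_cell.
pose fQ := EFin \o (fun z : plane => f z * \1_(cell c h) z).
have fQ0 z : (0 <= fQ z)%E by rewrite lee_fin mulr_ge0.
have mfQ : measurable_fun setT fQ.
  apply/measurable_EFinP/measurable_funM; first exact: continuous_measurable_plane.
  apply: measurable_indic; exact: measurable_cell.
have E2 : (\int[leb2 R]_z fQ z = c2)%E.
  rewrite (@fubini_tonelli2 _ _ _ _ _ lam lam _ mfQ fQ0); apply: eq_integral => y _.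
  rewrite EFinM EP muleC -ge0_integralZl//; last exact: measurable_fun_pair1.
  apply: eq_integral => t _; rewrite /fQ /f1/= indic_cell/= -EFinM; congr EFin; ring.
have E1 : (\int[leb2 R]_z PQ z = h%:E * c2)%E.
  rewrite (@fubini_tonelli1 _ _ _ _ _ lam lam _ mPQ PQ0).
  transitivity (\int[lam]_x (c2 * (\1_I1 x)%:E))%E.
    apply: eq_integral => x _; rewrite muleC /c2 -ge0_integralZl//; last first.
      by move=> y _; rewrite lee_fin mulr_ge0.
    apply: eq_integral => y _; rewrite /PQ/= indic_cell/= -EFinM; congr EFin; ring.
  rewrite ge0_integralZl//.
  - rewrite integral_indic// setIT muleC; congr (_ * _)%E; exact: lebesgue_itvco.
  - by apply/measurable_EFinP; exact: measurable_indic.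
  - by apply: integral_ge0 => y _; rewrite lee_fin mulr_ge0.
have l1 : L1 (leb2 R) (fun z => f z * \1_(cell c h) z) by exact: continuous_L1_cell.
have E3 : (\int[leb2 R]_z PQ z = (h * \int[leb2 R]_z (f z * \1_(cell c h) z))%:E)%E.
  by rewrite E1 -E2 EFinM -L1_fin.
have l2 : L1 (leb2 R) (fun z => P z.2 * \1_(cell c h) z).
  apply: L1_of_lty; first exact/measurable_EFinP.
  under eq_integral do rewrite ger0_norm ?mulr_ge0//.
  by rewrite E3 ltry.
split=> //; have := E3; rewrite /PQ => {}E3.
by apply: EFin_inj; rewrite -E3 L1_fin.
Qed.

Lemma integral_column_average f c h : 0 <= h -> continuous f -> (forall z, 0 <= f z) ->
  let P x := \int[lam]_s (f (x, s) * \1_(`[c.2, c.2 + h[) s) in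
  L1 (leb2 R) (fun z => P z.1 * \1_(cell c h) z) /\
  \int[leb2 R]_z (P z.1 * \1_(cell c h) z) = h * \int[leb2 R]_z (f z * \1_(cell c h) z).
Proof.
move=> h0 cf f0 P; set I1 := `[c.1, c.1 + h[%classic; set I2 := `[c.2, c.2 + h[%classic.
have m1 : measurable I1 by exact: measurable_itv.
have m2 : measurable I2 by exact: measurable_itv.
pose f1 := EFin \o (fun z : plane => f z * \1_I2 z.2).
have f10 z : (0 <= f1 z)%E by rewrite lee_fin mulr_ge0.
have mf1 : measurable_fun setT f1.
  apply/measurable_EFinP/measurable_funM; first exact: continuous_measurable_plane.
  by apply: (measurableT_comp (measurable_indic _)).
have EP x : (P x)%:E = fubini_F lam f1 x.
  by rewrite /P -L1_fin//; apply: continuous_L1_itvco; exact: continuous_column.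
have mP : measurable_fun setT (fun x => P x).
  apply/measurable_EFinP; rewrite (_ : EFin \o _ = fubini_F lam f1); last first.
    by apply/funext => x; rewrite /= EP.
  exact: (@measurable_fun_fubini_tonelli_F _ _ _ _ _ lam _ mf1 f10).
have P0 x : 0 <= P x by rewrite -lee_fin EP; exact: integral_ge0.
pose c1 := (\int[lam]_x (P x * \1_I1 x)%:E)%E.
have mPI : measurable_fun setT (fun x => (P x * \1_I1 x)%:E).
  by apply/measurable_EFinP/measurable_funM => //; exact: measurable_indic.
pose PQ := EFin \o (fun z : plane => P z.1 * \1_(cell c h) z).
have PQ0 z : (0 <= PQ z)%E by rewrite lee_fin mulr_ge0.
have mPQ : measurable_fun setT PQ.
  apply/measurable_EFinP/measurable_funM; first exact: measurableT_comp.
  apply: measurable_indic; exact: measurable_cell.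
pose fQ := EFin \o (fun z : plane => f z * \1_(cell c h) z).
have fQ0 z : (0 <= fQ z)%E by rewrite lee_fin mulr_ge0.
have mfQ : measurable_fun setT fQ.
  apply/measurable_EFinP/measurable_funM; first exact: continuous_measurable_plane.
  apply: measurable_indic; exact: measurable_cell.
have E2 : (\int[leb2 R]_z fQ z = c1)%E.
  rewrite (@fubini_tonelli1 _ _ _ _ _ lam lam _ mfQ fQ0); apply: eq_integral => x _.
  rewrite EFinM EP muleC -ge0_integralZl//; last exact: measurable_fun_pair2.
  apply: eq_integral => t _; rewrite /fQ /f1/= indic_cell/= -EFinM; congr EFin; ring.
have E1 : (\int[leb2 R]_z PQ z = h%:E * c1)%E.
  rewrite (@fubini_tonelli2 _ _ _ _ _ lam lam _ mPQ PQ0).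
  transitivity (\int[lam]_y (c1 * (\1_I2 y)%:E))%E.
    apply: eq_integral => y _; rewrite muleC /c1 -ge0_integralZl//; last first.
      by move=> x _; rewrite lee_fin mulr_ge0.
    apply: eq_integral => x _; rewrite /PQ/= indic_cell/= -EFinM; congr EFin; ring.
  rewrite ge0_integralZl//.
  - rewrite integral_indic// setIT muleC; congr (_ * _)%E; exact: lebesgue_itvco.
  - by apply/measurable_EFinP; exact: measurable_indic.
  - by apply: integral_ge0 => x _; rewrite lee_fin mulr_ge0.
have l1 : L1 (leb2 R) (fun z => f z * \1_(cell c h) z) by exact: continuous_L1_cell.
have E3 : (\int[leb2 R]_z PQ z = (h * \int[leb2 R]_z (f z * \1_(cell c h) z))%:E)%E.
  by rewrite E1 -E2 EFinM -L1_fin.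
have l2 : L1 (leb2 R) (fun z => P z.1 * \1_(cell c h) z).
  apply: L1_of_lty; first exact/measurable_EFinP.
  under eq_integral do rewrite ger0_norm ?mulr_ge0//.
  by rewrite E3 ltry.
split=> //; have := E3; rewrite /PQ => {}E3.
by apply: EFin_inj; rewrite -E3 L1_fin.
Qed.

Let sqr_diff_chain (u v t a b : R) : (u - t) ^+ 2 <= a -> (t - v) ^+ 2 <= b ->
  (u - v) ^+ 2 <= 2 * a + 2 * b.
Proof.
have : 0 <= (u - t - (t - v)) ^+ 2 by rewrite sqr_ge0.
have -> : (u - v) ^+ 2 = 2 * (u - t) ^+ 2 + 2 * (t - v) ^+ 2 - (u - t - (t - v)) ^+ 2.
  by ring.
lra.
Qed.

Let poincare_arith (h q m a b : R) : 0 < h ->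
  2 * h ^+ 2 * q - 2 * m ^+ 2 <= 2 * h ^+ 3 * (h * a) + 2 * h ^+ 2 * b * h ^+ 2 ->
  q <= (h ^+ 2)^-1 * m ^+ 2 + h ^+ 2 * (a + b).
Proof.
move=> h0 H; have h2 : 0 < h ^+ 2 by rewrite exprn_gt0.
rewrite -(@ler_pM2l _ (2 * h ^+ 2)) ?mulr_gt0// mulrDr.
have -> : 2 * h ^+ 2 * ((h ^+ 2)^-1 * m ^+ 2) = 2 * m ^+ 2 by field; rewrite gt_eqF.
have -> : 2 * h ^+ 2 * (h ^+ 2 * (a + b)) =
  2 * h ^+ 3 * (h * a) + 2 * h ^+ 2 * b * h ^+ 2 by ring.
by move: H; lra.
Qed.

(** Poincare's inequality on a square, with the explicit constant given by
    joining two points of the square by a horizontal and a vertical segment. *)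
Lemma poincare_cell f c h : 0 < h -> C1 f ->
  \int[leb2 R]_z (f z ^+ 2 * \1_(cell c h) z) <=
  (h ^+ 2)^-1 * (\int[leb2 R]_z (f z * \1_(cell c h) z)) ^+ 2 +
  h ^+ 2 * \int[leb2 R]_z (('D_e1 f z ^+ 2 + 'D_e2 f z ^+ 2) * \1_(cell c h) z).
Proof.
move=> h0 cf; have [f0 _ _ f1 f2] := cf; have h0' := ltW h0.
have sqC g : continuous g -> continuous (fun z => g z ^+ 2).
  by move=> cg z; apply: cvgM; exact: cg.
set Q := cell c h.
pose P1 y := \int[lam]_t ('D_e1 f (t, y) ^+ 2 * \1_(`[c.1, c.1 + h[) t).
pose P2 x := \int[lam]_s ('D_e2 f (x, s) ^+ 2 * \1_(`[c.2, c.2 + h[) s).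
have [l1P iP] : L1 (leb2 R) (fun z => P1 z.2 * \1_Q z) /\
    \int[leb2 R]_z (P1 z.2 * \1_Q z) = h * \int[leb2 R]_z ('D_e1 f z ^+ 2 * \1_Q z).
  exact: (integral_row_average c h0' (sqC _ f1) (fun z => sqr_ge0 _)).
have [l2P iP2] : L1 (leb2 R) (fun z => P2 z.1 * \1_Q z) /\
    \int[leb2 R]_z (P2 z.1 * \1_Q z) = h * \int[leb2 R]_z ('D_e2 f z ^+ 2 * \1_Q z).
  exact: (integral_column_average c h0' (sqC _ f2) (fun z => sqr_ge0 _)).
pose m := \int[leb2 R]_z (f z * \1_Q z).
pose q := \int[leb2 R]_z (f z ^+ 2 * \1_Q z).
pose W1 := \int[leb2 R]_z ('D_e1 f z ^+ 2 * \1_Q z).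
pose W2 := \int[leb2 R]_z ('D_e2 f z ^+ 2 * \1_Q z).
have lf := continuous_L1_cell c h0' f0.
have lf2 := continuous_L1_cell c h0' (sqC _ f0).
have mQ : measurable Q by exact: measurable_cell.
have l1 : L1 (leb2 R) (\1_Q) by apply: L1_indic => //; rewrite leb2_cell ?ltry.
have i1 : \int[leb2 R]_z \1_Q z = h ^+ 2.
  by rewrite /Rintegral integral_indic// setIT leb2_cell.
have -> : \int[leb2 R]_z (('D_e1 f z ^+ 2 + 'D_e2 f z ^+ 2) * \1_Q z) = W1 + W2.
  rewrite -RintegralD//; last 2 first.
    exact: continuous_L1_cell (sqC _ f1).
    exact: continuous_L1_cell (sqC _ f2).
  by apply: eq_Rintegral => z _; rewrite mulrDl.
have pw z w : z \in Q -> w \in Q -> (f z - f w) ^+ 2 <= 2 * h * P1 z.2 + 2 * h * P2 w.1.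
  rewrite !inE => -[z1 z2] [w1 w2]; have [_ dr cr] := C1_row z.2 cf.
  have [_ dc cc] := C1_column w.1 cf.
  have := diff_sqr_le dr cr w1 z1; have := diff_sqr_le dc cc w2 z2.
  under eq_Rintegral do rewrite derive_column.
  rewrite -/(P2 w.1) => hc.
  under eq_Rintegral do rewrite derive_row.
  rewrite -/(P1 z.2) -!surjective_pairing in hc * => hr.
  by rewrite -!mulrA; exact: sqr_diff_chain hr hc.
(* Expanding the square, the double integral of (f z - f w)^2 over the square
   times itself is 2 h^2 q - 2 m^2; [J] is the inner integral. *)
pose J z := h ^+ 2 * f z ^+ 2 - 2 * m * f z + q.
have JE z : J z = \int[leb2 R]_w ((f z - f w) ^+ 2 * \1_Q w).
  rewrite /J /q -i1 -[f z ^+ 2 as X in _ * X]/(f z ^+ 2) (mulrC _ (f z ^+ 2)) -RintegralZl//.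
  rewrite /m (mulrC 2) -mulrA mulrC -RintegralZl//.
  rewrite -RintegralB//; last 2 first.
    exact: L1Z.
    exact: L1Z.
  rewrite -RintegralD//; last first.
    by apply: L1B; exact: L1Z.
  by apply: eq_Rintegral => w _; ring.
have Jle z : z \in Q -> J z <= 2 * h ^+ 3 * P1 z.2 + 2 * h ^+ 2 * W2.
  move=> zQ; rewrite JE; apply: (@le_trans _ _ (\int[leb2 R]_w
      (2 * h * P1 z.2 * \1_Q w + 2 * h * (P2 w.1 * \1_Q w)))).
    apply: le_Rintegral => //.
    - rewrite (_ : (fun w => _) = (fun w => (f z ^+ 2 * \1_Q w - 2 * f z * (f w * \1_Q w)) +
        (f w ^+ 2 * \1_Q w))); last by apply/funext => w; ring.
      by apply: L1D => //; apply: L1B; exact: L1Z.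
    - by apply: L1D; exact: L1Z.
    - move=> w _; have [wQ|wQ] := boolP (w \in Q); last first.
        by rewrite indicE (negbTE wQ) !mulr0 addr0.
      by rewrite indicE wQ !mulr1; exact: pw.
  rewrite RintegralD//; [|exact: L1Z|exact: L1Z].
  rewrite !RintegralZl// i1 iP2 -/W2 le_eqVlt; apply/orP; left; apply/eqP; ring.
have : \int[leb2 R]_z (J z * \1_Q z) <=
    \int[leb2 R]_z (2 * h ^+ 3 * (P1 z.2 * \1_Q z) + 2 * h ^+ 2 * W2 * \1_Q z).
  apply: le_Rintegral => //.
  - rewrite (_ : (fun z => _) = (fun z => (h ^+ 2 * (f z ^+ 2 * \1_Q z) -
      2 * m * (f z * \1_Q z)) + q * \1_Q z)); last by apply/funext => z; rewrite /J; ring.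
    by apply: L1D; [apply: L1B; exact: L1Z|exact: L1Z].
  - by apply: L1D; exact: L1Z.
  - move=> z _; have [zQ|zQ] := boolP (z \in Q); last first.
      by rewrite indicE (negbTE zQ) !mulr0 addr0.
    by rewrite indicE zQ !mulr1; exact: Jle.
rewrite RintegralD//; [|exact: L1Z|exact: L1Z].
rewrite !RintegralZl// i1 iP -/W1.
have -> : \int[leb2 R]_z (J z * \1_Q z) = 2 * h ^+ 2 * q - 2 * m ^+ 2.
  transitivity (\int[leb2 R]_z ((h ^+ 2 * (f z ^+ 2 * \1_Q z) -
      2 * m * (f z * \1_Q z)) + q * \1_Q z)).
    by apply: eq_Rintegral => z _; rewrite /J; ring.
  rewrite RintegralD//; [|by apply: L1B; exact: L1Z|exact: L1Z].
  rewrite RintegralB//; [|exact: L1Z|exact: L1Z].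
  rewrite !RintegralZl// i1 -/q -/m; ring.
rewrite -/q -/m; exact: poincare_arith.
Qed.

End poincare.

(** * Ehrling's inequality *)

Section ehrling.
Context {R : realType}.
Local Notation plane := (measurableTypeR R * measurableTypeR R)%type.
Local Notation e1 := ((1, 0) : R * R).
Local Notation e2 := ((0, 1) : R * R).
Implicit Types f g : R * R -> R.

Definition cell_mass f (p : (R * R) * R) : R :=
  \int[leb2 R]_z (f z * \1_(cell p.1 p.2) z).

Definition grad_sqr f (z : R * R) : R := 'D_e1 f z ^+ 2 + 'D_e2 f z ^+ 2.

Let continuous_grad_sqr f : C1 f -> continuous (grad_sqr f).
Proof.
move=> [_ _ _ c1 c2] z.
by apply: cvgD; apply: cvgM; [exact: c1|exact: c1|exact: c2|exact: c2].
Qed.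

Let indic_itv_half (a k t : R) : 0 <= k ->
  \1_(`[a, a + 2 * k[) t = \1_(`[a, a + k[) t + \1_(`[a + k, a + k + k[) t :> R.
Proof.
move=> k0; have itvE (x y : R) : (t \in `[x, y[%classic) = (x <= t < y).
  by apply/idP/idP; rewrite inE/= in_itv.
rewrite !indicE !itvE.
case: (leP a t) => at_; case: (ltP t (a + 2 * k)) => ta /=;
case: (ltP t (a + k)) => tk; case: (leP (a + k) t) => kt /=;
case: (ltP t (a + k + k)) => tkk //=; rewrite ?addr0 ?add0r //; lra.
Qed.

Definition corners (c : R * R) (k : R) : seq (R * R) :=
  [:: c; (c.1 + k, c.2); (c.1, c.2 + k); (c.1 + k, c.2 + k)].

Let integral_cell_split g c k : 0 <= k -> continuous g ->
  \int[leb2 R]_z (g z * \1_(cell c (2 * k)) z) =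
  \sum_(d <- corners c k) \int[leb2 R]_z (g z * \1_(cell d k) z).
Proof.
move=> k0 cg; have l d := continuous_L1_cell d k0 cg.
rewrite !big_cons big_nil addr0.
rewrite -(RintegralD measurableT (l _) (l _)).
rewrite -(RintegralD measurableT (l _) (L1D (l _) (l _))).
rewrite -(RintegralD measurableT (l _) (L1D (l _) (L1D (l _) (l _)))).
apply: eq_Rintegral => z _; rewrite !indic_cell/= !indic_itv_half//; ring.
Qed.

(** The finitely many squares in [s] and the factor [A] must serve all functions at
    once: this uniformity is what yields compactness. *)
Definition controlled (c : R * R) (h eta : R) := exists A s,
  [/\ 0 <= A, (forall p, p \in s -> 0 <= p.2) & forall f, C1 f ->
   \int[leb2 R]_z (f z ^+ 2 * \1_(cell c h) z) <=
   A * (\sum_(p <- s) cell_mass f p ^+ 2) +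
   eta * \int[leb2 R]_z (grad_sqr f z * \1_(cell c h) z)].

Let merge_controls k eta (cs : seq (R * R)) : 0 <= k ->
  (forall c, controlled c k eta) ->
  exists A s, [/\ 0 <= A, (forall p, p \in s -> 0 <= p.2) & forall f, C1 f ->
   \sum_(c <- cs) \int[leb2 R]_z (f z ^+ 2 * \1_(cell c k) z) <=
   A * (\sum_(p <- s) cell_mass f p ^+ 2) +
   eta * \sum_(c <- cs) \int[leb2 R]_z (grad_sqr f z * \1_(cell c k) z)].
Proof.
move=> k0 ctl; elim: cs => [|c cs [A [s [A0 s0 H]]]].
  by exists 0, [::]; split=> // f _; rewrite !big_nil !mulr0 addr0.
have [A' [s' [A'0 s'0 H']]] := ctl c.
exists (A + A'), (s' ++ s); split; first exact: addr_ge0.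
  by move=> p; rewrite mem_cat => /orP[/s'0|/s0].
move=> f cf; rewrite !big_cons big_cat/=.
have := H' f cf; have := H f cf.
have : 0 <= \sum_(p <- s) cell_mass f p ^+ 2 by apply: sumr_ge0 => p _; rewrite sqr_ge0.
have : 0 <= \sum_(p <- s') cell_mass f p ^+ 2 by apply: sumr_ge0 => p _; rewrite sqr_ge0.
move: (\sum_(p <- s) _) (\sum_(p <- s') _) (\sum_(c <- cs) _) (\sum_(c <- cs) _).
move: (\int[leb2 R]_z _) (\int[leb2 R]_z _) A0 A'0; clear.
move=> a b A0 A'0 u v x y u0 v0 h1 h2.
rewrite mulrDl !mulrDr; have := mulr_ge0 A0 u0; have := mulr_ge0 A'0 v0; lra.
Qed.

(** Cutting a square into four halves the side in Poincare's inequality, so [n]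
    rounds divide the factor of the Dirichlet integral by 4^n. *)
Lemma controlled_dyadic n c h : 0 < h -> controlled c h ((h / 2 ^+ n) ^+ 2).
Proof.
elim: n c h => [|n ih] c h h0.
  exists (h ^+ 2)^-1, [:: (c, h)]; split; first by rewrite invr_ge0 sqr_ge0.
    by move=> p; rewrite inE => /eqP ->; exact: ltW.
  by move=> f cf; rewrite big_seq1 expr0 divr1; exact: poincare_cell.
have k0 : 0 < h / 2 by lra.
have hE : h = 2 * (h / 2) by field.
have ctl d : controlled d (h / 2) ((h / 2 / 2 ^+ n) ^+ 2) by exact: ih.
have [A [s [A0 s0 H]]] := merge_controls (corners c (h / 2)) (ltW k0) ctl.
exists A, s; split=> // f cf; have [f0 _ _ _ _] := cf.
have cf2 : continuous (fun z => f z ^+ 2) by move=> z; apply: cvgM; exact: f0.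
have -> : h / 2 ^+ n.+1 = h / 2 / 2 ^+ n by rewrite exprS invfM mulrA.
rewrite {1 3}hE !integral_cell_split ?(ltW k0)//; last exact: continuous_grad_sqr.
exact: H.
Qed.

(** The inequality behind Rellich's theorem: for sequences with bounded Dirichlet
    integral, convergence in L^2 reduces to that of finitely many averages for each
    precision. *)
Lemma ehrling M eps : 0 <= M -> 0 < eps -> exists A s,
  [/\ 0 <= A, (forall p, p \in s -> 0 <= p.2) & forall f, C1 f ->
    box_supported M f -> \int[leb2 R]_z (f z ^+ 2) <=
    A * (\sum_(p <- s) cell_mass f p ^+ 2) +
    eps * \int[leb2 R]_z grad_sqr f z].
Proof.
move=> M0 eps0; (* The margin 1 puts the closed box of size [M] inside a half-open cell. *)
pose h := 2 * (M + 1); have h0 : 0 < h by rewrite /h; lra.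
pose c : R * R := (- (M + 1), - (M + 1)).
have [n hn] : exists n, (h / 2 ^+ n) ^+ 2 <= eps.
  have r0 : 0 <= h ^+ 2 / eps by rewrite divr_ge0 ?sqr_ge0// ltW.
  exists (Num.bound (h ^+ 2 / eps)); set n := Num.bound _.
  have hn : h ^+ 2 / eps < n%:R by exact: archi_boundP.
  have n2 : n%:R <= 2 ^+ n :> R by rewrite -natrX ler_nat ltnW// ltn_expl.
  have p2 : (1 : R) <= 2 ^+ n by rewrite exprn_ege1// ler1n.
  rewrite exprMn exprVn ler_pdivrMr ?exprn_gt0//.
  rewrite ltr_pdivrMr// in hn; apply: (le_trans (ltW hn)).
  rewrite mulrC ler_pM2l// (le_trans n2)// -[leLHS]mulr1 ler_wpM2l//.
have [A [s [A0 s0 H]]] := controlled_dyadic n c h0.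
exists A, s; split=> // f cf sf.
have inE_ z : f z != 0 \/ grad_sqr f z != 0 -> z \in cell c h.
  move=> nz; rewrite inE; apply: contrapT => zc.
  have Mz : M < `|z.1| \/ M < `|z.2|.
    apply: contrapT => /not_orP[/negP]; rewrite -leNgt => z1 /negP.
    rewrite -leNgt => z2; apply: zc; move: z1 z2; rewrite !ler_norml => /andP[? ?] /andP[? ?].
    by split; rewrite /= in_itv/= /h; apply/andP; split; lra.
  case: nz; first by rewrite sf// eqxx.
  rewrite /grad_sqr (box_supported_derive e1 sf)// (box_supported_derive e2 sf)//.
  by rewrite expr0n addr0 eqxx.
have := H f cf.
have -> : \int[leb2 R]_z (f z ^+ 2 * \1_(cell c h) z) = \int[leb2 R]_z (f z ^+ 2).
  apply: eq_Rintegral => z _; have [->|fz] := eqVneq (f z) 0; first by rewrite expr0n mul0r.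
  by rewrite indicE inE_ ?mulr1//; left.
have -> : \int[leb2 R]_z (grad_sqr f z * \1_(cell c h) z) = \int[leb2 R]_z grad_sqr f z.
  apply: eq_Rintegral => z _; have [->|fz] := eqVneq (grad_sqr f z) 0; first by rewrite mul0r.
  by rewrite indicE inE_ ?mulr1//; right.
move=> /le_trans; apply; rewrite lerD2l ler_wpM2r//.
by apply: Rintegral_ge0 => z _; rewrite addr_ge0 ?sqr_ge0.
Qed.

Lemma cell_massB f g p : 0 <= p.2 -> continuous f -> continuous g ->
  cell_mass (f - g) p = cell_mass f p - cell_mass g p.
Proof.
move=> p0 cf cg; rewrite /cell_mass -RintegralB//; try exact: continuous_L1_cell.
by apply: eq_Rintegral => z _; rewrite mulrBl.
Qed.

Lemma cell_mass_sqr_le f p : 0 <= p.2 -> L2 (leb2 R) f ->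
  cell_mass f p ^+ 2 <= p.2 ^+ 2 * \int[leb2 R]_z (f z ^+ 2).
Proof.
move=> p0 lf; have mQ := @measurable_cell _ p.1 p.2.
have l1 : L2 (leb2 R) (\1_(cell p.1 p.2)).
  split; first exact: measurable_indic.
  under [X in L1 _ X]funext do rewrite sqr_indic.
  by apply: L1_indic => //; rewrite leb2_cell ?ltry.
have := cauchy_schwarz lf l1; rewrite mulrC /ip.
congr (_ <= _ * _).
under eq_Rintegral do rewrite -expr2 sqr_indic.
by rewrite /Rintegral integral_indic// setIT leb2_cell.
Qed.

End ehrling.

(** * The Green function of a disc *)

Section leb2_sigma_finite.
Context {R : realType}.
Local Notation plane := (measurableTypeR R * measurableTypeR R)%type.

(** A name of its own lets the product measure carry its sigma-finiteness, which
    Fubini's theorem on pairs of points of the plane requires. *)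
Definition leb2_fun : set plane -> \bar R := leb2 R.

HB.instance Definition _ := Measure.copy leb2_fun (leb2 R).

Let sigma_finite_leb2 : sigma_finite setT leb2_fun.
Proof.
exists (fun n => box n%:R).
  rewrite eqEsubset; split=> // z _; pose m := maxn (Num.bound `|z.1|) (Num.bound `|z.2|).
  exists m => //; have h (t : R) : (Num.bound `|t| <= m)%N -> t \in `[- m%:R, m%:R].
    move=> tm; rewrite in_itv/= -ler_norml (le_trans (ltW (archi_boundP (normr_ge0 t))))//.
    by rewrite ler_nat.
  by split; apply: h; rewrite ?leq_maxl ?leq_maxr.
by move=> n; split; [exact: measurable_box|exact: box_finite].
Qed.

HB.instance Definition _ := Measure_isSigmaFinite.Build _ _ _ leb2_fun sigma_finite_leb2.

Definition leb2s : {sigma_finite_measure set plane -> \bar R} := leb2_fun.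

End leb2_sigma_finite.

Section green_function.
Context {R : realType}.
Local Notation plane := (measurableTypeR R * measurableTypeR R)%type.
Local Notation lam := (@lebesgue_measure R).
Implicit Types x y : R * R.

Lemma dot_ge0 x : 0 <= dot x x.
Proof. by rewrite /dot addr_ge0// -expr2 sqr_ge0. Qed.

Let sqrtr_le_sqr (a b : R) : 0 <= b -> a <= b ^+ 2 -> Num.sqrt a <= b.
Proof. by move=> b0 /ler_wsqrtr; rewrite sqrtr_sqr ger0_norm. Qed.

Let sqr_le_sqrtr (a b : R) : 0 <= b -> b ^+ 2 <= a -> b <= Num.sqrt a.
Proof. by move=> b0 /ler_wsqrtr; rewrite sqrtr_sqr ger0_norm. Qed.

Lemma dotC x y : dot x y = dot y x.
Proof. by rewrite /dot; ring. Qed.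

Lemma dotB x y : dot (x - y) (x - y) = dot x x - 2 * dot x y + dot y y.
Proof. by rewrite /dot/=; ring. Qed.

Lemma disc_dot r x : disc r x -> dot x x < r ^+ 2.
Proof.
rewrite /disc/= /enorm => xr; have r0 := le_lt_trans (sqrtr_ge0 _) xr.
by rewrite -(sqr_sqrtr (dot_ge0 x)) ltrXn2r// ?nnegrE// ltW.
Qed.

(** The squared distance from [x] to the mirror image of [y], scaled so that it
    is symmetric and polynomial in the two points. *)
Definition mirror (r : R) x y : R :=
  r ^+ 2 - 2 * dot x y + dot x x * dot y y / r ^+ 2.

Lemma mirrorC r x y : mirror r x y = mirror r y x.
Proof. by rewrite /mirror (dotC x y) [dot x x * _]mulrC. Qed.

(** The reflected distance is [mirror] also at the origin, and the conventions
    [ln 0 = 0] and [1 / 0 = 0] make the formula hold on the diagonal. *)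
Lemma greenE r x y : 0 < r ->
  green r x y = ln (Num.sqrt (mirror r x y)) - ln (enorm (x - y)).
Proof.
move=> r0; have lnV' (t : R) : 0 <= t -> ln (1 / t) = - ln t.
  rewrite le_eqVlt => /predU1P[<-|t0]; first by rewrite invr0 mulr0 ln0// oppr0.
  by rewrite div1r lnV.
rewrite /green lnV' ?sqrtr_ge0// lnV'; last first.
  by case: ifP => _; [exact: ltW|exact: sqrtr_ge0].
rewrite opprK addrC; congr (ln _ - _); case: ifPn => [/eqP ->|x0].
  rewrite /mirror /dot/= !mul0r !addr0 mulr0 subr0 !mul0r addr0.
  by rewrite sqrtr_sqr gtr0_norm.
have xx : 0 < dot x x.
  rewrite lt_neqAle dot_ge0 andbT eq_sym; apply: contra x0 => /eqP.
  rewrite /dot => /eqP; rewrite paddr_eq0 -?expr2 ?sqr_ge0// !sqrf_eq0.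
  by case: x => a b /= /andP[/eqP -> /eqP ->].
have s0 : enorm x != 0 by rewrite gt_eqF// sqrtr_gt0.
have s2 : enorm x ^+ 2 = dot x x by rewrite sqr_sqrtr// dot_ge0.
rewrite /enorm; congr Num.sqrt; rewrite dotB /mirror -/(enorm x) -s2.
rewrite (_ : dot (_ *: x) (_ *: x) = (r / enorm x) ^+ 2 * dot x x); last first.
  by rewrite /dot/= /GRing.scale/=; ring.
rewrite (_ : dot (_ *: x) (_ *: y) = (r / enorm x) * (enorm x / r) * dot x y); last first.
  by rewrite /dot/= /GRing.scale/=; ring.
rewrite (_ : dot (_ *: y) (_ *: y) = (enorm x / r) ^+ 2 * dot y y); last first.
  by rewrite /dot/= /GRing.scale/=; ring.
by rewrite -s2; field; rewrite s0 gt_eqF.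
Qed.

Lemma greenC r x y : 0 < r -> green r x y = green r y x.
Proof.
move=> r0; rewrite !greenE// mirrorC; congr (_ - ln (Num.sqrt _)).
by rewrite /dot/=; ring.
Qed.

(** The positivity of the Green function: [mirror] exceeds the squared distance by
    (r^2 - |x|^2) (r^2 - |y|^2) / r^2. *)
Lemma mirror_ge r x y : 0 < r -> disc r x -> disc r y ->
  dot (x - y) (x - y) <= mirror r x y.
Proof.
move=> r0 /disc_dot xr /disc_dot yr.
rewrite -subr_ge0 (_ : _ - _ = (r ^+ 2 - dot x x) * (r ^+ 2 - dot y y) / r ^+ 2).
  by rewrite divr_ge0 ?mulr_ge0 ?subr_ge0 ?sqr_ge0// ltW.
by rewrite dotB /mirror; field; rewrite gt_eqF.
Qed.

Lemma mirror_le r x y : 0 < r -> disc r x -> disc r y ->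
  mirror r x y <= (2 * r) ^+ 2.
Proof.
move=> r0 /disc_dot xr /disc_dot yr.
have h1 : - 2 * dot x y <= dot x x + dot y y.
  have := dot_ge0 (x + y); rewrite /dot/=; nra.
have h2 : dot x x * dot y y / r ^+ 2 <= r ^+ 2.
  rewrite ler_pdivrMr ?exprn_gt0//; apply: ler_pM => //; try exact: dot_ge0.
    exact: ltW.
  exact: ltW.
by rewrite /mirror exprMn; move: h1 h2; move: xr yr; lra.
Qed.

Lemma enorm_ge1 x : `|x.1| <= enorm x.
Proof. by rewrite -sqrtr_sqr ler_wsqrtr// /dot expr2 lerDl -expr2 sqr_ge0. Qed.

(** The distance of two points is at least that of their first coordinates, and
    the reflected distance is at most [2 * r]. *)
Lemma normr_green_le r x y : 0 < r -> disc r x -> disc r y -> x.1 != y.1 ->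
  `|green r x y| <= ln (2 * r / `|x.1 - y.1|).
Proof.
move=> r0 dx dy xy; have xy0 : 0 < `|x.1 - y.1| by rewrite normr_gt0 subr_eq0.
have e0 : 0 < enorm (x - y) by apply: lt_le_trans (enorm_ge1 _).
have m0 : enorm (x - y) <= Num.sqrt (mirror r x y) by rewrite ler_wsqrtr// mirror_ge.
have m1 : Num.sqrt (mirror r x y) <= 2 * r.
  by apply: sqrtr_le_sqr; [lra|exact: mirror_le].
have m0' := lt_le_trans e0 m0.
rewrite greenE// ger0_norm; last by rewrite subr_ge0 ler_ln ?posrE.
rewrite ln_div ?posrE ?mulr_gt0// lerB// ler_ln ?posrE ?mulr_gt0//.
exact: (enorm_ge1 (x - y)).
Qed.

(** Seen from the unit disc the boundary is far away: the reflected distance is at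
    least [r / 2], whereas the distance is at most 2. *)
Lemma green_ge r x y : 2 <= r -> disc 1 x -> disc 1 y -> ln (r / 4) <= green r x y.
Proof.
move=> r2 /disc_dot; rewrite expr1n => x1 /disc_dot; rewrite expr1n => y1.
have r0 : 0 < r by lra.
have m : (r / 2) ^+ 2 <= mirror r x y.
  have h1 : 2 * dot x y <= dot x x + dot y y.
    have := dot_ge0 (x - y); rewrite /dot/=; nra.
  have : 0 <= dot x x * dot y y / r ^+ 2.
    by apply: divr_ge0; [apply: mulr_ge0; exact: dot_ge0|exact: sqr_ge0].
  have : 4 <= r ^+ 2 by nra.
  by rewrite /mirror exprMn; lra.
have m0 : r / 2 <= Num.sqrt (mirror r x y).
  by apply: sqr_le_sqrtr => //; lra.
rewrite greenE// (_ : r / 4 = r / 2 / 2); last by field.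
rewrite ln_div ?posrE ?divr_gt0// lerB//.
  have h0 : 0 < r / 2 by lra.
  by rewrite ler_ln ?posrE//; exact: lt_le_trans m0.
have := sqrtr_ge0 (dot (x - y) (x - y)); rewrite le_eqVlt => /predU1P[e0|e0].
  by rewrite /enorm -e0 ln0// ln_ge0// ler1n.
rewrite ler_ln ?posrE//; apply: sqrtr_le_sqr => //.
have : - 2 * dot x y <= dot x x + dot y y.
  have := dot_ge0 (x + y); rewrite /dot/=; nra.
by rewrite dotB; lra.
Qed.

End green_function.

(** * The Green function as a kernel *)

Section green_kernel.
Context {R : realType}.
Local Notation plane := (measurableTypeR R * measurableTypeR R)%type.
Implicit Types x y : plane.

(** Extended by zero, so that all integrals run over the whole plane. *)
Definition green_kernel (r : R) (z : plane * plane) : R :=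
  green r z.1 z.2 * (\1_(disc r) z.1 * \1_(disc r) z.2).

Let measurable_dot (f g : plane * plane -> plane) :
  measurable_fun setT f -> measurable_fun setT g ->
  measurable_fun setT (fun z => dot (f z) (g z)).
Proof.
move=> mf mg; apply: measurable_funD; apply: measurable_funM.
- exact: (measurableT_comp measurable_fst mf).
- exact: (measurableT_comp measurable_fst mg).
- exact: (measurableT_comp measurable_snd mf).
- exact: (measurableT_comp measurable_snd mg).
Qed.

Let measurable_sqrt : measurable_fun setT (@Num.sqrt R).
Proof. by apply: continuous_measurable_fun; exact: sqrt_continuous. Qed.

Lemma measurable_disc (r : R) : measurable (disc r : set plane).
Proof.
have m : measurable_fun setT (fun x : plane => enorm x).
  apply: (measurableT_comp measurable_sqrt); apply: measurable_funD.
    by apply: measurable_funM; exact: measurable_fst.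
  by apply: measurable_funM; exact: measurable_snd.
have -> : disc r = (fun x : plane => enorm x) @^-1` `]-oo, r[%classic.
  by rewrite eqEsubset; split=> x /=; rewrite in_itv.
by rewrite -[X in measurable X]setTI; apply: m => //; exact: measurable_itv.
Qed.

Lemma measurable_green_kernel (r : R) : 0 < r -> measurable_fun setT (green_kernel r).
Proof.
move=> r0; apply: measurable_funM; last first.
  apply: measurable_funM; apply: (measurableT_comp (measurable_indic _)) => //;
    exact: measurable_disc.
rewrite (_ : (fun z => _) = (fun z : plane * plane =>
    ln (Num.sqrt (mirror r z.1 z.2)) -
    ln (Num.sqrt (dot z.1 z.1 - 2 * dot z.1 z.2 + dot z.2 z.2)))).
  have m11 : measurable_fun setT (fun z : plane * plane => dot z.1 z.1).
    by apply: measurable_dot; exact: measurable_fst.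
  have m12 : measurable_fun setT (fun z : plane * plane => dot z.1 z.2).
    by apply: measurable_dot; [exact: measurable_fst|exact: measurable_snd].
  have m22 : measurable_fun setT (fun z : plane * plane => dot z.2 z.2).
    by apply: measurable_dot; exact: measurable_snd.
  apply: measurable_funB; apply: (measurableT_comp (@measurable_ln R));
    apply: (measurableT_comp measurable_sqrt).
    apply: measurable_funD; first by apply: measurable_funB => //; exact: measurable_funM.
    by apply: measurable_funM => //; exact: measurable_funM.
  by apply: measurable_funD => //; apply: measurable_funB => //; exact: measurable_funM.
by apply/funext => z; rewrite greenE// /enorm dotB.
Qed.

Lemma green_kernelC (r : R) x y : 0 < r -> green_kernel r (x, y) = green_kernel r (y, x).
Proof. by move=> r0; rewrite /green_kernel/= greenC// [\1__ _ * _]mulrC. Qed.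

Let width (r : R) k : R := 2 * r * 2^-1 ^+ k.

(* The logarithm of [s] is at most the number of powers of 2 below [s]. *)
Let ln_le_count (s : R) : 1 <= s ->
  exists n, ln s <= n%:R /\ forall k, (k < n)%N -> 2 ^+ k <= s.
Proof.
move=> s1; have ex : exists n, s < 2 ^+ n.
  exists (Num.bound s); apply: (lt_le_trans (archi_boundP (le_trans ler01 s1))).
  by rewrite -natrX ler_nat ltnW// ltn_expl.
have [n sn hn] := ex_minnP ex; exists n; split; last first.
  by move=> k kn; rewrite leNgt; apply/negP => /hn; rewrite leqNgt kn.
have s0 : 0 < s by lra.
apply: (@le_trans _ _ (ln (2 ^+ n))); first by rewrite ler_ln ?posrE ?exprn_gt0// ltW.
rewrite lnXn// -[leLHS]mulr_natl ler_piMr//.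
by have := @le_ln1Dx R 1; rewrite -natr1 => ->//; rewrite (lt_trans _ ltr01)// oppr_lt0.
Qed.

(** The logarithmic singularity is dominated by a sum of indicators of vertical strips of
    geometrically decreasing width around the first coordinate of the pole. *)
Lemma green_kernel_le (r : R) x y : 0 < r -> (`|green_kernel r (x, y)|%:E <=
  \sum_(k <oo) (\1_(`[x.1 - width r k, x.1 + width r k]) y.1)%:E)%E.
Proof.
move=> r0; have w0 k : 0 < width r k by rewrite !mulr_gt0// exprn_gt0.
suff [n [gn hn]] : exists n, `|green_kernel r (x, y)| <= n%:R /\ forall k, (k < n)%N ->
    `|x.1 - y.1| <= width r k.
  apply: (@le_trans _ _
      (\sum_(0 <= k < n) (\1_(`[x.1 - width r k, x.1 + width r k]) y.1)%:E)%E).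
    rewrite big_mkord (eq_bigr (fun=> 1%:E)); last first.
      move=> k _; rewrite indicE mem_set//=; have := hn k (ltn_ord k).
      rewrite distrC ler_norml in_itv/= => /andP[h1 h2].
      by apply/andP; split; lra.
    by rewrite sumEFin big_const_ord iter_addr_0 lee_fin.
  by apply: nneseries_lim_ge => k _ _; rewrite lee_fin.
rewrite /green_kernel/= !indicE.
have [dx|dx] := boolP (x \in disc r); last by exists 0%N; rewrite mul0r mulr0 normr0.
have [dy|dy] := boolP (y \in disc r); last by exists 0%N; rewrite !mulr0 normr0.
rewrite !mulr1; rewrite !inE in dx dy.
(* On the vertical line through the pole every strip contains [y], so the sum is
   infinite. *)
have [xy|xy] := eqVneq x.1 y.1.
  exists (Num.bound `|green r x y|); split; first exact/ltW/archi_boundP.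
  by move=> k _; rewrite xy subrr normr0 ltW.
have xy0 : 0 < `|x.1 - y.1| by rewrite normr_gt0 subr_eq0.
have xr : `|x.1| < r := le_lt_trans (enorm_ge1 x) dx.
have yr : `|y.1| < r := le_lt_trans (enorm_ge1 y) dy.
have [|n [ln hn]] := @ln_le_count (2 * r / `|x.1 - y.1|).
  rewrite ler_pdivlMr// mul1r (le_trans (ler_normB _ _))//.
  by move: xr yr; lra.
exists n; split; first exact: le_trans (normr_green_le _ _ _ _) ln.
move=> k /hn; rewrite ler_pdivlMr// => h.
by rewrite /width exprVn ler_pdivlMr ?exprn_gt0// mulrC.
Qed.

(** If the mass of [f ^+ 2] in vertical strips is at most [B] times the width, the
    geometric series of widths bounds the potential. *)
Lemma green_bounded_potential (r B : R) (f : plane -> R) : 0 < r ->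
  L2 (leb2 R) f ->
  (forall a b, a <= b ->
     \int[leb2 R]_y (f y ^+ 2 * \1_(`[a, b]) y.1) <= (b - a) * B) ->
  bounded_potential leb2s (green_kernel r) (8 * r * B) (fun y => f y ^+ 2).
Proof.
move=> r0 [mf lf] fB; split=> // x.
have w0 k : 0 < width r k by rewrite !mulr_gt0// exprn_gt0.
pose I k := `[x.1 - width r k, x.1 + width r k]%classic.
have mI k : measurable_fun setT (fun y : plane => \1_(I k) y.1 : R).
  apply: (measurableT_comp (measurable_indic _)) => //; exact: measurable_itv.
have mfI k : measurable_fun setT (fun y : plane => f y ^+ 2 * \1_(I k) y.1).
  by apply: measurable_funM => //; exact: measurable_funX.
have lfI k : L1 (leb2 R) (fun y => f y ^+ 2 * \1_(I k) y.1).
  apply: (le_L1 (mfI k) lf) => y; rewrite normrM ler_piMr//.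
  by rewrite ger0_norm// indicE lern1 leq_b1.
apply: (@le_trans _ _ (\int[leb2s]_y (\sum_(k <oo) (f y ^+ 2 * \1_(I k) y.1)%:E))%E).
  apply: ge0_le_integral => //.
  - apply/measurable_EFinP; apply: measurableT_comp => //; apply: measurable_funM.
      exact: (measurable_fun_pair2 x (measurable_green_kernel r0)).
    exact: measurable_funX.
  - apply: ge0_emeasurable_sum => [k y _ _|k _]; first by rewrite lee_fin mulr_ge0 ?sqr_ge0.
    exact/measurable_EFinP.
  - move=> y _; rewrite normrM [`|f y ^+ 2|]ger0_norm ?sqr_ge0// mulrC EFinM.
    under eq_eseriesr do rewrite EFinM.
    rewrite nneseriesZl ?sqr_ge0//.
    by rewrite lee_wpmul2l ?lee_fin ?sqr_ge0//; exact: green_kernel_le.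
rewrite integral_nneseries//; last 2 first.
  by move=> k; exact/measurable_EFinP.
  by move=> k y _; rewrite lee_fin mulr_ge0 ?sqr_ge0.
under eq_eseriesr do rewrite (L1_fin (lfI _)).
apply: nneseries_le => [k|n].
  by apply: Rintegral_ge0 => y _; rewrite mulr_ge0 ?sqr_ge0.
have B0 : 0 <= B.
  have := fB 0 1 ler01; rewrite subr0 mul1r; apply: le_trans.
  by apply: Rintegral_ge0 => y _; rewrite mulr_ge0 ?sqr_ge0.
apply: (@le_trans _ _ (\sum_(k < n) (4 * r * B * 2^-1 ^+ k))).
  apply: ler_sum => k _; apply: (le_trans (fB _ _ _)); first by have := w0 k; lra.
  by rewrite le_eqVlt; apply/orP; left; apply/eqP; rewrite /width; ring.
rewrite -mulr_sumr (_ : 8 * r * B = 4 * r * B * 2); last by ring.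
apply: ler_wpM2l; last by apply: sum_expr_le2; lra.
by apply: mulr_ge0 => //; apply: mulr_ge0 => //; exact: ltW.
Qed.

Lemma kform_green_ge (r C : R) (f : plane -> R) : 2 <= r -> L2 (leb2 R) f ->
  (forall x, ~ disc 1 x -> f x = 0) ->
  bounded_potential leb2s (green_kernel r) C (fun y => f y ^+ 2) ->
  ln (r / 4) * ip (leb2 R) f f ^+ 2 <=
    kform leb2s (green_kernel r) (fun x => f x ^+ 2) (fun x => f x ^+ 2).
Proof.
move=> r2 [mf lf] f0 bf; have r0 : 0 < r by lra.
have mK := measurable_green_kernel r0.
have kge x y : disc 1 x -> disc 1 y -> ln (r / 4) <= green_kernel r (x, y).
  move=> dx dy; have sub z : disc 1 z -> disc r z.
    by rewrite /disc/= => /lt_le_trans; apply; lra.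
  rewrite /green_kernel/= !indicE !mem_set ?mulr1; [exact: green_ge|exact: sub|exact: sub].
set m := ip _ _ _.
have pge x : disc 1 x -> ln (r / 4) * m <= potential leb2s (green_kernel r) (fun y => f y ^+ 2) x.
  move=> dx; rewrite /m /ip -RintegralZl//; apply: le_Rintegral => //.
  - exact: L1Z.
  - exact: (bounded_potential_L1 mK x bf).
  - move=> y _; have [dy|/f0 ->] := pselect (disc 1 y); last by rewrite expr0n !mulr0.
    by rewrite -expr2 ler_wpM2r ?sqr_ge0// kge.
rewrite expr2 mulrA {2}/m /ip -RintegralZl//; apply: le_Rintegral => //.
- exact: L1Z.
- exact: (L1_potentialM mK bf lf).
- move=> x _; have [dx|/f0 ->] := pselect (disc 1 x); last by rewrite expr0n !mulr0.
  by rewrite -expr2 ler_wpM2r ?sqr_ge0// pge.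
Qed.

End green_kernel.

(** * Test functions and their jets *)

Section test_jets.
Context {R : realType}.
Local Notation plane := (measurableTypeR R * measurableTypeR R)%type.
Local Notation e1 := ((1, 0) : R * R).
Local Notation e2 := ((0, 1) : R * R).
Implicit Types f g : R * R -> R.

Definition linf (a : R) f (b : R) g : R * R -> R := fun x => a * f x + b * g x.

Let linfE a f b g : linf a f b g = a \*: (f : R * R -> R^o) + b \*: (g : R * R -> R^o).
Proof. by []. Qed.

Let derivable_linf a f b g v x : derivable f x v -> derivable g x v ->
  derivable (linf a f b g) x v.
Proof.
by move=> df dg; rewrite linfE; apply: derivableD; exact: derivableZ.
Qed.

Let derive_linf a f b g v : (forall x, derivable f x v) -> (forall x, derivable g x v) ->
  'D_v (linf a f b g) = linf a ('D_v f) b ('D_v g).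
Proof.
move=> df dg; apply/funext => x.
rewrite linfE deriveD; [|exact: derivableZ|exact: derivableZ].
by rewrite !deriveZ.
Qed.

Let Ck_linf n a f b g : Ck n f -> Ck n g -> Ck n (linf a f b g).
Proof.
have cl f' g' : continuous f' -> continuous g' -> continuous (linf a f' b g').
  move=> cf cg x; apply: cvgD; apply: cvgM; [exact: cvg_cst|exact: cf|exact: cvg_cst|exact: cg].
elim: n f g => [|n ih] f g /=; first by move=> [cf _] [cg _]; split=> //; exact: cl.
move=> [cf [f1 f2 cf1 cf2]] [cg [g1 g2 cg1 cg2]]; split; first exact: cl.
split; [by move=> x; exact: derivable_linf|by move=> x; exact: derivable_linf| |].
- rewrite (derive_linf _ _ f1 g1); exact: (ih _ _ cf1 cg1).
- rewrite (derive_linf _ _ f2 g2); exact: (ih _ _ cf2 cg2).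
Qed.

Lemma test_function_linf D a f b g : test_function D f -> test_function D g ->
  test_function D (linf a f b g).
Proof.
move=> [sf kf Df] [sg kg Dg].
have sub : closure [set x | linf a f b g x != 0] `<=`
    closure [set x | f x != 0] `|` closure [set x | g x != 0].
  rewrite -closureU; apply: closureS => x /=; rewrite /linf => n0.
  have [fx|fx] := eqVneq (f x) 0; last by left.
  by right; apply: contra n0 => /eqP ->; rewrite fx !mulr0 addr0.
split.
- by move=> n; exact: Ck_linf.
- apply: (subclosed_compact _ _ sub); first exact: closed_closure.
  exact: compactU.
- by move=> x /sub[/Df|/Dg].
Qed.

Lemma test_function_C1 D f : test_function D f -> C1 f.
Proof. by move=> [sf _ _]; exact: smooth_C1. Qed.

Lemma test_function_out D f x : test_function D f -> ~ D x -> f x = 0.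
Proof.
move=> [_ _ fD] Dx; apply/eqP/negPn/negP => fx; apply: Dx; apply: fD.
exact: subset_closure.
Qed.

Lemma derive_test_function_out D f v x : test_function D f -> ~ D x -> 'D_v f x = 0.
Proof.
move=> [_ _ fD] Dx; transitivity ('D_v (cst (0 : R)) x); last by rewrite derive_cst.
apply: near_eq_derive.
have : open_nbhs x (~` closure [set x | f x != 0]).
  by split; [exact/closed_openC/closed_closure|move=> /fD].
move=> /open_nbhs_nbhs; apply: filterS => y /= fy.
by apply/eqP/negPn/negP => fy0; apply: fy; exact: subset_closure.
Qed.

Lemma test_function_box (r : R) f : test_function (disc r) f -> box_supported r f.
Proof.
move=> tf x xr; apply: (test_function_out tf) => xd; case: xr => /lt_gtF.
- by rewrite (le_lt_trans (enorm_ge1 x)).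
- by rewrite (le_lt_trans _ xd)// -sqrtr_sqr ler_wsqrtr// /dot expr2 lerDr -expr2 sqr_ge0.
Qed.

Lemma test_functionT_box f : test_function setT f -> exists M, box_supported M f.
Proof.
move=> [_ kf _]; have [M [_ hM]] := compact_bounded kf.
have h := hM (M + 1) (ltr_pwDr ltr01 (lexx M)); exists (M + 1) => x Mx.
apply/eqP/negPn/negP => fx; have cx : closure [set x | f x != 0] x.
  exact: subset_closure.
move: (h x cx) => /=.
rewrite /Num.norm/= ge_max => /andP[h1 h2].
by case: Mx; rewrite ltNge ?h1 ?h2.
Qed.

Definition jet_of f : jet plane R := (f, 'D_e1 f, 'D_e2 f).

Definition Tst (r : R) (F : jet plane R) :=
  exists2 f, test_function (disc r) f & F = jet_of f.

Let box_L2 M f : continuous f -> box_supported M f -> L2 (leb2 R) f.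
Proof.
move=> cf sf; split; first exact: continuous_measurable_plane.
apply: (@continuous_box_supported_L1 _ M); first by move=> x; apply: cvgM; exact: cf.
by move=> x /sf ->; rewrite expr0n.
Qed.

Lemma C1_L2J M f : C1 f -> box_supported M f -> L2J (leb2 R) (jet_of f).
Proof.
move=> [cf _ _ c1 c2] sf; split; first exact: box_L2 sf.
  exact: box_L2 c1 (box_supported_derive e1 sf).
exact: box_L2 c2 (box_supported_derive e2 sf).
Qed.

Lemma Tst_L2J r F : Tst r F -> L2J (leb2 R) F.
Proof.
by move=> [f tf ->]; exact: C1_L2J (test_function_C1 tf) (test_function_box tf).
Qed.

Lemma Tst_lin r a F b G : Tst r F -> Tst r G -> Tst r (lin a F b G).
Proof.
move=> [f tf ->] [g tg ->]; exists (linf a f b g); first exact: test_function_linf.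
have [_ f1 f2 _ _] := test_function_C1 tf; have [_ g1 g2 _ _] := test_function_C1 tg.
by rewrite /jet_of (derive_linf _ _ f1 g1) (derive_linf _ _ f2 g2).
Qed.

End test_jets.

(** * The Sobolev space of a disc *)

Section sobolev.
Context {R : realType}.
Local Notation plane := (measurableTypeR R * measurableTypeR R)%type.
Local Notation e1 := ((1, 0) : R * R).
Local Notation e2 := ((0, 1) : R * R).
Local Notation mu := (leb2 R).
Local Notation N F := (ipJ mu F F).
Local Notation H0 r := (jet_closure leb2s (@Tst R r)).

(** A bounded real sequence converges along an ultrafilter, hence is Cauchy along
    it. *)
Let ultra_close (x : nat -> R) (B : R) (U : set_system nat) : UltraFilter U ->
  (forall n, `|x n| <= B) -> forall e, 0 < e -> exists2 V, U V &
  forall n m, V n -> V m -> (x n - x m) ^+ 2 <= e.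
Proof.
move=> uU xB e e0; pose d := Num.sqrt e / 2.
have d0 : 0 < d by rewrite divr_gt0// sqrtr_gt0.
have cptB := @segment_compact R (- B) B.
have UB : (x @ U) `[- B, B]%classic.
  by apply: (@filterS _ U _ setT); [move=> n _; rewrite /= in_itv/= -ler_norml|exact: filterT].
have [p [_ clp]] : `[- B, B]%classic `&` cluster (x @ U) !=set0 by exact: cptB.
exists [set n | `|x n - p| < d]; last first.
  move=> n m /= xn xm; rewrite -(sqr_sqrtr (ltW e0)) -real_normK ?num_real//.
  apply: lerXn2r; rewrite ?nnegrE ?sqrtr_ge0//.
  have -> : x n - x m = (x n - p) - (x m - p) by ring.
  apply: le_trans (ler_normB _ _) _.
  have -> : Num.sqrt e = d + d by rewrite /d; field.
  by rewrite lerD// ltW.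
have [//|far] := in_ultra_setVsetC [set n | `|x n - p| < d] uU.
have := clp (~` ball p d) (ball p d).
have nb : nbhs p (ball p d) by exact: nbhsx_ballx.
have xfar : (x @ U) (~` ball p d).
  apply: (@filterS _ U _ _ _ _ far) => n xn xb; apply: xn; rewrite /= distrC; exact: xb.
by move=> /(_ xfar nb) [y []].
Qed.

Let ip_le_normJ2 (F : jet plane R) : ip mu F.1.1 F.1.1 + ip mu F.1.2 F.1.2 <= N F.
Proof. by rewrite /ipJ lerDl ip_ge0. Qed.

Lemma H0_L2J r F : H0 r F -> L2J mu F.
Proof. by case. Qed.

(** [strip_le] for the closure; the factor 2 comes from comparing [f ^+ 2] with the
    squares of an approximation and of the error. *)
Lemma H0_strip r F a b : H0 r F -> a <= b ->
  \int[mu]_y (F.1.1 y ^+ 2 * \1_(`[a, b]) y.1) <= (b - a) * (2 * N F).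
Proof.
move=> [lF [F_ [tF FF]]] ab; pose I := `[a, b]%classic : set (measurableTypeR R).
have mI : measurable_fun setT (fun y : plane => \1_I y.1 : R).
  apply: (measurableT_comp (measurable_indic _)) => //; exact: measurable_itv.
have lI g : L2 mu g -> L1 mu (fun y => g y ^+ 2 * \1_I y.1).
  move=> [mg lg]; apply: (le_L1 _ lg).
    by apply: measurable_funM => //; exact: measurable_funX.
  by move=> y; rewrite normrM ler_piMr// ger0_norm// indicE lern1 leq_b1.
have leI g : L2 mu g -> \int[mu]_y (g y ^+ 2 * \1_I y.1) <= ip mu g g.
  move=> lg; apply: le_Rintegral => //; [exact: lI|by case: lg|].
  by move=> y _; rewrite ler_piMr ?sqr_ge0// indicE lern1 leq_b1.
have bound n : \int[mu]_y (F.1.1 y ^+ 2 * \1_I y.1) <=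
    2 * ((b - a) * N (F_ n)) + 2 * N (lin 1 F (-1) (F_ n)).
  have [f tf FnE] := tF n; have lFn := Tst_L2J (tF n).
  have lf : L2 mu F.1.1 by case: lF.
  have lfn : L2 mu (F_ n).1.1 by case: lFn.
  have ld := L2B lf lfn.
  apply: (@le_trans _ _ (\int[mu]_y (2 * ((F_ n).1.1 y ^+ 2 * \1_I y.1) +
      2 * ((F.1.1 y - (F_ n).1.1 y) ^+ 2 * \1_I y.1)))).
    apply: le_Rintegral => //; first exact: lI.
      by apply: L1D; apply: L1Z; exact: lI.
    move=> y _; have i0 : 0 <= \1_I y.1 :> R by rewrite indicE ler0n.
    rewrite !mulrA -mulrDl ler_wpM2r//.
    have : 0 <= ((F_ n).1.1 y - (F.1.1 y - (F_ n).1.1 y)) ^+ 2 by exact: sqr_ge0.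
    move: ((F_ n).1.1 y) (F.1.1 y) => u v; nra.
  rewrite RintegralD//; [|by apply: L1Z; exact: lI|by apply: L1Z; exact: lI].
  rewrite !RintegralZl//; [|exact: lI|exact: lI].
  apply: lerD; rewrite ler_pM2l//; last first.
    apply: le_trans (leI _ ld) _; apply: le_trans (le_ip_normJ mu (lin 1 F (-1) (F_ n))).
    rewrite le_eqVlt; apply/orP; left; apply/eqP.
    by congr (ip _ _ _); apply/funext => y /=; ring.
  rewrite FnE; apply: le_trans (strip_le ab (test_function_C1 tf) (test_function_box tf)) _.
  rewrite ler_wpM2l ?subr_ge0//; apply: le_trans (ip_le_normJ2 (jet_of f)).
  have [l1 l2 _] := C1_L2J (test_function_C1 tf) (test_function_box tf).
  by rewrite RintegralD//; [case: l1|case: l2].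
have cR : 2 * ((b - a) * N (F_ n)) + 2 * N (lin 1 F (-1) (F_ n)) @[n --> \oo] -->
    2 * ((b - a) * N F) + 2 * 0.
  apply: cvgD; apply: cvgM; [exact: cvg_cst| |exact: cvg_cst|exact: FF].
  by apply: cvgM; [exact: cvg_cst|exact: (cvJ_normJ (fun n => Tst_L2J (tF n)) lF FF)].
rewrite mulrCA -[leRHS]addr0 -(mulr0 2).
by apply: (ler_cvg_to (cvg_cst _) cR); exact: nearW.
Qed.

Lemma H0_potential r F : 0 < r -> H0 r F ->
  bounded_potential leb2s (green_kernel r) (16 * r * N F) (fun x => F.1.1 x ^+ 2).
Proof.
move=> r0 HF; have lf : L2 mu F.1.1 by case: (H0_L2J HF).
rewrite (_ : 16 * r * N F = 8 * r * (2 * N F)); last by ring.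
apply: green_bounded_potential => // a b; exact: H0_strip HF.
Qed.

(** Rellich's theorem for test jets: along any ultrafilter a bounded sequence is
    Cauchy in L^2, since each of the finitely many averages in [ehrling] is. *)
Lemma Tst_compact r (F_ : nat -> jet plane R) : 0 < r -> (forall n, Tst r (F_ n)) ->
  (forall n, N (F_ n) <= 1) -> forall U : set_system nat, UltraFilter U ->
  forall e : R, 0 < e -> exists2 B, U B & forall n m, B n -> B m ->
    ip mu (fun x => (F_ n).1.1 x - (F_ m).1.1 x)
          (fun x => (F_ n).1.1 x - (F_ m).1.1 x) <= e.
Proof.
move=> r0 tF NF U uU e e0.
have e8 : 0 < e / 8 by lra.
have [A [s [A0 s0 hE]]] := ehrling (ltW r0) e8.
have cont n : continuous ((F_ n).1.1 : R * R -> R).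
  by have [f /test_function_C1[cf _ _ _ _] ->] := tF n.
have close (d : R) : 0 < d -> exists2 V, U V & forall n m, V n -> V m ->
    \sum_(p <- s) cell_mass (fun x => (F_ n).1.1 x - (F_ m).1.1 x) p ^+ 2 <= (size s)%:R * d.
  move=> d0; elim: s s0 {hE} => [|p s ih] s0.
    by exists setT; [exact: filterT|move=> n m _ _; rewrite big_nil mul0r].
  have [|V1 UV1 h1] := ih; first by move=> q qs; apply: s0; rewrite inE qs orbT.
  have p0 : 0 <= p.2 by apply: s0; rewrite inE eqxx.
  have bnd n : `|cell_mass (F_ n).1.1 p| <= p.2.
    rewrite -(ler_pXn2r (n := 2))// ?nnegrE// real_normK ?num_real//.
    have lfn : L2 mu (F_ n).1.1 by case: (Tst_L2J (tF n)).
    apply: le_trans (cell_mass_sqr_le p0 lfn) _; rewrite ler_piMr ?sqr_ge0//.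
    exact: le_trans (le_ip_normJ mu (F_ n)) (NF n).
  have [V2 UV2 h2] := ultra_close uU bnd d0.
  exists (V1 `&` V2); first exact: filterI.
  move=> n m [n1 n2] [m1 m2]; rewrite big_cons/= -natr1 mulrDl mul1r addrC lerD ?h1//.
  have -> : (fun x => (F_ n).1.1 x - (F_ m).1.1 x) =
    ((F_ n).1.1 : R * R -> R) - ((F_ m).1.1 : R * R -> R) by [].
  by rewrite cell_massB//; exact: h2.
pose d := e / (2 * (A * (size s)%:R + 1)).
have As : 0 < A * (size s)%:R + 1 by rewrite ltr_pwDr// mulr_ge0.
have d0 : 0 < d by rewrite divr_gt0// mulr_gt0.
have [V UV hV] := close d d0; exists V => // n m Vn Vm.
have := Tst_lin 1 (-1) (tF n) (tF m) => -[g tg gE].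
have gE1 : (fun x => (F_ n).1.1 x - (F_ m).1.1 x) = g.
  have := congr1 (fun F => F.1.1) gE => /= <-; apply/funext => x; ring.
have [lg1 lg2 lg3] := C1_L2J (test_function_C1 tg) (test_function_box tg).
have := hV n m Vn Vm; rewrite gE1 => hs.
apply: le_trans (hE g (test_function_C1 tg) (test_function_box tg)) _.
have hgrad : \int[mu]_z grad_sqr g z <= 4.
  apply: (@le_trans _ _ (N (lin 1 (F_ n) (-1) (F_ m)))).
    rewrite gE /ipJ -addrA /grad_sqr RintegralD//; [|by case: lg2|by case: lg3].
    by rewrite lerDr ip_ge0.
  apply: le_trans (normJ_lin_le 1 (-1) (Tst_L2J (tF n)) (Tst_L2J (tF m))) _.
  by have := NF n; have := NF m; lra.
have h1 : A * (\sum_(p <- s) cell_mass g p ^+ 2) <= A * ((size s)%:R * d).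
  by rewrite ler_wpM2l.
have h2 : A * ((size s)%:R * d) <= e / 2.
  rewrite mulrA /d mulrA ler_pdivrMr ?mulr_gt0//.
  rewrite (_ : e / 2 * _ = e * (A * (size s)%:R + 1)); last by field.
  by rewrite mulrC ler_pM2l// lerDl.
have h3 : e / 8 * \int[mu]_z grad_sqr g z <= e / 8 * 4 by rewrite ler_pM2l.
have eE : e = e / 2 + e / 8 * 4 by field.
by rewrite [leRHS]eE; apply: lerD (le_trans h1 h2) (le_trans _ h3).
Qed.

End sobolev.

(** * Representatives of Sobolev functions *)

Section weak_solutions.
Context {R : realType}.
Local Notation plane := (measurableTypeR R * measurableTypeR R)%type.
Local Notation e1 := ((1, 0) : R * R).
Local Notation e2 := ((0, 1) : R * R).
Local Notation mu := (leb2 R).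
Local Notation N F := (ipJ mu F F).
Local Notation H0 r := (jet_closure leb2s (@Tst R r)).
Implicit Types u v : H1 R.

Definition jet_of_H1 u : jet plane R :=
  ((u : R * R -> R), fun x => (wgrad u x).1, fun x => (wgrad u x).2).

Lemma jet_of_H1_L2J u : L2J mu (jet_of_H1 u).
Proof. by split; [exact: H1fun_L2|exact: wgrad1_L2|exact: wgrad2_L2]. Qed.

Let with_gradient (f : R * R -> R) (g : R * R -> R * R) : jet plane R :=
  (f, fun x => (g x).1, fun x => (g x).2).

Let integral_jet f g f' g' :
  L2J mu (with_gradient f g) -> L2J mu (with_gradient f' g') ->
  \int[mu]_x (dot (g x) (g' x) + f x * f' x) =
  ipJ mu (with_gradient f g) (with_gradient f' g').
Proof.
move=> lF lF'; have [l1 l2 l3] := lF; have [m1 m2 m3] := lF'.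
have [h1 h2 h3] := And3 (L2M l1 m1) (L2M l2 m2) (L2M l3 m3).
rewrite /ipJ/= /ip -!RintegralD//; [|exact: L1D].
by apply: eq_Rintegral => x _; rewrite /dot/=; ring.
Qed.

Lemma H1norm_sqr u : H1norm u = Num.sqrt (N (jet_of_H1 u)).
Proof.
have lu := jet_of_H1_L2J u.
by rewrite /H1norm /h1norm; congr Num.sqrt; exact: (integral_jet lu lu).
Qed.

Lemma H10_closure r u : H10 (disc r) u <-> H0 r (jet_of_H1 u).
Proof.
have lu := jet_of_H1_L2J u.
have E phi : test_function (disc r) phi ->
    h1norm (fun x => u x - phi x) (fun x => wgrad u x - grad phi x) =
    Num.sqrt (N (lin 1 (jet_of_H1 u) (-1) (jet_of phi))).
  move=> tphi; have lphi := C1_L2J (test_function_C1 tphi) (test_function_box tphi).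
  have ld : L2J mu (with_gradient (fun x => 1 * u x + -1 * phi x)
      (fun x => (1 * (wgrad u x).1 + -1 * 'D_e1 phi x, 1 * (wgrad u x).2 + -1 * 'D_e2 phi x))).
    exact: (L2J_lin 1 (-1) lu lphi).
  rewrite /h1norm; congr Num.sqrt; apply: etrans (integral_jet ld ld).
  by apply: eq_Rintegral => x _; rewrite /dot/=; ring.
split.
  move=> [phi [tphi cphi]]; split=> //; exists (fun n => jet_of (phi n)).
  split; first by move=> n; exists (phi n).
  rewrite /cvJ; set h := (fun n => h1norm _ _) in cphi.
  rewrite (_ : (fun n => ipJ _ _ _) = (fun n => h n * h n)).
    by rewrite -[0](mulr0 0); exact: (cvgM cphi cphi).
  by apply/funext => n; rewrite /h E// -expr2 sqr_sqrtr// normJ_ge0.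
move=> [_ [F_ [tF FF]]].
have /choice[phi hphi] : forall n, exists f,
    test_function (disc r) f /\ F_ n = jet_of f.
  by move=> n; have [f tf FE] := tF n; exists f.
exists phi; split; first by move=> n; case: (hphi n).
apply: (cvg0_sqr_le FF (B := 1)) => n; have [tn ->] := hphi n.
by rewrite E// sqr_sqrtr ?mulr1// normJ_ge0.
Qed.

(** That a jet is a function with its weak gradient means that it is orthogonal to
    the triples (d_1 phi, phi, 0) and (d_2 phi, 0, phi); orthogonality passes to
    limits. *)
Lemma H1_of_closure r F : H0 r F -> exists u, jet_of_H1 u = F.
Proof.
move=> [lF [F_ [tF FF]]]; have lF_ n := Tst_L2J (tF n).
have l0 : L2 mu (fun=> 0) := L2_0 mu.
case: F lF FF => -[f g1] g2 lF FF; have [/= lf lg1 lg2] := lF.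
have ip0 (h : plane -> R) : ip mu h (fun=> 0) = 0.
  by rewrite /ip; under eq_Rintegral do rewrite mulr0; rewrite Rintegral_cst ?mul0r.
have lim G : L2J mu G -> (forall n, ipJ mu (F_ n) G = 0) -> ipJ mu (f, g1, g2) G = 0.
  move=> lG h; have := cvJ_ipJ lF_ lF lG FF; rewrite (_ : (fun n => _) = fun=> 0).
    by move=> /(cvg_unique _) /(_ (cvg_cst 0)) ->.
  exact/funext.
have wg : weak_gradient f (fun x => (g1 x, g2 x)).
  move=> phi tphi; have cphi := test_function_C1 tphi.
  have [M sphi] := test_functionT_box tphi; have [lp lp1 lp2] := C1_L2J cphi sphi.
  split.
    have := @lim ('D_e1 phi, (phi : R * R -> R), fun=> 0) (And3 lp1 lp l0).
    rewrite /ipJ/= ip0 addr0 => H; apply/eqP; rewrite -addr_eq0; apply/eqP; apply: H => n.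
    have [fn tfn ->] := tF n; rewrite /= ip0 addr0.
    rewrite [X in X + _](integration_by_parts1 (test_function_C1 tfn) cphi sphi).
    exact: addNr.
  have := @lim ('D_e2 phi, fun=> 0, (phi : R * R -> R)) (And3 lp2 l0 lp).
  rewrite /ipJ/= ip0 addr0 => H; apply/eqP; rewrite -addr_eq0; apply/eqP; apply: H => n.
  have [fn tfn ->] := tF n; rewrite /= ip0 addr0.
  rewrite [X in X + _](integration_by_parts2 (test_function_C1 tfn) cphi sphi).
  exact: addNr.
by exists (@MkH1 R f (fun x => (g1 x, g2 x)) lf lg1 lg2 wg).
Qed.

(** Limits of test jets vanish almost everywhere outside the disc. The three
    components are treated uniformly through a projection [c]. *)
Let restrict_component r F (c : jet plane R -> plane -> R) g : H0 r F -> L2 mu g ->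
  (forall a G b H, c (lin a G b H) = (fun x => a * c G x + b * c H x)) ->
  (forall G, ip mu (c G) (c G) <= N G) -> (forall G, L2J mu G -> L2 mu (c G)) ->
  (forall G x, Tst r G -> ~ disc r x -> c G x = 0) ->
  \int[mu]_(x in disc r) (c F x * g x) = ip mu (c F) g.
Proof.
move=> [lF [F_ [tF FF]]] lg clin cN cL2 cout.
have lc := cL2 _ lF; have mD := @measurable_disc R r.
pose o x := c F x * \1_(~` disc r) x.
have mo : measurable_fun setT o.
  apply: measurable_funM; first by case: lc.
  by apply: measurable_indic; exact: measurableC.
have o0 : ip mu o o = 0.
  apply/eqP; rewrite eq_le ip_ge0 andbT.
  apply: (ler_cvg_to (cvg_cst _) FF); apply: nearW => n.
  apply: le_trans (cN _); rewrite clin.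
  apply: (proj2 (le_ip _ _ mo)).
    by apply: L2D; apply: L2Z => //; exact: (cL2 _ (Tst_L2J (tF n))).
  move=> x; rewrite /o indicE; have [xD|xD] := pselect (disc r x).
    by rewrite memNset ?mulr0 ?normr0//=; apply.
  by rewrite (cout _ x (tF n) xD) mulr0 addr0 mul1r mem_set// mulr1.
have lo : L2 mu o by apply: (proj1 (le_ip lc _ mo)) => x;
  rewrite /o normrM ler_piMr// ger0_norm// indicE lern1 leq_b1.
have og : ip mu o g = 0.
  have := cauchy_schwarz lo lg; rewrite o0 mul0r => h.
  by apply/eqP; rewrite -sqrf_eq0 eq_le h sqr_ge0.
have lcg := L2M lc lg.
rewrite Rintegral_indicM -[RHS]subr0 -og /ip -RintegralB//; last exact: L2M.
apply: eq_Rintegral => x _; rewrite /o !indicE in_setC.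
by case: (x \in disc r) => /=; ring.
Qed.

Lemma H0_restrict r u v : H10 (disc r) u ->
  \int[mu]_(x in disc r) (dot (wgrad u x) (wgrad v x) + u x * v x) =
  ipJ mu (jet_of_H1 u) (jet_of_H1 v).
Proof.
move=> /H10_closure hu; have [l1 l2 l3] := jet_of_H1_L2J u.
have [m1 m2 m3] := jet_of_H1_L2J v; have mD := @measurable_disc R r.
have iD h : L1 mu h -> mu.-integrable (disc r) (EFin \o h).
  by move=> lh; apply: integrableS lh.
have [h1 h2 h3] := And3 (L2M l1 m1) (L2M l2 m2) (L2M l3 m3).
have out f x : test_function (disc r) f -> ~ disc r x ->
    [/\ f x = 0, 'D_e1 f x = 0 & 'D_e2 f x = 0].
  by move=> tf xr; split; [exact: test_function_out xr|
    exact: derive_test_function_out xr|exact: derive_test_function_out xr].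
have E1 : \int[mu]_(x in disc r) ((jet_of_H1 u).1.1 x * (jet_of_H1 v).1.1 x) =
    ip mu (jet_of_H1 u).1.1 (jet_of_H1 v).1.1.
  apply: (@restrict_component r _ (fun F => F.1.1) _ hu m1) => //.
  - exact: le_ip_normJ.
  - by move=> G [].
  - by move=> G x [f tf ->] xr; have [] := out f x tf xr.
have E2 : \int[mu]_(x in disc r) ((jet_of_H1 u).1.2 x * (jet_of_H1 v).1.2 x) =
    ip mu (jet_of_H1 u).1.2 (jet_of_H1 v).1.2.
  apply: (@restrict_component r _ (fun F => F.1.2) _ hu m2) => //.
  - by move=> G; rewrite /ipJ -addrA addrCA lerDl addr_ge0// ip_ge0.
  - by move=> G [].
  - by move=> G x [f tf ->] xr; have [] := out f x tf xr.
have E3 : \int[mu]_(x in disc r) ((jet_of_H1 u).2 x * (jet_of_H1 v).2 x) =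
    ip mu (jet_of_H1 u).2 (jet_of_H1 v).2.
  apply: (@restrict_component r _ (fun F => F.2) _ hu m3) => //.
  - by move=> G; rewrite /ipJ addrC lerDl addr_ge0// ip_ge0.
  - by move=> G [].
  - by move=> G x [f tf ->] xr; have [] := out f x tf xr.
rewrite /ipJ -E1 -E2 -E3 -(RintegralD mD (iD _ h1) (iD _ h2)).
rewrite -(RintegralD mD (iD _ (L1D h1 h2)) (iD _ h3)).
by apply: eq_Rintegral => x _; rewrite /dot/=; ring.
Qed.

End weak_solutions.

(** * Solutions and ground states *)

Section ground_states.
Context {R : realType}.
Local Notation plane := (measurableTypeR R * measurableTypeR R)%type.
Local Notation mu := (leb2 R).
Local Notation N F := (ipJ mu F F).
Local Notation H0 r := (jet_closure leb2s (@Tst R r)).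
Local Notation A r := (kform leb2s (green_kernel r)).
Implicit Types u v : H1 R.

Let potentialE (r : R) (p : plane -> R) (x : plane) :
  potential leb2s (green_kernel r) p x =
  (\int[mu]_(y in disc r) (green r x y * p y)) * \1_(disc r) x.
Proof.
rewrite [in RHS]indicE /potential; case: (boolP (x \in disc r)) => xD.
  rewrite mulr1 (@Rintegral_indicM _ _ _ mu (disc r)); apply: eq_Rintegral => y _.
  by rewrite /green_kernel/= !indicE xD mul1r mulrAC.
rewrite mulr0; under eq_Rintegral do rewrite /green_kernel/= indicE (negbTE xD) mul0r mulr0 mul0r.
by rewrite Rintegral_cst ?mul0r.
Qed.

Let kform_disc (r : R) (p q : plane -> R) :
  \int[mu]_(x in disc r) ((\int[mu]_(y in disc r) (green r x y * p y)) * q x) = A r p q.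
Proof.
rewrite (@Rintegral_indicM _ _ _ mu (disc r)) /kform; apply: eq_Rintegral => x _.
by rewrite potentialE mulrAC.
Qed.

Lemma solutionE (r : R) u : solution r u <-> H0 r (jet_of_H1 u) /\
  forall v, H10 (disc r) v -> ipJ mu (jet_of_H1 u) (jet_of_H1 v) =
    A r (fun x => u x ^+ 2) (fun x => u x * v x).
Proof.
have E v : \int[mu]_(x in disc r)
      ((\int[mu]_(y in disc r) (green r x y * (u y) ^+ 2)) * u x * v x) =
    A r (fun x => u x ^+ 2) (fun x => u x * v x).
  by rewrite -kform_disc; apply: eq_Rintegral => x _; rewrite mulrA.
split=> [[hu eqn]|[hu eqn]].
  split; first exact/H10_closure.
  by move=> v hv; rewrite -E -eqn// H0_restrict.
have hu' : H10 (disc r) u by exact/H10_closure.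
by split=> // v hv; rewrite E H0_restrict// eqn.
Qed.

Let quartic_disc (r : R) u : 0 < r -> H0 r (jet_of_H1 u) ->
  \int[mu]_(y in disc r) (\int[mu]_(x in disc r)
    (green r x y * `|u y| ^+ 2 * `|u x| ^+ 2)) =
  A r (fun x => u x ^+ 2) (fun x => u x ^+ 2).
Proof.
move=> r0 hu; rewrite -kform_disc; apply: eq_Rintegral => y; rewrite inE => yD.
have mD := @measurable_disc R r.
rewrite -RintegralZr//; last first.
  apply/(integrable_indicM mu _ mD).
  have := bounded_potential_L1 (measurable_green_kernel r0) y (H0_potential r0 hu).
  congr (L1 _ _); apply/funext => x; rewrite /green_kernel/= indicE mem_set// mul1r.
  by rewrite mulrAC.
apply: eq_Rintegral => x _; rewrite !real_normK ?num_real// greenC//.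
by rewrite mulrAC.
Qed.

(** Testing the equation with [u] identifies the quartic part with the norm:
    1 / 2 - 1 / 4 = 1 / 4. *)
Lemma energy_solution (r : R) u : 0 < r -> solution r u ->
  energy r u = N (jet_of_H1 u) / 4.
Proof.
move=> r0 su; have [hu eqn] := (solutionE r u).1 su; have [hu10 _] := su.
rewrite /energy quartic_disc//; have := eqn u hu10.
under [X in A r _ X]funext do rewrite -expr2.
move=> <-; have -> : \int[mu]_(x in disc r) (dot (wgrad u x) (wgrad u x) + `|u x| ^+ 2) =
    N (jet_of_H1 u).
  rewrite -(H0_restrict u hu10); apply: eq_Rintegral => x _.
  by rewrite real_normK ?num_real// expr2.
by field.
Qed.

(** If all test functions were null, so would be their limit [u]. *)
Lemma nontrivial_test (u : H1 R) (r : R) : H10 (disc r) u -> ~ trivial u ->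
  exists2 f, test_function (disc r) f & 0 < ip mu f f.
Proof.
move=> hu nu; apply: contrapT => h; apply: nu.
have [lF [F_ [tF FF]]] := (H10_closure r u).1 hu.
have [lu _ _] := lF; have z : ip mu u u = 0.
  apply/eqP; rewrite eq_le ip_ge0 andbT.
  have cR : 2 * N (lin 1 (jet_of_H1 u) (-1) (F_ n)) @[n --> \oo] --> 2 * (0 : R).
    by apply: cvgM; [exact: cvg_cst|exact: FF].
  rewrite -(mulr0 2); apply: (ler_cvg_to (cvg_cst _) cR); apply: nearW => n.
  have [f tf Fn] := tF n; have lf := C1_L2J (test_function_C1 tf) (test_function_box tf).
  have [lf1 _ _] := lf.
  have f0 : ip mu f f = 0.
    apply/eqP; rewrite eq_le ip_ge0 andbT leNgt; apply/negP => fp; apply: h.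
    by exists f.
  have fu : ip mu u f = 0.
    have := cauchy_schwarz lu lf1; rewrite f0 mulr0 => c.
    by apply/eqP; rewrite -sqrf_eq0 eq_le c sqr_ge0.
  have := le_ip_normJ mu (lin 1 (jet_of_H1 u) (-1) (F_ n)).
  rewrite Fn; have -> : (lin 1 (jet_of_H1 u) (-1) (jet_of f)).1.1 =
    (fun x => u x + -1 * f x) by apply/funext => x /=; rewrite mul1r.
  rewrite (ip_expand (-1) lu lf1) fu f0 !mulr0 !addr0 => H.
  by apply: le_trans H _; rewrite ler_peMl ?normJ_ge0// ler1n.
have [mu_ lu2] := lu.
have ae0 : (\int[mu]_x `|(u x ^+ 2)%:E| = 0)%E.
  under eq_integral do rewrite abse_EFin ger0_norm ?sqr_ge0//.
  by rewrite L1_fin//; move: z; rewrite /ip => ->.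
have mu2 : measurable_fun setT (fun x : plane => (u x ^+ 2)%:E).
  exact/measurable_EFinP/measurable_funX.
have := (ae_eq_integral_abs mu measurableT mu2).1 ae0.
apply: filterS => x /(_ I) ux; have /eqP : u x ^+ 2 = 0 by exact: EFin_inj.
by rewrite sqrf_eq0 => /eqP.
Qed.

Lemma solution_nontrivial (r : R) u : 0 < r -> solution r u ->
  0 < N (jet_of_H1 u) -> ~ trivial u.
Proof.
move=> r0 su Nu tu; have [hu eqn] := (solutionE r u).1 su; have [hu10 _] := su.
have [[mu_ lu2] _ _] := jet_of_H1_L2J u.
have bu := H0_potential r0 hu.
have := normr_kform_le (measurable_green_kernel r0) bu lu2.
have -> : \int[leb2s]_x `|u x ^+ 2| = 0.
  rewrite /Rintegral (@ae_eq_int _ _ _ mu (fun x => `|u x ^+ 2|) (fun=> 0)).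
  - by rewrite integral0.
  - by apply: measurableT_comp => //; exact: measurable_funX.
  - by [].
  - case: tu => B [mB B0 uB]; exists B; split=> // x /= ux; apply: uB => /= u0.
    by apply: ux; rewrite u0 expr0n normr0.
rewrite mulr0 normr_le0 => /eqP A0.
by move: Nu; rewrite eqn//; under [X in A r _ X]funext do rewrite -expr2;
  rewrite A0 ltxx.
Qed.

Lemma Tst_sub (r s : R) F : r <= s -> Tst r F -> Tst s F.
Proof.
move=> rs [f [sf kf fD] ->]; exists f => //; split=> // x /fD.
by rewrite /disc/= => /lt_le_trans; apply.
Qed.

(** The energy of a ground state is at most that of the rescaled maximizer of
    the quartic form, and a fixed test function [f] in the unit disc bounds the
    latter by a multiple of [1 / ln (r / 4)]. *)
Lemma ground_state_bound f (r : R) u : 4 < r -> test_function (disc 1) f ->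
  0 < ip mu f f -> ground_state r u ->
  N (jet_of_H1 u) <= N (jet_of f) ^+ 2 / (ln (r / 4) * ip mu f f ^+ 2).
Proof.
move=> r4 tf f0 [su nu min_u]; have r0 : 0 < r by lra.
have mK := measurable_green_kernel r0.
have symK x y := @green_kernelC R r x y r0.
have tF1 : Tst 1 (jet_of f) by exists f.
have tF : Tst r (jet_of f) by apply: Tst_sub tF1; lra.
have tL2 F : Tst r F -> L2J leb2s F by exact: Tst_L2J.
have cF := Tst_closure tL2 tF.
have L0 : 0 < ln (r / 4) by apply: ln_gt0; rewrite ltr_pdivlMr//; lra.
have [lf _ _] := Tst_L2J tF.
have qF : ln (r / 4) * ip mu f f ^+ 2 <= quartic leb2s (green_kernel r) (jet_of f).
  apply: (kform_green_ge _ lf _ (H0_potential r0 cF)); first lra.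
  by move=> x; exact: test_function_out.
have q0 : 0 < ln (r / 4) * ip mu f f ^+ 2 by rewrite mulr_gt0// exprn_gt0.
have [U [cU NU EL best]] := critical_jet_exists mK symK tL2 (@Tst_lin R r)
  (ltW (mulr_gt0 (ltr0n R 16) r0)) (fun F => @H0_potential R r F r0)
  (fun F_ => @Tst_compact R r F_ r0) tF (lt_le_trans q0 qF).
have [w wU] := H1_of_closure cU.
have sw : solution r w.
  apply/solutionE; rewrite wU; split=> // v /H10_closure hv.
  by have := EL _ hv; rewrite -wU.
have nw : ~ trivial w by apply: (solution_nontrivial r0 sw); rewrite wU.
have := min_u w sw nw; rewrite !energy_solution// ler_pM2r ?invr_gt0// wU.
move=> /le_trans; apply; rewrite ler_pdivlMr//.
by apply: le_trans (best _ tF); rewrite ler_pM2l.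
Qed.

End ground_states.

Theorem theorem1p3 (R : realType) (u : R -> H1 R)
    (hu : forall r : R, 0 < r -> positive_ground_state r (u r)) :
  H1norm (u r) @[r --> +oo] --> (0 : R).
Proof.
(* The ground state at radius 1 supplies the fixed test function. *)
have [[[h1 _] n1 _] _] := hu 1 ltr01.
have [f tf f0] := nontrivial_test h1 n1.
set c := ipJ (leb2 R) (jet_of f) (jet_of f) ^+ 2 / ip (leb2 R) f f ^+ 2.
have c0 : 0 <= c by rewrite divr_ge0 ?sqr_ge0.
apply/cvgr0Pnorm_lt => e e0; have e2 : 0 < e ^+ 2 by rewrite exprn_gt0.
near=> r.
have r4 : 4 < r by near: r; exact: nbhs_pinfty_gt.
(* From this radius on, c / ln (r / 4) < e ^+ 2. *)
have rc : 4 * expR (c / e ^+ 2) < r by near: r; exact: nbhs_pinfty_gt.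
have r0 : 0 < r by lra.
have [gs _] := hu r r0; have := ground_state_bound r4 tf f0 gs.
have lr : c / e ^+ 2 < ln (r / 4).
  by rewrite -[ltLHS]expRK ltr_ln ?posrE ?expR_gt0 ?divr_gt0// ltr_pdivlMr// mulrC.
have l0 : 0 < ln (r / 4) by apply: le_lt_trans lr; rewrite divr_ge0// ltW.
rewrite [ln _ * _]mulrC invfM mulrA -/c => b.
rewrite H1norm_sqr ger0_norm ?sqrtr_ge0// -[ltRHS]gtr0_norm// -sqrtr_sqr ltr_sqrt//.
apply: le_lt_trans b _; rewrite ltr_pdivrMr//.
by move: lr; rewrite ltr_pdivrMr// mulrC.
Unshelve. all: by end_near.
Qed.
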